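(* Let $T\in F[d_x,d_y]$ be a linear partial differential operator of order $n$. Then: (i) the equation $T=0$ has a generic fractional-derivatives series solution; (ii) the sum of the multiplicities of the generic solutions of $T=0$ does not exceed $n$; (iii) the denominator of every generic solution is less than $n^{O(\log n)}$, i.e. there is an absolute constant $c$ such that for $n\ge2$ the denominator $q$ of every generic solution satisfies $q<n^{c\log n}$.
   Context: $F$ is a differentially closed (universal in the sense of Kolchin) differential field of characteristic $0$ with two commuting derivations $d_x,d_y$; $F[d_x,d_y]$ is the ring of linear partial differential operators over $F$. For $T=\sum_{i+j\le n}b_{i,j}d_x^id_y^j$ of order $n$, $\mathrm{symb}(T)=\sum_{i+j=n}b_{i,j}\xi^i\eta^j$ is a homogeneous polynomial in formal variables $\xi,\eta$. **Fractional-derivatives series.** Let $k_0\ge1$, let $1>s_2>\cdots>s_{k_0}>0$ be rational numbers and $f_1,\dots,f_{k_0}\in F$. The symbol $G=G^{(0)}=G_{s_2,\dots,s_{k_0}}(f_1,\dots,f_{k_0})$ comes with $F$-linearly independent formal symbols $\{G^{(s)}\}_{s\in\mathbb Q}$ and the rule, for $d=d_x$ and $d=d_y$, $dG^{(s)}=(df_1)G^{(1+s)}+(df_2)G^{(s_2+s)}+\cdots+(df_{k_0})G^{(s_{k_0}+s)}$. Let $q$ be the common denominator of $s_2,\dots,s_{k_0}$ ($q=1$ if $k_0=1$), called the denominator. A fractional-derivatives series is a formal series $H=\sum_{0\le i<\infty}h_iG^{(s_0-i/q)}$ with $h_i\in F$, $s_0q\in\mathbb Z$. Operators act termwise via the Leibniz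 rule and the rule above; $H$ is a solution of $T=0$ if $TH=0$. **The construction procedure.** Start: choose a linear factor $a_1\xi+a_2\eta$ of $\mathrm{symb}(T)$ and $f_1\in F$ with $a_1d_xf_1+a_2d_yf_1=0$, $(d_xf_1,d_yf_1)\neq(0,0)$, and put $s_1=1$. Suppose $f_1,\dots,f_k\in F$ and $1=s_1>s_2>\cdots>s_k>0$ have been constructed ($k\ge1$). *Polygon $P_{k+1}$.* Let $h,\varphi$ be differential indeterminates over $F$ and $\sigma$ a formal exponent. Expand $T(hG)$ using $dG^{(s)}=\sum_{1\le i\le k}(df_i)G^{(s_i+s)}+(d\varphi)G^{(\sigma+s)}$ and write the result as $\sum_{(j,t)}C_{j,t}G^{(j+\sigma t)}$, where $j\in\mathbb Q_{\ge0}$, $t\in\mathbb Z_{\ge0}$, and $C_{j,t}$ is a differential polynomial in $h,\varphi$ over $F$, linear homogeneous in $h$ and its derivatives and homogeneous of degree $t$ in the derivatives of $\varphi$. $P_{k+1}$ is the convex hull of $(0,0)$ and all $(j,t)$ with $C_{j,t}\ne0$. The slope of a line $\{j+ct=\mathrm{const}\}$ is $c$. *Continuing step.* Choose an edge $L_{k+1}$ of $P_{k+1}$ with slope $s_{k+1}$, $0<s_{k+1}<s_k$. Put $Q_{k+1}=\sum_{(j,t)\in L_{k+1}}C_{j,t}$; it has the form $h$ times a polynomial in $v_1=d_x\varphi,v_2=d_y\varphi$ over $F$, which is again denoted $Q_{k+1}$ below. Choose $f_{k+1}\in F$ with $Q_{k+1}(d_xf_{k+1},d_yf_{k+1})=0$.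 *Terminal step.* If $P_{k+1}$ has a right-hand vertical edge (slope $0$, contained in the line $j=\max$), with upper endpoint $(j_5,t_5)$ and lower endpoint $(j_5,0)$, one may stop: put $k_0=k$, $\bar B=C_{j_5,0}$, choose a non-zero $h_0\in F$ with $\bar B(h_0)=0$, and choose $h_1,h_2,\dots\in F$ successively from the equations $\bar B(h_i)=r_i$ (with $r_i\in F$ determined by the previous choices) obtained by equating to zero the coefficients of $T\bigl(\sum_{i\ge0}h_iG^{(-i/q)}\bigr)$. **Generic solutions.** For $k\ge2$ factor the (non-homogeneous) polynomial $Q_k=\beta_1^{m_1}\cdots\beta_l^{m_l}\beta$ over $F$ with $\beta$ homogeneous and $\beta_1,\dots,\beta_l$ irreducible, non-homogeneous and pairwise non-proportional. The generic case occurs for $f_k$ if $\beta_i(d_xf_k,d_yf_k)=0$ for some $i$ with $m_i=\min\{m_1,\dots,m_l\}$ and $(d_xf_k,d_yf_k)$ is a non-singular point of the plane curve $\{Q_k=0\}$ (with its reduced structure). A solution produced by the procedure is generic if the generic case occurs for each of $f_2,\dots,f_{k_0}$ (for $k_0=1$ it is always generic). **Multiplicity.** To the set of all generic solutions following the same branch of the tree of the procedure one assigns the multiplicity $t_5$, where $(j_5,t_5)$ is the upper endpoint of the slope-$0$ edge at the terminal step. Here the set of all $f_k$ satisfying the generic case for a given factor $\beta_i$ of $Q_k$ is treated as one choice (represented by any one of its members, and likewise the set of all $f_1$ for a given linear factor of the symbol), so that a branch is a sequence of choices of a linear factor of $\mathrm{symb}(T)$, of leading edges and of factors $\beta_i$,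 ended by a terminal step; the sum in (ii) is over all such branches. *)

(* Defs.v *)
(* The real numbers of Stdlib are used, through qualified names, only for the
   bound n^(c log n). *)
From HB Require Import structures.
From mathcomp Require Import all_boot all_order all_algebra finmap.
From mathcomp.multinomials Require Import mpoly.
From mathcomp.multinomials Require monalg.
Import -(notations) monalg.
Import mpoly.
From Stdlib Require Reals.

Set Implicit Arguments.
Unset Strict Implicit.
Unset Printing Implicit Defensive.

Import Order.TTheory GRing.Theory Num.Theory.

Local Open Scope ring_scope.

Definition derivation (A : nzRingType) (d : A -> A) : Prop :=
  (forall x y, d (x + y) = d x + d y) /\
  (forall x y, d (x * y) = d x * y + x * d y).

Definition differential_field (F : fieldType) (dx dy : F -> F) : Prop :=
  [/\ derivation dx, derivation dy & forall x, dx (dy x) = dy (dx x)].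

Definition diff_morphism (F K : fieldType) (dx dy : F -> F) (ex ey : K -> K)
    (f : F -> K) : Prop :=
  forall x, f (dx x) = ex (f x) /\ f (dy x) = ey (f x).

(* The ring F{u_i : i in I} of differential polynomials: polynomials over F in
   the variables (u, (i, j)), which stand for d_x^i d_y^j u. *)
Notation dpoly F I := (malg (cmonom (I * (nat * nat))%type) F).

Section DiffPoly.
Context {F : fieldType} {I : choiceType}.
Local Notation var := (I * (nat * nat))%type.

Definition dvar (u : I) (i j : nat) : dpoly F I := mkmalgU (ucm (u, (i, j))) 1.

Definition up_x (v : var) : var := (v.1, (v.2.1.+1, v.2.2)).
Definition up_y (v : var) : var := (v.1, (v.2.1, v.2.2.+1)).

(* The derivation which is d on the coefficients and v |-> up v on the
   variables. *)
Definition dpoly_der (d : F -> F) (up : var -> var) (p : dpoly F I) :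
    dpoly F I :=
  \sum_(m <- monalg.msupp p)
    (mkmalgU m (d (monalg.mcoeff m p)) +
     \sum_(v <- finsupp m)
       mkmalgU (mulcm (divcm m (ucm v)) (ucm (up v)))
         (monalg.mcoeff m p *+ m v)).

(* The value of p when u is replaced by a u, coefficients being mapped by f. *)
Definition dpoly_eval (K : fieldType) (ex ey : K -> K) (f : F -> K)
    (a : I -> K) (p : dpoly F I) : K :=
  monalg.mmap f
    (fun m : cmonom var =>
       \prod_(v <- finsupp m)
         iter v.2.1 ex (iter v.2.2 ey (a v.1)) ^+ m v) p.

End DiffPoly.

Definition differentially_closed (F : fieldType) (dx dy : F -> F) : Prop :=
  forall (m : nat) (ps : seq (dpoly F 'I_m)) (r : dpoly F 'I_m),
    (exists (K : fieldType) (ex ey : K -> K) (f : {rmorphism F -> K})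
        (a : 'I_m -> K),
      [/\ differential_field ex ey, diff_morphism dx dy ex ey f,
          {in ps, forall p, dpoly_eval ex ey f a p = 0}
        & dpoly_eval ex ey f a r != 0]) ->
    exists a : 'I_m -> F,
      {in ps, forall p, dpoly_eval dx dy id a p = 0} /\
      dpoly_eval dx dy id a r != 0.

Definition diff_subfield (K : fieldType) (ex ey : K -> K) (S : K -> Prop) :
    Prop :=
  [/\ S 1, forall x y, S x -> S y -> S (x - y),
      forall x y, S x -> S y -> S (x * y), forall x, S x -> S x^-1
    & forall x, S x -> S (ex x) /\ S (ey x)].

(* K is finitely generated, as a differential field, over the subset B. *)
Definition diff_fin_gen (K : fieldType) (ex ey : K -> K) (B : K -> Prop) :
    Prop :=
  exists s : seq K, forall S : K -> Prop,
    diff_subfield ex ey S -> (forall x, B x -> S x) ->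
    (forall x, x \in s -> S x) -> forall x, S x.

(* Kolchin: F is universal if for every finitely generated differential
   subfield G of F, every finitely generated differential extension H of G
   embeds in F over G.  (A field which is a universal extension of some
   differential field is universal in this sense.) *)
Definition kolchin_universal (F : fieldType) (dx dy : F -> F) : Prop :=
  forall (G H : fieldType) (gx gy : G -> G) (hx hy : H -> H)
      (f : {rmorphism G -> F}) (i : {rmorphism G -> H}),
    differential_field gx gy -> differential_field hx hy ->
    diff_morphism gx gy dx dy f -> diff_morphism gx gy hx hy i ->
    diff_fin_gen gx gy (fun=> False) ->
    diff_fin_gen hx hy (fun y => exists x, y = i x) ->
    exists k : {rmorphism H -> F},
      diff_morphism hx hy dx dy k /\ forall x, k (i x) = f x.

(* Linear partial differential operators, in normal form: 'X_[m] stands for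
   d_x^(m 0) d_y^(m 1).  The product of {mpoly F[2]} is not the composition of
   operators; it is only used for symbols. *)
Notation lpdo F := {mpoly F[2]}.

Definition has_order (F : fieldType) (T : lpdo F) (n : nat) : Prop :=
  msize T = n.+1.

Definition symb (F : fieldType) (T : lpdo F) : {mpoly F[2]} :=
  pihomog mdeg (msize T).-1 T.

Section PlaneCurves.
Context {F : fieldType}.
Implicit Types p q r : {mpoly F[2]}.

Definition mdivides p q : Prop := exists r, q = r * p.

Definition mirreducible p : Prop :=
  [/\ p != 0, p \isn't a GRing.unit
    & forall q r, p = q * r -> q \is a GRing.unit \/ r \is a GRing.unit].

Definition msquarefree p : Prop :=
  forall q, mdivides (q ^+ 2) p -> q \is a GRing.unit.

(* r is an equation of the curve {q = 0} with its reduced structure. *)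
Definition reduced_equation q r : Prop :=
  [/\ msquarefree r, mdivides r q & exists N, mdivides q (r ^+ N)].

Definition nonsingular_point q (v : 'I_2 -> F) : Prop :=
  exists r, [/\ reduced_equation q r, r.@[v] = 0
              & exists i, (r^`M(i)).@[v] != 0].

Definition factorization q (fs : seq ({mpoly F[2]} * nat)) b : Prop :=
  [/\ q = \prod_(x <- fs) x.1 ^+ x.2 * b,
      b \is homog mdeg,
      {in fs, forall x, [/\ mirreducible x.1, x.1 \isn't homog mdeg
                          & (0 < x.2)%N]}
    & forall i j, (i < j < size fs)%N ->
        ~ exists c : F, (nth (0, 0%N) fs i).1 = c *: (nth (0, 0%N) fs j).1].

Definition generic_case q p (v : 'I_2 -> F) : Prop :=
  exists fs b m,
    [/\ factorization q fs b, (p, m) \in fs, {in fs, forall x, (m <= x.2)%N},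
        p.@[v] = 0 & nonsingular_point q v].

End PlaneCurves.

Definition convex_hull (s : seq (rat * rat)) (p : rat * rat) : Prop :=
  exists w : rat * rat -> rat,
    [/\ {in s, forall u, 0 <= w u}, \sum_(u <- s) w u = 1
      & p = (\sum_(u <- s) w u * u.1, \sum_(u <- s) w u * u.2)].

(* The line {j + c t = M}, of slope c, contains an edge of P. *)
Definition edge_line (P : rat * rat -> Prop) (c M : rat) : Prop :=
  ((forall p, P p -> p.1 + c * p.2 <= M) \/
   (forall p, P p -> M <= p.1 + c * p.2)) /\
  exists p p', [/\ P p, P p', p <> p', p.1 + c * p.2 = M
                 & p'.1 + c * p'.2 = M].

(* (j, t) and (j, 0) are the endpoints of a right-hand vertical edge of P. *)
Definition right_vertical_edge (P : rat * rat -> Prop) (j : rat) (t : nat) :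
    Prop :=
  [/\ edge_line P 0 j, forall p, P p -> p.1 <= j,
      P (j, t%:R) /\ (forall t', P (j, t') -> t' <= t%:R)
    & P (j, 0) /\ (forall t', P (j, t') -> 0 <= t')].

Section FractionalDerivatives.
Context {F : fieldType} (dx dy : F -> F).

(* The symbol G = G_{s_2, ..., s_k}(f_1, ..., f_k) is given by the sequence of
   the pairs (s_i, f_i), with s_1 = 1. *)
Implicit Type g : seq (rat * F).

Definition gradient (f : F) : 'I_2 -> F :=
  fun i => if i == ord0 then dx f else dy f.

Definition denominator g : nat := \big[lcmn/1%N]_(x <- g) `|denq x.1|%N.

(* A formal series of symbols G^(s) is given by the function mapping s to the
   coefficient of G^(s); this is the action on it of d = dx or d = dy. *)
Definition series_der (d : F -> F) g (H : rat -> F) : rat -> F :=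
  fun s => d (H s) + \sum_(x <- g) d x.2 * H (s - x.1).

Definition series_app (T : lpdo F) g (H : rat -> F) : rat -> F :=
  fun s => \sum_(m <- msupp T)
    T@_m * iter (m ord0) (series_der dx g)
             (iter (m ord_max) (series_der dy g) H) s.

(* \sum_(0 <= i < oo) h_i G^(s0 - i / q) *)
Definition frac_series (s0 : rat) (q : nat) (h : nat -> F) : rat -> F :=
  fun s => if (s0 - s) * q%:R \is a Num.nat
           then h (Num.truncn ((s0 - s) * q%:R)) else 0.

Definition is_solution (T : lpdo F) g (H : rat -> F) : Prop :=
  forall s, series_app T g H s = 0.

(* The expansion of T(hG): the differential indeterminates h and phi are those
   of index 0 and 1, and the coefficient at (j, t) is the one of
   G^(j + sigma t). *)
Notation expansion := (malg (rat * nat)%type (dpoly F 'I_2)).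

Definition ind_h : 'I_2 := ord0.
Definition ind_phi : 'I_2 := ord_max.

Definition expansion_der (d : F -> F)
    (up : 'I_2 * (nat * nat) -> 'I_2 * (nat * nat)) (dphi : dpoly F 'I_2)
    g (e : expansion) : expansion :=
  \sum_(p <- monalg.msupp e)
    (mkmalgU p (dpoly_der d up (monalg.mcoeff p e)) +
     \sum_(x <- g) mkmalgU (p.1 + x.1, p.2) (d x.2 *: monalg.mcoeff p e) +
     mkmalgU (p.1, p.2.+1) (dphi * monalg.mcoeff p e)).

Definition expand (T : lpdo F) g : expansion :=
  \sum_(m <- msupp T)
    (T@_m)%:A *:
      iter (m ord0) (expansion_der dx up_x (dvar ind_phi 1 0) g)
        (iter (m ord_max) (expansion_der dy up_y (dvar ind_phi 0 1) g)
          (mkmalgU (0, 0%N) (dvar ind_h 0 0))).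

(* The differential polynomial C_{j,t}. *)
Definition expand_coef (T : lpdo F) g (j : rat) (t : nat) : dpoly F 'I_2 :=
  monalg.mcoeff (j, t) (expand T g).

Definition polygon (T : lpdo F) g : rat * rat -> Prop :=
  convex_hull ((0, 0) :: [seq (p.1, p.2%:R) | p <- monalg.msupp (expand T g)]).

(* Q, a polynomial in v_1 = d_x phi and v_2 = d_y phi, is the polynomial
   attached to the edge of the polygon on the line {j + c t = M}. *)
Definition edge_poly (T : lpdo F) g (c M : rat) (Q : {mpoly F[2]}) : Prop :=
  edge_line (polygon T g) c M /\
  \sum_(p <- monalg.msupp (expand T g) | p.1 + c * p.2%:R == M)
      expand_coef T g p.1 p.2
    = dvar ind_h 0 0 *
      mpoly.mmap (fun a : F => a%:A)
        (fun i => if i == ord0 then dvar ind_phi 1 0 else dvar ind_phi 0 1) Q.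

(* The choices made along a branch: (1, linear factor of symb T), followed by
   the pairs (slope s_k, factor of Q_k) for k >= 2.  Factors matter up to
   non-zero constants: they are normalized by the condition mleadc = 1. *)
Definition branch := seq (rat * {mpoly F[2]}).

(* generic_run T b g: the construction procedure, with the choices recorded by
   b, yields s_1, ..., s_k and f_1, ..., f_k, and the generic case occurs for
   each of f_2, ..., f_k. *)
Inductive generic_run (T : lpdo F) : branch -> seq (rat * F) -> Prop :=
| GenericStart a f of
    a \is 1.-homog & mleadc a = 1 & mdivides a (symb T) &
    a.@[gradient f] = 0 & (dx f, dy f) != (0, 0) :
    generic_run T [:: (1, a)] [:: (1, f)]
| GenericContinue b g c M Q p f of
    generic_run T b g &
    edge_poly T g c M Q & 0 < c < (last (0, 0) g).1 &
    Q.@[gradient f] = 0 &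
    mleadc p = 1 & generic_case Q p (gradient f) :
    generic_run T (rcons b (c, p)) (rcons g (c, f)).

(* The series \sum_i h_i G^(-i/q), with G given by g, is a generic solution of
   T = 0 which follows the branch b, of multiplicity t.  The equations
   determining h_1, h_2, ... express that the series is a solution. *)
Definition generic_solution (T : lpdo F) (b : branch) g (t : nat)
    (h : nat -> F) : Prop :=
  generic_run T b g /\
  exists j : rat,
    [/\ right_vertical_edge (polygon T g) j t,
        h 0%N != 0,
        dpoly_eval dx dy id (fun i => if i == ind_h then h 0%N else 0)
          (expand_coef T g j 0) = 0
      & is_solution T g (frac_series 0 (denominator g) h)].

(* The data (s_i, f_i) along the branch b, when the f chosen at the node of the
   tree reached by the choices b' is its representative rho b'. *)
Definition represented (rho : branch -> F) (b : branch) : seq (rat * F) :=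
  mkseq (fun k => ((nth (0, 0) b k).1, rho (take k.+1 b))) (size b).

End FractionalDerivatives.

Definition quasipolynomial_bound (c : Rdefinitions.R) (n q : nat) : Prop :=
  Rdefinitions.Rlt (Raxioms.INR q)
    (Rpower.Rpower (Raxioms.INR n)
       (Rdefinitions.Rmult c (Rpower.ln (Raxioms.INR n)))).

(* Main.v *)
Require Import Defs.
From HB Require Import structures.
From mathcomp Require Import all_boot all_order all_algebra.
From mathcomp Require Import fieldext finmap.
From mathcomp Require boolp functions.
Import -(notations) functions.
From mathcomp.multinomials Require Import ssrcomplements mpoly.
From mathcomp.multinomials Require monalg.
Import -(notations) monalg.
Import mpoly.
From mathcomp Require Import zify ring lra.
From Stdlib Require Reals.

Set Implicit Arguments.
Unset Strict Implicit.
Unset Printing Implicit Defensive.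

Import Order.TTheory GRing.Theory Num.Theory.

Local Open Scope ring_scope.

(* For g = ((s_i, f_i))_i, write T (h G) = \sum_j (T_j h) G^(j) with differential
   operators T_j, and place the monomial k of T_j at the point (j, |k|).  The
   polygon is determined by these points, and the polynomial Q of the edge on
   the line j + c t = M has the coefficients Q_k = (T_(M - c |k|))_k.  Adding
   (c, f) to g keeps the support below this line and replaces Q(v) by
   Q(v + grad f).  In the generic case Q = p^m w, where p vanishes simply at
   grad f and w does not vanish there, so that m is the lowest degree of the
   new Q: the edges of smaller slope concern the degrees at most m.

   These edges have polynomials whose degrees range over disjoint intervals of
   [0, m], and the multiplicities of the factors of such a polynomial add up to
   at most the length of its interval; this gives (ii) by induction on the tree.
   For (iii), either m is at least halved at each step, or p has degree 1 and
   w is homogeneous, so that Q has terms of consecutive degrees and the slope c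
   does not enlarge the denominator; hence q <= n^e with 2^e <= n.  This bound
   also makes the slopes run through a finite set, whence the termination needed
   for (i).  The required elements of F exist because p(grad f) = 0 has power
   series solutions with a prescribed gradient at a nonsingular point of the
   curve p = 0, and because a non-zero linear operator is onto on power series;
   F being differentially closed, they can then be found in F.  *)

(** * Irreducible polynomials in two variables *)

(** Differential closedness speaks of differential fields only. Hence [F] is mapped, by formal
    Taylor expansion, into a domain of power series with two shift derivations, and the systems are
    solved in its fraction field. With coefficients in a finite extension of [F] the same device
    shows that [F] is algebraically closed, which the geometry of plane curves rests on. The
    solution found in [F] does not keep the prescribed gradient; what survives is an inequation, so
    nonsingularity must be put in that form.

    Conjugation by G turns d into d + (d f) G^(c). On a line of slope c this is multiplication by
    X_i + d_i f, since differentiating coefficients leads below the line when c > 0; whence the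
    shift of Q.

    The halving comes from the minimality of m among the multiplicities of the non-homogeneous
    factors of Q, whose degree is at most the previous m: a second such factor, or a p of degree at
    least 2, forces deg Q >= 2 m. In the remaining case characteristic 0 keeps the two lowest
    components of p^m w from vanishing. *)

Definition pdivides (R : nzRingType) (p q : R) : Prop := exists r, q = r * p.

(** Algebraic closedness of [F]; it is derived from differential closedness in
    [closed_has_roots]. *)
Definition has_roots (F : fieldType) : Prop :=
  forall p : {poly F}, (1 < size p)%N -> exists x, root p x.

Section BivariatePrimes.
Variable F : fieldType.
Hypothesis Froots : has_roots F.

(** Reduction of F[X][Y] modulo the prime X - x of F[X]. *)
Definition spec (x : F) : {poly {poly F}} -> {poly F} :=
  map_poly (horner_eval x).

HB.instance Definition _ x := GRing.RMorphism.on (spec x).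

Lemma spec_eq0 x (P : {poly {poly F}}) :
  spec x P = 0 -> exists Q, P = ('X - x%:P)%:P * Q.
Proof.
move=> P0; exists (map_poly (fun q => q %/ ('X - x%:P)) P).
apply/polyP => i; rewrite coefCM coef_map_id0 ?div0p // mulrC divpK //.
by rewrite dvdp_XsubCl; move/polyP/(_ i): P0; rewrite coef_map coef0 => /eqP.
Qed.

Lemma spec_linear x : spec x ('X - x%:P)%:P = 0.
Proof. by rewrite /spec map_polyC /= /horner_eval hornerXsubC subrr. Qed.

Lemma linear_neq0 (x : F) : ('X - x%:P)%:P != 0 :> {poly {poly F}}.
Proof. by rewrite polyC_eq0 polyXsubC_eq0. Qed.

(** Content 1: since [F] is algebraically closed, the primes of F[X] are the X - x up to units. *)
Definition primitive (P : {poly {poly F}}) : Prop := forall x, spec x P != 0.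

Lemma linear_factor (c : {poly F}) : (1 < size c)%N ->
  exists x c', c = c' * ('X - x%:P) /\ size c' = (size c).-1.
Proof.
move=> /[dup] c1 /Froots[x /factor_theorem[c' ec]]; exists x, c'; split=> //.
have c0 : c' != 0.
  by apply: contraTneq c1 => c0; rewrite ec c0 mul0r size_poly0.
by rewrite ec size_Mmonic ?monicXsubC // size_XsubC addn2.
Qed.

Lemma scale_poly_const (c : {poly F}) (P : {poly {poly F}}) : size c = 1%N ->
  exists d : {poly F}, d * c = 1.
Proof.
move=> /eqP/size_poly1P[a a0 ->]; exists a^-1%:P.
by rewrite -polyCM mulVf.
Qed.

(** Each linear factor X - x of [c] divides [E], because [P] does not vanish modulo X - x; such
    factors are removed one at a time. *)
Lemma primitive_cancel (c : {poly F}) (P B E : {poly {poly F}}) :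
  c != 0 -> primitive P -> c *: B = P * E -> exists E', B = P * E'.
Proof.
move=> + primP; move e: (size c) => n; elim: n c E e => [|n IH] c E sc c0 eB.
  by move: c0; rewrite -size_poly_eq0 sc.
case: n => [|n] in IH sc *.
  have [d dc] := scale_poly_const P sc.
  by exists (d *: E); rewrite -scalerAr -eB scalerA dc scale1r.
have [x [c' [ec sc']]] : exists x c', c = c' * ('X - x%:P) /\ _ :=
  @linear_factor c (ltac:(by rewrite sc)).
have : spec x P * spec x E = 0.
  by rewrite -rmorphM -eB -mul_polyC ec polyCM !rmorphM /= spec_linear
             mulr0 mul0r.
move/eqP; rewrite mulf_eq0 (negPf (primP x)) /= => /eqP/spec_eq0[E' eE].
apply: (IH c' E'); first by rewrite sc' sc.
  by apply: contraNneq c0 => c0; rewrite ec c0 mul0r.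
apply: (mulfI (linear_neq0 x)).
by rewrite -mul_polyC mulrA -polyCM mulrC [_ * c']mulrC -ec mulrC mul_polyC eB eE;
   ring.
Qed.

(** Gauss's lemma: a linear factor X - x of [c] divides [D] or [E], the reduction modulo X - x being
    a domain. Dividing by it leaves the degrees in Y unchanged. *)
Lemma gauss_factor (c : {poly F}) (P D E : {poly {poly F}}) :
  c != 0 -> c *: P = D * E ->
  exists D' E', [/\ P = D' * E', size D' = size D & size E' = size E].
Proof.
move e: (size c) => n; elim: n c D E e => [|n IH] c D E sc c0 eP.
  by move: c0; rewrite -size_poly_eq0 sc.
case: n => [|n] in IH sc *.
  have [d dc] := scale_poly_const P sc.
  exists (d *: D), E; split=> //; last first.
    rewrite size_scale //; apply: contra_eq_neq dc => ->.
    by rewrite mul0r eq_sym oner_eq0.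
  by rewrite -scalerAl -eP scalerA dc scale1r.
have [x [c' [ec sc']]] : exists x c', c = c' * ('X - x%:P) /\ _ :=
  @linear_factor c (ltac:(by rewrite sc)).
have c'0 : c' != 0 by apply: contraNneq c0 => c'0; rewrite ec c'0 mul0r.
have scx : size c' = n.+1 by rewrite sc' sc.
have ePx : ('X - x%:P)%:P * (c' *: P) = D * E.
  by rewrite -eP -!mul_polyC ec polyCM; ring.
have : spec x D * spec x E = 0.
  by rewrite -rmorphM -ePx rmorphM /= spec_linear mul0r.
have sz Q : size (('X - x%:P)%:P * Q) = size Q.
  by rewrite mul_polyC size_scale // polyXsubC_eq0.
move/eqP; rewrite mulf_eq0 => /orP[] /eqP/spec_eq0[Q eQ].
  have [|D' [E' [-> sD sE]]] := IH c' Q E scx c'0.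
    by apply: (mulfI (linear_neq0 x)); rewrite ePx eQ mulrA.
  by exists D', E'; split=> //; rewrite eQ sz.
have [|D' [E' [-> sD sE]]] := IH c' D Q scx c'0.
  by apply: (mulfI (linear_neq0 x)); rewrite ePx eQ; ring.
by exists D', E'; split=> //; rewrite eQ sz.
Qed.

Definition biunit (P : {poly {poly F}}) : Prop := exists Q, Q * P = 1.

Definition biirreducible (P : {poly {poly F}}) : Prop :=
  [/\ P != 0, ~ biunit P
    & forall Q R, P = Q * R -> biunit Q \/ biunit R].

Lemma biunit_size P : biunit P -> size P = 1%N.
Proof.
move=> [Q QP]; have : size (Q * P) = 1%N by rewrite QP size_poly1.
have P0 : P != 0.
  by apply: contra_eq_neq QP => ->; rewrite mulr0 eq_sym oner_eq0.
have Q0 : Q != 0.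
  by apply: contra_eq_neq QP => ->; rewrite mul0r eq_sym oner_eq0.
rewrite size_mul //; move: P0 Q0; rewrite -!size_poly_gt0.
by case: (size P) (size Q) => [|a] [|b]; lia.
Qed.

Lemma linear_nonbiunit x : ~ biunit ('X - x%:P)%:P.
Proof.
move=> [Q /(congr1 (spec x))]; rewrite rmorphM /= spec_linear mulr0 rmorph1.
by move/esym/eqP; rewrite oner_eq0.
Qed.

Lemma biirreducible_primitive P :
  biirreducible P -> (1 < size P)%N -> primitive P.
Proof.
move=> [P0 _ irrP] sP x; apply: contraTneq sP => /spec_eq0[Q eP].
case: (irrP _ _ eP) => [/linear_nonbiunit//|/biunit_size sQ].
by rewrite eP mul_polyC size_scale ?sQ // polyXsubC_eq0.
Qed.

Lemma biirreducible_const P :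
  biirreducible P -> (size P <= 1)%N ->
  exists x U, P = U * ('X - x%:P)%:P /\ biunit U.
Proof.
move=> [P0 nuP irrP] /size1_polyC; set c : {poly F} := _`_0 => eP.
have sc : (1 < size c)%N.
  rewrite ltnNge; apply/negP => /size1_polyC ec; apply: nuP.
  exists (c`_0)^-1%:P%:P; rewrite eP {2}ec -!polyCM mulVf //.
  by apply: contraNneq P0 => c0; rewrite eP ec c0.
have [x [c' [ec _]]] := linear_factor sc.
have eP' : P = c'%:P * ('X - x%:P)%:P by rewrite -polyCM -ec.
exists x, c'%:P; split=> //.
by case: (irrP _ _ eP') => // /linear_nonbiunit.
Qed.

(** The pseudo-gcd divides a multiple [c *: P], and Gauss's lemma turns this into a factorization of
    [P]. If the cofactor is the unit, [P] divides a multiple of [Q], hence [Q] because [P] is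
    primitive. *)
Lemma biirreducible_coprime P Q :
  biirreducible P -> (1 < size P)%N -> ~ pdivides P Q ->
  Pdiv.Idomain.coprimep P Q.
Proof.
move=> irrP sP nPQ; have primP := biirreducible_primitive irrP sP.
have [c c0 ec] : exists2 c, c != 0 & exists E, c *: P = E * gcdp P Q.
  have /Pdiv.Idomain.dvdpP[[c E] /= c0 ec] := Pdiv.Idomain.dvdp_gcdl P Q.
  by exists c => //; exists E.
have [E eE] := ec; have [E' [D' [eP sE' sD']]] := gauss_factor c0 eE.
case: irrP => _ _ /(_ _ _ eP)[/biunit_size|/biunit_size]; last first.
  by rewrite sD' => sd; rewrite /Pdiv.Idomain.coprimep sd.
rewrite sE' => /eqP/size_poly1P[e e0 Ee].
have /Pdiv.Idomain.dvdpP[[a B] /= a0 eQ] := Pdiv.Idomain.dvdp_gcdr P Q.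
have eac : (e * a) *: Q = P * (c *: B).
  by rewrite -scalerA eQ scalerAr -[e *: _]mul_polyC -Ee -eE -!scalerAr mulrC.
have [|E1 eQ1] := primitive_cancel _ primP eac; first by rewrite mulf_neq0.
by case: nPQ; exists E1; rewrite mulrC.
Qed.

Lemma biirreducible_prime P Q R :
  biirreducible P -> pdivides P (Q * R) -> pdivides P Q \/ pdivides P R.
Proof.
move=> irrP [S eS]; case: (ltnP 1 (size P)) => sP; last first.
  have [x [U [eP [V VU]]]] := biirreducible_const irrP sP.
  have : spec x Q * spec x R = 0.
    by rewrite -rmorphM eS eP !rmorphM /= spec_linear !mulr0.
  move/eqP; rewrite mulf_eq0 => /orP[] /eqP/spec_eq0[W ->]; [left|right];
  by exists (W * V); rewrite eP -mulrA [V * _]mulrA VU mul1r mulrC.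
case: (boolp.pselect (pdivides P Q)) => [|nPQ]; [by left|right].
have coPQ := biirreducible_coprime irrP sP nPQ.
have : Pdiv.Idomain.dvdp P (Q * R).
  by apply/Pdiv.Idomain.dvdpP; exists (1, S); rewrite ?oner_eq0 // scale1r.
rewrite mulrC (Pdiv.Idomain.Gauss_dvdpl _ coPQ) => /Pdiv.Idomain.dvdpP[[c E] /= c0 ec].
have [|E' ->] := primitive_cancel c0 (biirreducible_primitive irrP sP)
  (_ : c *: R = P * E); first by rewrite mulrC.
by exists E'; rewrite mulrC.
Qed.

Hypothesis Fchar : [pchar F] =i pred0.

(** In characteristic 0 the integers below [size p] are distinct elements of [F], one more than the
    number of roots that [p] can have. *)
Lemma nonroot (p : {poly F}) : p != 0 -> exists x, ~~ root p x.
Proof.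
move=> p0; case: (boolp.pselect (exists x, ~~ root p x)) => // nx.
have all_root x : root p x by apply/negPn/negP => px; apply: nx; exists x.
pose s : seq F := [seq i%:R | i <- iota 0 (size p)].
have := @max_poly_roots _ p s p0; rewrite size_map size_iota ltnn => h.
suff : false by []; apply: h.
  by apply/allP => x _; apply: all_root.
rewrite map_inj_uniq ?iota_uniq // => i j /eqP.
wlog ij : i j / (i <= j)%N.
  move=> wl; case: (leqP i j) => [/wl//|/ltnW/wl h]; rewrite eq_sym => /h.
  by move=> ->.
rewrite eq_sym -subr_eq0 -natrB // ((pcharf0P F).1 Fchar) subn_eq0 => ji.
by apply/eqP; rewrite eqn_leq ij.
Qed.

(** By a Bezout relation A P + B U = r(X). Where neither r nor the leading coefficient of [P]
    vanishes, [P] has a root y over x, and [U] cannot vanish at (x, y). If [P] is constant in Y, it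
    is X - x up to a unit. *)
Lemma bipoint P U :
  biirreducible P -> ~ pdivides P U ->
  exists x y, (spec x P).[y] = 0 /\ (spec x U).[y] != 0.
Proof.
move=> irrP nPU; case: (ltnP 1 (size P)) => sP; last first.
  have [x [V [eP [W WV]]]] := biirreducible_const irrP sP.
  have /nonroot[y Uy] : spec x U != 0.
    apply: contra_notN nPU => /eqP/spec_eq0[Q ->]; exists (W * Q).
    by rewrite eP -[LHS]mul1r -WV; ring.
  by exists x, y; rewrite eP rmorphM /= spec_linear mulr0 horner0.
have /Pdiv.Idomain.Bezout_coprimepP[[A B] /= AB] :=
  biirreducible_coprime irrP sP nPU.
have /eqP/size_poly1P[r r0 er] : size (A * P + B * U) = 1%N.
  by rewrite (eqp_size AB) size_poly1.
have lP0 : lead_coef P != 0 by rewrite lead_coef_eq0; case: irrP.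
have /nonroot[x] : r * lead_coef P != 0 by rewrite mulf_neq0.
rewrite rootM negb_or => /andP[rx lx].
have sPx : size (spec x P) = size P.
  by rewrite /spec size_map_poly_id0.
have [y /rootP Py] : exists y, root (spec x P) y by apply: Froots; rewrite sPx.
exists x, y; split=> //; apply: contraNneq rx => Uy; apply/rootP.
have := congr1 (fun p => (spec x p).[y]) er.
rewrite /= rmorphD !rmorphM /= hornerD !hornerM Py Uy !mulr0 addr0.
by rewrite /spec map_polyC hornerC /= /horner_eval => <-.
Qed.

End BivariatePrimes.

Section PlanePrimes.
Variable F : fieldType.
Local Notation PP := {poly {poly F}}.
Implicit Types (p q r : {mpoly F[2]}) (P Q : PP).

Definition to_bipoly : {mpoly F[2]} -> PP :=
  mmap (polyC \o polyC) (fun i => if i == ord0 then 'X%:P else 'X).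

HB.instance Definition _ := GRing.RMorphism.on to_bipoly.

Definition of_bipoly_coef (q : {poly F}) : {mpoly F[2]} :=
  (map_poly (@mpolyC 2 F) q).['X_ord0].

Lemma of_bipoly_coef_rmorphism :
  zmod_morphism of_bipoly_coef * monoid_morphism of_bipoly_coef.
Proof.
split=> [p q|]; first by rewrite /of_bipoly_coef rmorphB hornerD hornerN.
by split=> [|p q]; rewrite /of_bipoly_coef ?rmorph1 ?hornerC // rmorphM hornerM.
Qed.

HB.instance Definition _ :=
  GRing.isZmodMorphism.Build {poly F} {mpoly F[2]} of_bipoly_coef
    of_bipoly_coef_rmorphism.1.
HB.instance Definition _ :=
  GRing.isMonoidMorphism.Build {poly F} {mpoly F[2]} of_bipoly_coef
    of_bipoly_coef_rmorphism.2.

Definition of_bipoly P : {mpoly F[2]} :=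
  (map_poly of_bipoly_coef P).['X_ord_max].

Lemma of_bipoly_rmorphism : zmod_morphism of_bipoly * monoid_morphism of_bipoly.
Proof.
split=> [p q|]; first by rewrite /of_bipoly rmorphB hornerD hornerN.
by split=> [|p q]; rewrite /of_bipoly ?rmorph1 ?hornerC // rmorphM hornerM.
Qed.

HB.instance Definition _ :=
  GRing.isZmodMorphism.Build PP {mpoly F[2]} of_bipoly of_bipoly_rmorphism.1.
HB.instance Definition _ :=
  GRing.isMonoidMorphism.Build PP {mpoly F[2]} of_bipoly of_bipoly_rmorphism.2.

Lemma ord2P (P : 'I_2 -> Prop) : P ord0 -> P ord_max -> forall i, P i.
Proof.
move=> P0 P1 [[|[|i]] hi] //; first by rewrite (_ : Ordinal hi = ord0) //;
  apply: val_inj.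
by rewrite (_ : Ordinal hi = ord_max) //; apply: val_inj.
Qed.

Lemma to_bipolyC c : to_bipoly c%:MP = c%:P%:P.
Proof. by rewrite /to_bipoly mmapC. Qed.

Lemma to_bipolyX i : to_bipoly 'X_i = if i == ord0 then 'X%:P else 'X.
Proof. by rewrite /to_bipoly mmapX mmap1U. Qed.

Lemma of_bipolyC c : of_bipoly c%:P = of_bipoly_coef c.
Proof. by rewrite /of_bipoly map_polyC hornerC. Qed.

Lemma of_bipolyX : of_bipoly 'X = 'X_ord_max.
Proof. by rewrite /of_bipoly map_polyX hornerX. Qed.

Lemma of_bipoly_coefC c : of_bipoly_coef c%:P = c%:MP.
Proof. by rewrite /of_bipoly_coef map_polyC hornerC. Qed.

Lemma of_bipoly_coefX : of_bipoly_coef 'X = 'X_ord0.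
Proof. by rewrite /of_bipoly_coef map_polyX hornerX. Qed.

Lemma mpoly_rmorph_eq (S : nzRingType) (f g : {rmorphism {mpoly F[2]} -> S}) :
  (forall c, f c%:MP = g c%:MP) -> (forall i, f 'X_i = g 'X_i) -> f =1 g.
Proof.
move=> fgC fgX p; rewrite [p]mpolyE !raddf_sum; apply: eq_bigr => m _ /=.
rewrite -mul_mpolyC !rmorphM fgC mpolyXE_id !rmorph_prod; congr (_ * _).
by apply: eq_bigr => i _; rewrite !rmorphXn fgX.
Qed.

Lemma to_bipolyK : cancel to_bipoly of_bipoly.
Proof.
apply: (mpoly_rmorph_eq (f := of_bipoly \o to_bipoly) (g := idfun)) => [c|i] /=.
  by rewrite to_bipolyC of_bipolyC of_bipoly_coefC.
rewrite to_bipolyX; elim/ord2P: i => /=.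
  by rewrite of_bipolyC of_bipoly_coefX.
exact: of_bipolyX.
Qed.

Lemma of_bipolyK : cancel of_bipoly to_bipoly.
Proof.
have KC (q : {poly F}) : to_bipoly (of_bipoly_coef q) = q%:P.
  elim/poly_ind: q => [|q c IH]; first by rewrite !rmorph0.
  rewrite !rmorphD !rmorphM /= IH of_bipoly_coefX of_bipoly_coefC to_bipolyX.
  by rewrite to_bipolyC.
elim/poly_ind => [|P c IH]; first by rewrite !rmorph0.
by rewrite !rmorphD !rmorphM /= IH of_bipolyX of_bipolyC KC to_bipolyX.
Qed.

Lemma to_bipoly_eval p (v : 'I_2 -> F) :
  p.@[v] = (spec (v ord0) (to_bipoly p)).[v ord_max].
Proof.
pose g : {rmorphism _ -> _} :=
  horner_eval (v ord_max) \o spec (v ord0) \o to_bipoly.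
apply: (mpoly_rmorph_eq (f := meval v) (g := g)) => [c|i]; rewrite /g /=.
  by rewrite mevalC to_bipolyC /spec map_polyC /= /horner_eval !hornerC.
rewrite mevalXU to_bipolyX; move: i; apply: ord2P => /=.
  by rewrite /spec map_polyC /= /horner_eval hornerC hornerX.
by rewrite /spec map_polyX /horner_eval hornerX.
Qed.

Lemma munitP p : reflect (exists q, q * p = 1) (p \is a GRing.unit).
Proof.
apply: (iffP unitrP) => [[q [qp _]]|[q qp]]; exists q => //.
by split=> //; rewrite mulrC.
Qed.

Lemma to_bipoly_unit p : p \is a GRing.unit <-> biunit (to_bipoly p).
Proof.
split=> [/munitP[q qp]|[Q QP]]; first by exists (to_bipoly q);
  rewrite -rmorphM qp rmorph1.
apply/munitP; exists (of_bipoly Q); apply: (can_inj to_bipolyK).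
by rewrite rmorphM /= of_bipolyK QP rmorph1.
Qed.

Lemma to_bipoly_divides p q :
  mdivides p q <-> pdivides (to_bipoly p) (to_bipoly q).
Proof.
split=> [[r ->]|[R eR]]; first by exists (to_bipoly r); rewrite rmorphM.
exists (of_bipoly R); apply: (can_inj to_bipolyK).
by rewrite rmorphM /= of_bipolyK.
Qed.

Lemma to_bipoly_irreducible p : mirreducible p -> biirreducible (to_bipoly p).
Proof.
move=> [p0 nup irrp]; split.
- by rewrite -(rmorph0 to_bipoly) (can_eq to_bipolyK).
- by move/to_bipoly_unit; apply/negP.
move=> Q R eP; have := irrp (of_bipoly Q) (of_bipoly R); case.
- by apply: (can_inj to_bipolyK); rewrite rmorphM /= !of_bipolyK.
- by move/to_bipoly_unit; rewrite of_bipolyK; left.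
by move/to_bipoly_unit; rewrite of_bipolyK; right.
Qed.

Hypothesis Froots : has_roots F.

Lemma mirreducible_prime p q r :
  mirreducible p -> mdivides p (q * r) -> mdivides p q \/ mdivides p r.
Proof.
move=> /to_bipoly_irreducible irrp /to_bipoly_divides; rewrite rmorphM /=.
by case/(biirreducible_prime Froots irrp) => /to_bipoly_divides; [left|right].
Qed.

Lemma mirreducible_point p u : [pchar F] =i pred0 ->
  mirreducible p -> ~ mdivides p u ->
  exists v : 'I_2 -> F, p.@[v] = 0 /\ u.@[v] != 0.
Proof.
move=> Fchar /to_bipoly_irreducible irrp npu.
have [|x [y [Py Uy]]] := bipoint Froots Fchar irrp (U := to_bipoly u).
  by move/to_bipoly_divides.
by exists (fun i => if i == ord0 then x else y); rewrite !to_bipoly_eval.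
Qed.

End PlanePrimes.

(** * Hurwitz series and derivations of fraction fields *)

Lemma derivation0 (A : nzRingType) (d : A -> A) : derivation d -> d 0 = 0.
Proof. by case=> dD _; apply: (addrI (d 0)); rewrite -dD !addr0. Qed.

Lemma derivation1 (A : nzRingType) (d : A -> A) : derivation d -> d 1 = 0.
Proof.
case=> _ dM; have := dM 1 1; rewrite !mulr1 mul1r => /eqP.
by rewrite -{1}[d 1]addr0 (inj_eq (addrI _)) => /eqP <-.
Qed.

(* Hurwitz series: f : nat -> R stands for the formal power series
   \sum_n f n t^n / n!, so that d/dt is the shift.  The proof of the
   characteristic is a parameter because the integral domain structure,
   which is inferred from the type, depends on it. *)
Definition hurwitz (R : idomainType) (_ : [pchar R] =i pred0) : Type :=
  nat -> R.

Section Hurwitz.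
Variables (R : idomainType) (Rchar : [pchar R] =i pred0).
Local Notation H := (hurwitz Rchar).
Implicit Types f g h : H.

HB.instance Definition _ := boolp.gen_eqMixin H.
HB.instance Definition _ := boolp.gen_choiceMixin H.

Lemma hurwitzP f g : (forall n, f n = g n) -> f = g.
Proof. exact: boolp.funext. Qed.

Definition hshift f : H := fun n => f n.+1.

Definition hzero : H := fun=> 0.
Definition hopp f : H := fun n => - f n.
Definition hadd f g : H := fun n => f n + g n.

Lemma haddA : associative hadd.
Proof. by move=> f g h; apply: hurwitzP => n; apply: addrA. Qed.
Lemma haddC : commutative hadd.
Proof. by move=> f g; apply: hurwitzP => n; apply: addrC. Qed.
Lemma hadd0 : left_id hzero hadd.
Proof. by move=> f; apply: hurwitzP => n; apply: add0r. Qed.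
Lemma haddN : left_inverse hzero hopp hadd.
Proof. by move=> f; apply: hurwitzP => n; apply: addNr. Qed.

HB.instance Definition _ := GRing.isZmodule.Build H haddA haddC hadd0 haddN.

(** The n-th derivative of a product at 0, unfolded by the Leibniz rule; the ring laws then follow
    by induction on [n], without sums of binomial coefficients. *)
Fixpoint hmul_at n f g : R :=
  if n is n'.+1 then hmul_at n' (hshift f) g + hmul_at n' f (hshift g)
  else f 0%N * g 0%N.

Definition hmul f g : H := fun n => hmul_at n f g.
Definition hone : H := fun n => (n == 0%N)%:R.

Lemma hmul_atC n f g : hmul_at n f g = hmul_at n g f.
Proof.
elim: n f g => [|n IH] f g /=; first exact: mulrC.
by rewrite addrC IH [hmul_at n (hshift f) g]IH.
Qed.

Lemma hmul_atDl n f g h : hmul_at n (f + g) h = hmul_at n f h + hmul_at n g h.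
Proof.
elim: n f g h => [|n IH] f g h /=; first exact: mulrDl.
by rewrite (_ : hshift (f + g) = hshift f + hshift g) // !IH addrACA.
Qed.

Lemma hshiftM f g : hshift (hmul f g) = hmul (hshift f) g + hmul f (hshift g).
Proof. by []. Qed.

Lemma hmul_atDr n f g h : hmul_at n f (g + h) = hmul_at n f g + hmul_at n f h.
Proof. by rewrite hmul_atC hmul_atDl !(hmul_atC _ f). Qed.

Lemma hmulA : associative hmul.
Proof.
move=> f g h; apply: hurwitzP => n; rewrite /hmul.
elim: n f g h => [|n IH] f g h /=; first exact: mulrA.
rewrite -/(hmul f g) -/(hmul g h) !hshiftM hmul_atDl hmul_atDr.
by rewrite !IH addrA.
Qed.

Lemma hmulC : commutative hmul.
Proof. by move=> f g; apply: hurwitzP => n; apply: hmul_atC. Qed.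

Lemma hmul_at0 n g : hmul_at n 0 g = 0.
Proof. by apply: (addrI (hmul_at n 0 g)); rewrite -hmul_atDl !addr0. Qed.

Lemma hmul1 : left_id hone hmul.
Proof.
move=> f; apply: hurwitzP => n; rewrite /hmul.
elim: n f => [|n IH] f /=; first by rewrite mul1r.
by rewrite (_ : hshift hone = 0) // hmul_at0 add0r IH.
Qed.

Lemma hmulDl : left_distributive hmul hadd.
Proof. by move=> f g h; apply: hurwitzP => n; apply: hmul_atDl. Qed.

Lemma hone_neq0 : hone != 0.
Proof.
by apply/eqP => /(congr1 (fun f : H => f 0%N)) /eqP; rewrite oner_eq0.
Qed.

HB.instance Definition _ :=
  GRing.Zmodule_isComNzRing.Build H hmulA hmulC hmul1 hmulDl hone_neq0.

Definition hunit : {pred H} := fun f => boolp.asbool (exists g, g * f = 1).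
Definition hinv f : H :=
  if boolp.pselect (exists g, g * f = 1) is left fP then sval (boolp.cid fP)
  else f.

Lemma hmulV : {in hunit, left_inverse 1 hinv *%R}.
Proof.
move=> f /boolp.asboolP fP; rewrite /hinv.
by case: boolp.pselect => // ?; case: boolp.cid.
Qed.

Lemma hunitPl f g : g * f = 1 -> hunit f.
Proof. by move=> gf; apply/boolp.asboolP; exists g. Qed.

Lemma hinv_out : {in [predC hunit], hinv =1 id}.
Proof.
move=> f; rewrite inE => /boolp.asboolP fP; rewrite /hinv.
by case: boolp.pselect.
Qed.

HB.instance Definition _ :=
  GRing.ComNzRing_hasMulInverse.Build H hmulV hunitPl hinv_out.

(** Induction through the Leibniz rule and Pascal's rule. The binomial coefficient is not zero in
    characteristic 0, so that Hurwitz series over a domain form a domain. *)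
Lemma hmul_lowest m n f g :
  (forall k, (k < m)%N -> f k = 0) -> (forall k, (k < n)%N -> g k = 0) ->
  hmul_at (m + n) f g = 'C(m + n, m)%:R * (f m * g n).
Proof.
move e: (m + n)%N => s; elim: s m n f g e => [|s IH] m n f g.
  by move/eqP; rewrite addn_eq0 => /andP[/eqP-> /eqP->] _ _; rewrite /= mul1r.
case: m => [|m] e f0 g0 /=.
  case: n e g0 => // n; rewrite add0n => -[ns] g0; subst s.
  rewrite (_ : hmul_at _ (hshift f) g = 0) ?add0r.
    by rewrite (IH 0%N n) ?add0n // ?bin0 // => k kn; apply: g0.
  elim: n (hshift f) g g0 {IH f0} => [|n IHn] f1 g g0 /=.
    by rewrite g0 // mulr0.
  rewrite IHn => [|k kn]; last exact/g0/ltnW.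
  by rewrite IHn ?addr0 // => k kn; apply: g0.
case: e => e; rewrite (IH m n) //; last by move=> k km; apply: f0.
case: n e g0 => [|n] e g0.
  rewrite addn0 in e; subst s; rewrite binn binn.
  rewrite (_ : hmul_at _ f (hshift g) = 0) ?addr0 //.
  elim: m f (hshift g) f0 {IH} => [|m IHm] f h f0 /=; first by rewrite f0 ?mul0r.
  rewrite IHm ?add0r => [|k km]; last exact: f0.
  by rewrite IHm // => k km; apply/f0/ltnW.
rewrite (IH m.+1 n) //; last by move=> k kn; apply: g0.
  by rewrite binS addrC natrD mulrDl.
by lia.
Qed.

Lemma hmul_idomain f g : f * g = 0 -> (f == 0) || (g == 0).
Proof.
apply: contra_eqT => /norP[f0 g0].
have lowest (h : H) : h != 0 ->
    exists m, h m != 0 /\ forall k, (k < m)%N -> h k = 0.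
  move=> h0; have hP : exists m, h m != 0.
    apply: boolp.contrapT => hP; case/eqP: h0; apply: hurwitzP => m.
    by apply/eqP/negPn/negP => hm; apply: hP; exists m.
  case: (ex_minnP hP) => m hm minm; exists m; split=> // k km.
  by apply/eqP/negPn/negP => /minm; rewrite leqNgt km.
have [m [fm fk]] := lowest f f0; have [n [gn gk]] := lowest g g0.
apply/eqP => /(congr1 (fun h : H => h (m + n)%N)) /eqP.
change ((f * g) (m + n)%N) with (hmul_at (m + n) f g).
rewrite hmul_lowest // mulf_eq0 mulf_eq0 (negPf fm) (negPf gn) !orbF.
by rewrite ((pcharf0P R).1 Rchar) -leqn0 leqNgt bin_gt0 leq_addr.
Qed.

HB.instance Definition _ :=
  GRing.ComUnitRing_isIntegral.Build H hmul_idomain.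

Lemma hurwitz_natr k : (k%:R : H) 0%N = k%:R.
Proof.
elim: k => [//|k IH]; rewrite -[in LHS]natr1 -natr1 -IH.
by change ((k%:R + 1 : H) 0%N) with ((k%:R : H) 0%N + 1).
Qed.

Lemma hurwitz_char : [pchar H] =i pred0.
Proof.
apply/pcharf0P => k; apply/eqP/eqP => [|->//].
move/(congr1 (fun f : H => f 0%N)); rewrite hurwitz_natr.
by move/eqP; rewrite ((pcharf0P R).1 Rchar) => /eqP.
Qed.

Lemma hshift_derivation : derivation hshift.
Proof. by split=> f g; apply: hurwitzP. Qed.

Definition hmap (d : R -> R) f : H := fun n => d (f n).

Lemma hmap_derivation (d : R -> R) : derivation d -> derivation (hmap d).
Proof.
move=> [dD dM]; split=> f g; apply: hurwitzP => n; first exact: dD.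
have dshift h : hmap d (hshift h) = hshift (hmap d h) by [].
rewrite /hmap.
change (d (hmul_at n f g) = hmul_at n (hmap d f) g + hmul_at n f (hmap d g)).
elim: n f g => [|n IH] f g /=; first exact: dM.
by rewrite dD !IH !dshift addrACA.
Qed.

End Hurwitz.

Section FractionDerivation.
Variable R : idomainType.
Local Notation K := {fraction R}.

Lemma fractionE (x : K) : exists nd : R * R,
  nd.2 != 0 /\ x * tofrac nd.2 = tofrac nd.1.
Proof.
elim/quotW: x => r; exists (frac r); split; first exact: denom_ratioP.
apply/eqP; change (FracField.mul (\pi r)%qT (FracField.tofrac (frac r).2) ==
  FracField.tofrac (frac r).1).
rewrite !piE FracField.equivfE /FracField.mulf.
by rewrite !numden_Ratio ?(oner_eq0, mulf_neq0, denom_ratioP) // !mulr1 mulrC.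
Qed.

Definition frac_rep (x : K) : R * R := sval (boolp.cid (fractionE x)).

Lemma frac_repP x :
  (frac_rep x).2 != 0 /\ x * tofrac (frac_rep x).2 = tofrac (frac_rep x).1.
Proof. by rewrite /frac_rep; case: boolp.cid. Qed.

(** The quotient rule in the form x' = (a' - x b') / b for x = a / b, applied to a chosen
    fraction. *)
Definition frac_der (d : R -> R) (x : K) : K :=
  let: (a, b) := frac_rep x in
  (tofrac (d a) - x * tofrac (d b)) / tofrac b.

Variable d : R -> R.
Hypothesis dP : derivation d.

(** Two fractions a / b = u / v satisfy u b = a v; differentiating this identity shows that the
    quotient rule gives the same value for both. *)
Lemma frac_derE x a b : b != 0 -> x * tofrac b = tofrac a ->
  frac_der d x = (tofrac (d a) - x * tofrac (d b)) / tofrac b.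
Proof.
move=> b0 xb; have [] := frac_repP x; rewrite /frac_der.
case: frac_rep => u v /= v0 xv; have [_ dM] := dP.
have bF : tofrac b != 0 by rewrite tofrac_eq0.
have vF : tofrac v != 0 by rewrite tofrac_eq0.
have /(congr1 d) uv : u * b = a * v.
  by apply/eqP; rewrite -tofrac_eq !tofracM -xv -xb; apply/eqP; ring.
rewrite !dM in uv.
have := congr1 (@tofrac R) uv; rewrite !tofracD !tofracM -xv -xb => uvF.
apply: (mulIf vF); apply: (mulIf bF); rewrite mulfVK // -[RHS]mulrAC mulfVK //.
apply/eqP; rewrite -subr_eq0; apply/eqP.
transitivity (tofrac (d u) * tofrac b + x * tofrac v * tofrac (d b) -
  (tofrac (d a) * tofrac v + x * tofrac b * tofrac (d v))); first by ring.
by rewrite uvF; ring.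
Qed.

Lemma frac_der_tofrac a : frac_der d (tofrac a) = tofrac (d a).
Proof.
rewrite (@frac_derE _ a 1) ?oner_eq0 ?tofrac1 ?mulr1 // divr1.
by rewrite derivation1 // tofrac0 mulr0 subr0.
Qed.

Lemma quotient_ruleD (L : fieldType) (x y b v a' b' u' v' : L) :
  b != 0 -> v != 0 ->
  ((a' * v + x * b * v') + (u' * b + y * v * b') -
     (x + y) * (b' * v + b * v')) / (b * v) =
  (a' - x * b') / b + (u' - y * v') / v.
Proof. by move=> b0 v0; field; rewrite v0 b0. Qed.

Lemma quotient_ruleM (L : fieldType) (x y b v a' b' u' v' : L) :
  b != 0 -> v != 0 ->
  ((a' * (y * v) + x * b * u') - x * y * (b' * v + b * v')) / (b * v) =
  (a' - x * b') / b * y + x * ((u' - y * v') / v).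
Proof. by move=> b0 v0; field; rewrite v0 b0. Qed.

Lemma frac_der_derivation : derivation (frac_der d).
Proof.
have [dD dM] := dP.
split=> x y; have [] := frac_repP x; have [] := frac_repP y;
  case: (frac_rep x) => a b; case: (frac_rep y) => u v /= v0 yv b0 xb;
  have bF : tofrac b != 0 by rewrite tofrac_eq0.
- have vF : tofrac v != 0 by rewrite tofrac_eq0.
  rewrite (frac_derE b0 xb) (frac_derE v0 yv).
  rewrite (@frac_derE _ (a * v + u * b) (b * v)) ?mulf_neq0 //; last first.
    by rewrite tofracD !tofracM -xb -yv; ring.
  by rewrite !dD !dM !tofracD !tofracM -xb -yv quotient_ruleD.
have vF : tofrac v != 0 by rewrite tofrac_eq0.
rewrite (frac_derE b0 xb) (frac_derE v0 yv).
rewrite (@frac_derE _ (a * u) (b * v)) ?mulf_neq0 //; last first.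
  by rewrite !tofracM -xb -yv; ring.
by rewrite !dM !tofracD !tofracM -xb -yv quotient_ruleM.
Qed.

End FractionDerivation.

(** Differentiating x b = a in both orders and cancelling the common terms leaves b times the
    commutator at x equal to 0. *)
Lemma frac_der_comm (R : idomainType) (d e : R -> R) :
  derivation d -> derivation e -> (forall x, d (e x) = e (d x)) ->
  forall x, frac_der d (frac_der e x) = frac_der e (frac_der d x).
Proof.
move=> dP eP de x; have [] := frac_repP x.
case: (frac_rep x) => a b /= b0 xb.
have bF : tofrac b != 0 by rewrite tofrac_eq0.
have [[DD DM] [ED EM]] := (frac_der_derivation dP, frac_der_derivation eP).
have /(congr1 (frac_der d)) E1 := congr1 (frac_der e) xb.
have /(congr1 (frac_der e)) D1 := congr1 (frac_der d) xb.
move: E1 D1; rewrite !(EM, ED, DM, DD) !(frac_der_tofrac dP, frac_der_tofrac eP).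
rewrite !de => <- h; apply: (mulIf bF).
apply: (addIr (frac_der d x * tofrac (e b) + frac_der e x * tofrac (d b) +
  x * tofrac (e (d b)))).
by match type of h with ?l = ?r => transitivity r; [ring | rewrite -h; ring] end.
Qed.

(** * Evaluation of differential polynomials and series solutions *)

Section MonomialEval.
Variables (J : choiceType) (R : comNzRingType) (val : J -> R).

Definition monom_eval (m : monalg.cmonom J) : R :=
  \prod_(v <- finsupp m) val v ^+ m v.

Lemma monom_eval_widen (m : monalg.cmonom J) (s : {fset J}) :
  (finsupp m `<=` s)%fset -> monom_eval m = \prod_(v <- s) val v ^+ m v.
Proof.
move=> ms; apply: big_fset_incl => // v _; rewrite -monalg.cmE_eq0.
by move=> /eqP ->; rewrite expr0.
Qed.

Lemma monom_eval_mmorphism : monalg.mmorphism monom_eval.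
Proof.
split=> [m1 m2|]; last by rewrite /monom_eval monalg.mdom1 big_seq_fset0.
rewrite !(@monom_eval_widen _ (finsupp m1 `|` finsupp m2)%fset).
- rewrite -big_split; apply: eq_bigr => v _.
  by rewrite monalg.cmM exprD.
- exact: fsubsetUr.
- exact: fsubsetUl.
by rewrite monalg.mdomD.
Qed.

HB.instance Definition _ :=
  monalg.isMultiplicative.Build (monalg.cmonom J) R monom_eval
    monom_eval_mmorphism.

Lemma monom_eval_ucm v : monom_eval (monalg.ucm v) = val v.
Proof. by rewrite /monom_eval monalg.mdomU big_seq_fset1 monalg.cmUU. Qed.

End MonomialEval.

Section DpolyEval.
Variables (F K : fieldType) (I : choiceType).
Variables (ex ey : K -> K) (f : {rmorphism F -> K}) (a : I -> K).
Local Notation var := (I * (nat * nat))%type.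

Definition dmonom_eval : monalg.cmonom var -> K :=
  monom_eval (fun v : var => iter v.2.1 ex (iter v.2.2 ey (a v.1))).

HB.instance Definition _ := MMorphism.on dmonom_eval.

(** Convertible with [dpoly_eval], in a form that carries the structure of a ring morphism. *)
Definition dpoly_evalm : dpoly F I -> K := monalg.mmap f dmonom_eval.

HB.instance Definition _ := GRing.RMorphism.on dpoly_evalm.

Lemma dpoly_evalE p : dpoly_eval ex ey f a p = dpoly_evalm p.
Proof. by []. Qed.

Lemma dpoly_evalC c : dpoly_eval ex ey f a c%:A = f c.
Proof.
by rewrite dpoly_evalE -[c%:A]/(c *: _) /dpoly_evalm monalg.mmapZ monalg.mmap1 mulr1.
Qed.

Lemma dpoly_evalZ c p :
  dpoly_eval ex ey f a (c *: p) = f c * dpoly_eval ex ey f a p.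
Proof. by rewrite !dpoly_evalE /dpoly_evalm monalg.mmapZ. Qed.

Lemma dpoly_eval_var u i j :
  dpoly_eval ex ey f a (dvar u i j) = iter i ex (iter j ey (a u)).
Proof.
rewrite /dpoly_eval /dvar monalg.mmapU /= rmorph1 mul1r.
exact: monom_eval_ucm.
Qed.

Definition grad_dpoly (u : I) (p : {mpoly F[2]}) : dpoly F I :=
  mmap (fun c : F => c%:A)
    (fun i => if i == ord0 then dvar u 1 0 else dvar u 0 1) p.

Lemma dpoly_eval_grad u p :
  dpoly_eval ex ey f a (grad_dpoly u p) =
  mmap f (fun i => if i == ord0 then ex (a u) else ey (a u)) p.
Proof.
rewrite dpoly_evalE /grad_dpoly [in LHS]/mmap rmorph_sum; apply: eq_bigr => m _ /=.
rewrite rmorphM /mmap1 rmorph_prod /= -!dpoly_evalE dpoly_evalC; congr (_ * _).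
apply: eq_bigr => i _; rewrite rmorphXn /= -dpoly_evalE.
by case: ifP => _; rewrite dpoly_eval_var.
Qed.

Definition lin_dpoly (u : I) (P : lpdo F) : dpoly F I :=
  \sum_(m <- msupp P) P@_m *: dvar u (m ord0) (m ord_max).

Lemma dpoly_eval_lin u P :
  dpoly_eval ex ey f a (lin_dpoly u P) =
  \sum_(m <- msupp P) f P@_m * iter (m ord0) ex (iter (m ord_max) ey (a u)).
Proof.
rewrite dpoly_evalE rmorph_sum; apply: eq_bigr => m _ /=.
by rewrite -dpoly_evalE dpoly_evalZ dpoly_eval_var.
Qed.

End DpolyEval.

Section Taylor.
Variables (A : nzRingType) (d : A -> A) (R : idomainType).
Variables (Rchar : [pchar R] =i pred0) (t : {rmorphism A -> R}).

(** The formal Taylor expansion of [a] at the point given by [t]. The proof that [d] is a derivation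
    is an argument so that a ring morphism structure can be attached. *)
Definition taylor (_ : derivation d) (a : A) : hurwitz Rchar :=
  fun n => t (iter n d a).

Hypothesis dP : derivation d.
Local Notation tau := (taylor dP).

Lemma derivationB : {morph d : x y / x - y}.
Proof.
have [dD _] := dP.
by move=> x y; apply: (addIr (d y)); rewrite -dD !subrK.
Qed.

Lemma taylor_zmod_morphism : zmod_morphism tau.
Proof.
move=> a b; apply: hurwitzP => n; rewrite /taylor.
change (t (iter n d (a - b)) = t (iter n d a) - t (iter n d b)).
rewrite -rmorphB; congr (t _).
by elim: n a b => [|n IH] a b //; rewrite !iterSr derivationB IH.
Qed.

Lemma taylor_monoid_morphism : monoid_morphism tau.
Proof.
have [dD dM] := dP; split.
  have [d0 d1] := (derivation0 dP, derivation1 dP).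
  apply: hurwitzP => -[|n]; rewrite /taylor /=; first exact: rmorph1.
  by rewrite -iterS iterSr d1; elim: n => [|n IH]; rewrite ?rmorph0 // iterSr d0.
move=> a b; apply: hurwitzP => n.
change (t (iter n d (a * b)) = hmul_at n (tau a) (tau b)).
elim: n a b => [|n IH] a b; first exact: rmorphM.
rewrite iterSr dM; change (t (iter n d (d a * b + a * d b)) =
  hmul_at n (hshift (tau a)) (tau b) + hmul_at n (tau a) (hshift (tau b))).
have tauS c : hshift (tau c) = tau (d c).
  by apply: hurwitzP => k; rewrite /hshift /taylor iterSr.
rewrite !tauS -!IH -rmorphD; congr (t _).
elim: n (d a * b) (a * d b) {IH} => [//|n IH] u w.
by rewrite iterSr dD IH -!iterSr.
Qed.

HB.instance Definition _ :=
  GRing.isZmodMorphism.Build A (hurwitz Rchar) tau taylor_zmod_morphism.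
HB.instance Definition _ :=
  GRing.isMonoidMorphism.Build A (hurwitz Rchar) tau taylor_monoid_morphism.

End Taylor.

(** * Power series in two variables and formal differential equations *)

Section PowerSeries.
Variables (L : fieldType) (Lchar : [pchar L] =i pred0).

(** Hurwitz series in x whose coefficients are Hurwitz series in y: [f i j] is the coefficient of
    x^i y^j / (i! j!), and both derivations shift an index. *)
Definition series2 : idomainType := hurwitz (hurwitz_char Lchar).
Implicit Types f g h e : series2.

Definition coef2 f (i j : nat) : L := f i j.
Definition der_x : series2 -> series2 := @hshift _ _.
Definition der_y : series2 -> series2 := hmap (@hshift _ _).

Lemma coef2_der_x f i j : coef2 (der_x f) i j = coef2 f i.+1 j.
Proof. by []. Qed.
Lemma coef2_der_y f i j : coef2 (der_y f) i j = coef2 f i j.+1.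
Proof. by []. Qed.
Lemma coef2D f g i j : coef2 (f + g) i j = coef2 f i j + coef2 g i j.
Proof. by []. Qed.
Lemma coef2N f i j : coef2 (- f) i j = - coef2 f i j.
Proof. by []. Qed.
Lemma coef2_sum (T : Type) (s : seq T) (G : T -> series2) i j :
  coef2 (\sum_(x <- s) G x) i j = \sum_(x <- s) coef2 (G x) i j.
Proof. by elim/big_rec2: _ => // x u v _ <-. Qed.
Lemma coef2M00 f g : coef2 (f * g) 0 0 = coef2 f 0 0 * coef2 g 0 0.
Proof. by []. Qed.

Lemma series2_neq0 f i j : coef2 f i j != 0 -> f != 0.
Proof. by apply: contraNneq => ->. Qed.

Lemma der_x_derivation : derivation der_x.
Proof. exact: hshift_derivation. Qed.
Lemma der_y_derivation : derivation der_y.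
Proof. exact/hmap_derivation/hshift_derivation. Qed.

Lemma coef2_iter f a b i j :
  coef2 (iter a der_x (iter b der_y f)) i j = coef2 f (i + a) (j + b).
Proof.
elim: a i => [|a IH] i; last by rewrite iterS coef2_der_x IH addSnnS.
rewrite addn0; elim: b j => [|b IH] j; first by rewrite addn0.
by rewrite iterS coef2_der_y IH addSnnS.
Qed.

(** One derivation is moved out by the Leibniz rule; the term in which it falls on [f] only meets
    coefficients of [g] that vanish. *)
Lemma coef2M_first f g i j :
  (forall i' j', (i' <= i)%N -> (j' <= j)%N -> (i', j') != (i, j) ->
     coef2 g i' j' = 0) ->
  coef2 (f * g) i j = coef2 f 0 0 * coef2 g i j.
Proof.
move e: (i + j)%N => n; elim: n i j f g e => [|n IH] i j f g.
  by move/eqP; rewrite addn_eq0 => /andP[/eqP-> /eqP->].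
have z h k u w : coef2 h u w = 0 ->
    coef2 k 0 0 * coef2 h u w = 0 by move=> ->; rewrite mulr0.
case: i => [|i] e g0.
  case: j => [//|j] in e g0 *; have [_ dM] := der_y_derivation.
  rewrite -coef2_der_y dM coef2D (IH _ _ _ g) ?(IH _ _ f) //; try lia.
  - rewrite z ?add0r // g0 // xpair_eqE; lia.
  - by move=> i' j' hi hj ne; apply: g0; rewrite ?xpair_eqE // in ne *; lia.
  - by move=> i' j' hi hj _; apply: g0; rewrite ?xpair_eqE //; lia.
have [_ dM] := der_x_derivation.
rewrite -coef2_der_x dM coef2D (IH _ _ _ g) ?(IH _ _ f) //; try lia.
- rewrite z ?add0r // g0 // xpair_eqE; lia.
- by move=> i' j' hi hj ne; apply: g0; rewrite ?xpair_eqE // in ne *; lia.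
- by move=> i' j' hi hj _; apply: g0; rewrite ?xpair_eqE //; lia.
Qed.

End PowerSeries.

(* The coefficients of the solution are determined one after the other, in the
   order given by [code]. *)
Lemma recursive_solution (L : fieldType) (code : nat -> nat -> nat)
    (E : (nat -> nat -> L) -> nat -> nat -> L) (S : nat -> nat -> bool)
    (a b : nat) (k : L) (f0 : nat -> nat -> L) :
  (forall i j i' j', code i j = code i' j' -> i = i' /\ j = j') ->
  let T i j := [&& a <= i, b <= j & S (i - a) (j - b)]%N in
  k != 0 ->
  (forall f f' i j,
     (forall i' j', ~~ T i' j' -> f i' j' = f0 i' j' /\ f' i' j' = f0 i' j') ->
     S i j ->
     (forall i' j', (code i' j' < code (i + a) (j + b))%N ->
        f i' j' = f' i' j') ->
     E f i j - E f' i j = k * (f (i + a)%N (j + b)%N - f' (i + a)%N (j + b)%N)) ->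
  exists f, (forall i j, S i j -> E f i j = 0) /\
            (forall i j, ~~ T i j -> f i j = f0 i j).
Proof.
move=> code_inj T k0 EP.
(* Stage [c'.+1] corrects only the coefficient numbered [c'], by - E / k, so that its equation
   holds. Coefficients with larger numbers do not enter that equation, which therefore stays
   true. *)
pose fix appr c : nat -> nat -> L :=
  if c is c'.+1 then fun i j =>
    if (code i j == c') && T i j
    then appr c' i j - E (appr c') (i - a)%N (j - b)%N / k
    else appr c' i j
  else f0.
pose f i j := appr (code i j).+1 i j.
have apprT c i j : ~~ T i j -> appr c i j = f0 i j.
  by move=> nT; elim: c => //= c IH; rewrite (negPf nT) andbF.
have appr_lt c i j : (code i j < c)%N -> appr c i j = f i j.
  elim: c => // c IH; rewrite ltnS leq_eqVlt => /orP[/eqP <- //|ltc].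
  by rewrite /= ltn_eqF //= IH.
exists f; split=> [i j Sij|i j nT]; last exact: apprT.
have Tij : T (i + a)%N (j + b)%N by rewrite /T !leq_addl !addnK.
have := EP f (appr (code (i + a) (j + b))%N) i j.
rewrite [X in _ * (X - _)]/f /= eqxx Tij /= !addnK.
have -> : forall u w : L, k * (u - w / k - u) = - w.
  by move=> u w; field.
move=> /(_ _ Sij) h; apply: (addIr (- E (appr (code (i + a) (j + b))%N) i j)).
rewrite h ?add0r // => i' j'; first by move=> nT; split; apply: apprT.
by move=> /appr_lt ->.
Qed.

Lemma mderivXU (n : nat) (R : nzRingType) (i j : 'I_n) :
  ('X_j : {mpoly R[n]})^`M(i) = (j == i)%:R.
Proof.
rewrite mderivX mnm1E; case: eqP => [->|]; last by rewrite scale0r.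
rewrite scale1r (_ : U_(i) - U_(i) = 0)%MM ?mpolyX0 //.
by apply/mnmP => k; rewrite mnmBE subnn mnm0E.
Qed.

Lemma mpoly_ring_ind (n : nat) (R : comNzRingType) (P : {mpoly R[n]} -> Prop) :
  (forall c, P c%:MP) -> (forall i, P 'X_i) ->
  (forall p q, P p -> P q -> P (p + q)) ->
  (forall p q, P p -> P q -> P (p * q)) -> forall p, P p.
Proof.
move=> PC PX PD PM p; rewrite [p]mpolyE; elim/big_ind: _ => //.
  exact: (PC 0).
move=> m _; rewrite -mul_mpolyC; apply: (PM) => //.
rewrite mpolyXE_id; elim/big_ind: _ => [|x y|i _]; [exact: (PC 1)|exact: PM|].
by elim: (m i) => [|k IH]; [exact: (PC 1)|rewrite exprS; apply: PM].
Qed.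

Lemma pchar_rmorph (F L : fieldType) (t : {rmorphism F -> L}) :
  [pchar F] =i pred0 -> [pchar L] =i pred0.
Proof.
move=> Fchar; apply/pcharf0P => k; rewrite -(rmorph_nat t) fmorph_eq0.
exact: ((pcharf0P F).1 Fchar).
Qed.

Lemma ord2_neq (k l : 'I_2) : k != l -> (k == ord0) = (l != ord0).
Proof. by move: k l; apply: ord2P; apply: ord2P. Qed.

(** The pairs of sum s are numbered within the interval from s^2 to s^2 + s, and these intervals are
    disjoint. *)
Lemma code_inj (i j i' j' : nat) :
  ((i + j) * (i + j) + i = (i' + j') * (i' + j') + i')%N -> i = i' /\ j = j'.
Proof.
move=> h; suff ij : (i + j = i' + j')%N by rewrite ij in h; lia.
by case: (ltngtP (i + j) (i' + j')) => // lt; nia.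
Qed.

Lemma mul_diff (R : comNzRingType) (a b a' b' : R) :
  a * b - a' * b' = b * (a - a') + a' * (b - b').
Proof. by ring. Qed.

Section SeriesSolutions.
Variables (F : fieldType) (dx dy : F -> F) (L : fieldType).
Variables (t : {rmorphism F -> L}) (Lchar : [pchar L] =i pred0).
Hypothesis dxP : derivation dx.
Hypothesis dyP : derivation dy.
Hypothesis dxy : forall x, dx (dy x) = dy (dx x).
Local Notation H := (series2 Lchar).

(** The coefficient (i, j) is [t (iter j dy (iter i dx a))]. As [dx] and [dy] commute, this is a
    morphism of differential rings. *)
Definition taylor2 : F -> H := taylor (hurwitz_char Lchar)
  (taylor Lchar t dyP) dxP.

HB.instance Definition _ := GRing.RMorphism.on taylor2.

Lemma der_x_taylor2 a : der_x (taylor2 a) = taylor2 (dx a).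
Proof.
apply: hurwitzP => i; apply: hurwitzP => j.
by rewrite /der_x /hshift /taylor2 /taylor iterSr.
Qed.

Lemma der_y_taylor2 a : der_y (taylor2 a) = taylor2 (dy a).
Proof.
apply: hurwitzP => i; apply: hurwitzP => j.
change (t (iter j.+1 dy (iter i dx a)) = t (iter j dy (iter i dx (dy a)))).
rewrite iterSr; congr (t (iter j dy _)).
by elim: i => [//|i IH]; rewrite !iterS -dxy IH.
Qed.

(** Since u - w begins in total degree i + j, only the linear part of [p] at the constant terms
    contributes to its effect there. Thus the non-linear equation p(grad f) = 0 is linear in its
    highest unknown coefficients. *)
Lemma mmap_taylor2_perturb (p : {mpoly F[2]}) (u w : 'I_2 -> H) i j :
  (0 < i + j)%N ->
  (forall k i' j', (i' + j' < i + j)%N ->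
     coef2 (u k) i' j' = coef2 (w k) i' j') ->
  let ev q := mmap t (fun k => coef2 (u k) 0 0) q in
  [/\ coef2 (mmap taylor2 u p) 0 0 = ev p,
      forall i' j', (i' + j' < i + j)%N ->
        coef2 (mmap taylor2 u p) i' j' = coef2 (mmap taylor2 w p) i' j'
    & coef2 (mmap taylor2 u p) i j - coef2 (mmap taylor2 w p) i j =
      \sum_k ev p^`M(k) * (coef2 (u k) i j - coef2 (w k) i j)].
Proof.
move=> ij uw ev; elim/mpoly_ring_ind: p => [c|l|p q|p q].
- rewrite !mmapC /ev mmapC; split=> //.
  by rewrite subrr big1 // => k _; rewrite mderivC mmap0 mul0r.
- rewrite !mmapX !mmap1U /ev mmapX mmap1U; split=> [//|i' j' lt|]; first exact: uw.
  rewrite (bigD1 l) //= big1 => [|k kl]; rewrite mderivXU.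
    by rewrite eqxx rmorph1 mul1r addr0.
  by rewrite eq_sym (negPf kl) mmap0 mul0r.
- move=> [p0 plt pij] [q0 qlt qij]; rewrite !mmapD /ev mmapD; split.
  + by rewrite coef2D p0 q0.
  + by move=> i' j' lt; rewrite !coef2D plt // qlt.
  rewrite !coef2D opprD addrACA pij qij -big_split; apply: eq_bigr => k _ /=.
  by rewrite mderivD mmapD mulrDl.
move=> [p0 plt pij] [q0 qlt qij]; rewrite !rmorphM /ev rmorphM /=.
set A := mmap _ u p in p0 plt pij *; set B := mmap _ u q in q0 qlt qij *.
set A' := mmap _ w p in plt pij *; set B' := mmap _ w q in qlt qij *.
have split_diff : A * B - A' * B' = B * (A - A') + A' * (B - B')
  by exact: mul_diff.
have diff i' j' : (i' + j' <= i + j)%N ->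
    coef2 (A * B) i' j' - coef2 (A' * B') i' j' =
    coef2 B 0 0 * (coef2 A i' j' - coef2 A' i' j') +
    coef2 A 0 0 * (coef2 B i' j' - coef2 B' i' j').
  move=> le; transitivity (coef2 (A * B - A' * B') i' j').
    by rewrite coef2D coef2N.
  have lt k l : (k <= i')%N -> (l <= j')%N -> (k, l) != (i', j') ->
      (k + l < i + j)%N by rewrite xpair_eqE; lia.
  rewrite split_diff [LHS]coef2D [coef2 A 0 0]plt // !coef2M_first.
  - by rewrite !coef2D !coef2N.
  - by move=> k l ki lj /(lt _ _ ki lj) kl; rewrite coef2D coef2N qlt // subrr.
  by move=> k l ki lj /(lt _ _ ki lj) kl; rewrite coef2D coef2N plt // subrr.
split; first by rewrite coef2M00 p0 q0.
  move=> i' j' lt; apply/eqP; rewrite -subr_eq0 diff 1?ltnW // (plt i') // (qlt i') //.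
  by rewrite !subrr !mulr0 addr0.
rewrite diff // pij qij p0 q0 !mulr_sumr -big_split; apply: eq_bigr => k _ /=.
by rewrite mderivM mmapD !rmorphM /=; ring.
Qed.

(** A formal Cauchy-Kovalevskaya argument: the equation at (i, j) is solved for the coefficient of f
    one step further in the direction [l], whose factor is the non-zero value of the derivative of
    [p]. *)
Lemma first_order_series (p : {mpoly F[2]}) (v : 'I_2 -> L) (l : 'I_2) :
  mmap t v p = 0 -> mmap t v p^`M(l) != 0 ->
  exists f : H,
    mmap taylor2 (fun k => if k == ord0 then der_x f else der_y f) p = 0 /\
    (forall k, coef2 (if k == ord0 then der_x f else der_y f) 0 0 = v k).
Proof.
(* The equation at (0, 0) is [pv] itself; it is left out of the recursion, so that the prescribed
   gradient is not altered. *)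
move=> pv plv; pose S (i j : nat) := (0 < i + j)%N.
(* Total degree, ties broken by the index in the direction [l]: of the two coefficients of highest
   order in an equation, the one to be solved for comes last. *)
pose code i j := ((i + j) * (i + j) + (if l == ord0 then i else j))%N.
pose a : nat := l == ord0; pose b : nat := l != ord0.
pose f0 i j := if (i, j) == (1, 0)%N then v ord0
  else if (i, j) == (0, 1)%N then v ord_max else 0.
pose g (f : nat -> nat -> L) (k : 'I_2) : H :=
  if k == ord0 then der_x f else der_y f.
pose E (f : nat -> nat -> L) := coef2 (mmap taylor2 (g f) p).
have gE f k i j :
    coef2 (g f k) i j = if k == ord0 then f i.+1 j else f i j.+1.
  by rewrite /g; case: ifP.
have code_lt i j i' j' : (i' + j' < i + j)%N -> (code i' j' < code i j)%N.
  by rewrite /code; case: ifP => _; nia.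
have g00 f : (forall i' j',
    ~~ [&& a <= i', b <= j' & S (i' - a) (j' - b)]%N -> f i' j' = f0 i' j') ->
    forall k, coef2 (g f k) 0 0 = v k.
  move=> ff0 k; rewrite gE; move: k; apply: ord2P => /=.
    by rewrite ff0 // /S /a /b; case: (l == ord0).
  by rewrite ff0 // /S /a /b; case: (l == ord0).
have [|||f [fE ff0]] := @recursive_solution L code E S a b
    (mmap t v p^`M(l)) f0; last first.
- exists f; split; last by move=> k; rewrite -(g00 f ff0 k).
  apply: hurwitzP => i; apply: hurwitzP => j.
  change (E f i j = 0); case: (posnP (i + j)%N) => [|ij]; last exact: fE.
  move/eqP; rewrite addn_eq0 => /andP[/eqP-> /eqP->].
  rewrite /E; have [//|//|-> _ _] := @mmap_taylor2_perturb p (g f) (g f) 1 0.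
  rewrite -[RHS]pv; rewrite /mmap; apply: eq_bigr => m _; congr (_ * _).
  by apply: eq_bigr => k _; rewrite (g00 f ff0).
- move=> f f' i j ff0 Sij agree.
  have agree' k i' j' : (i' + j' < i + j)%N ->
      coef2 (g f k) i' j' = coef2 (g f' k) i' j'.
    move=> lt; rewrite !gE; case: ifP => _; apply: agree;
    by apply: code_lt; rewrite /a /b; case: (l == ord0) => /=; lia.
  rewrite /E; have [//|//|_ _ ->] := @mmap_taylor2_perturb p (g f) (g f') i j.
  have ev q : mmap t (fun k => coef2 (g f k) 0 0) q = mmap t v q.
    rewrite /mmap; apply: eq_bigr => m _; congr (_ * _).
    apply: eq_bigr => k _; rewrite g00 // => i' j' nT.
    by case: (ff0 i' j' nT).
  rewrite (bigD1 l) //= ev big1 => [|k kl].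
    rewrite addr0 !gE; congr (_ * _); rewrite /a /b.
    by case: (l == ord0); rewrite !addn0 ?addn1.
  have kl0 : (k == ord0) = (l != ord0).
    exact: ord2_neq.
  have -> : coef2 (g f k) i j = coef2 (g f' k) i j.
    rewrite !gE kl0; move: agree; rewrite /code /a /b.
    by case: (l == ord0) => /= agree; apply: agree; nia.
  by rewrite subrr mulr0.
- exact: plv.
move=> i j i' j'; rewrite /code; case: ifP => _ h; first exact: code_inj h.
rewrite (addnC i) (addnC i') in h.
by have [] := code_inj h.
Qed.
End SeriesSolutions.

Lemma seq_argmax (disp : Order.disp_t) (R : orderType disp) (T : eqType)
    (s : seq T) (f : T -> R) (x0 : T) : x0 \in s ->
  exists2 x, x \in s & forall y, y \in s -> (f y <= f x)%O.
Proof.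
elim: s x0 => // x s IH x0 _; case: s IH => [|y s] IH.
  by exists x; rewrite ?mem_head // => y; rewrite inE => /eqP ->.
have [z zs zmax] := IH y (mem_head _ _).
case: (leP (f x) (f z)) => xz.
  exists z; first by rewrite inE zs orbT.
  by move=> w; rewrite inE => /orP[/eqP-> //|/zmax].
exists x; first exact: mem_head.
move=> w; rewrite inE => /orP[/eqP-> //|/zmax wz].
exact/ltW/(le_lt_trans wz).
Qed.

(** The numbering is a monomial order: it compares total degrees, and in case of a tie the first
    exponents. *)
Lemma code_lt_add (a b c d i j i' j' : nat) :
  ((a + b) * (a + b) + a < (c + d) * (c + d) + c)%N ->
  (i' <= i)%N -> (j' <= j)%N ->
  ((i' + a + (j' + b)) * (i' + a + (j' + b)) + (i' + a) <
   (i + c + (j + d)) * (i + c + (j + d)) + (i + c))%N.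
Proof.
move=> lt ii jj; case: (ltngtP (a + b) (c + d)) => [lt'|gt'|eq].
- have h : (i' + a + (j' + b) < i + c + (j + d))%N by lia.
  have := leq_mul h h; lia.
- have := leq_mul gt' gt'; lia.
have ac : (a < c)%N by rewrite eq in lt; lia.
have h : (i' + a + (j' + b) <= i + c + (j + d))%N by lia.
have := leq_mul h h; lia.
Qed.

Section LinearSeries.
Variables (F : fieldType) (dx dy : F -> F) (L : fieldType).
Variables (t : {rmorphism F -> L}) (Lchar : [pchar L] =i pred0).
Hypothesis dxP : derivation dx.
Hypothesis dyP : derivation dy.
Local Notation H := (series2 Lchar).
Local Notation tau := (taylor2 t Lchar dxP dyP).

Definition op_series (P : lpdo F) (h : H) : H :=
  \sum_(m <- msupp P) tau P@_m * iter (m ord0) (@der_x _ Lchar)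
    (iter (m ord_max) (@der_y _ Lchar) h).

(** Let m be the greatest monomial of [P] in the order [code]. The equation at (i, j) is solved for
    the coefficient at (i, j) + m, with factor [t P@_m]. The coefficients outside m + N^2 are free;
    if [P] has positive order, so is the one at (0, 0), which is set to 1. *)
Lemma linear_series (P : lpdo F) (r : F) : P != 0 ->
  exists h : H, op_series P h = tau r /\
    ((1 < msize P)%N -> coef2 h 0 0 = 1).
Proof.
move=> P0; pose code i j := ((i + j) * (i + j) + i)%N.
have [m mP mmax] : exists2 m, m \in msupp P & forall m', m' \in msupp P ->
    (code (m' ord0) (m' ord_max) <= code (m ord0) (m ord_max))%N.
  exact: (seq_argmax (fun m' : 'X_{1..2} => code (m' ord0) (m' ord_max))
    (mlead_supp P0)).
pose f0 (i j : nat) : L := ((i == 0%N) && (j == 0%N))%:R.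
pose E (f : nat -> nat -> L) := coef2 (op_series P f - tau r).
have [|||f [fE ff0]] := @recursive_solution L code E (fun _ _ => true)
    (m ord0) (m ord_max) (t P@_m) f0; last first.
- exists f; split=> [|sP].
    apply/eqP; rewrite -subr_eq0; apply/eqP.
    by apply: hurwitzP => i; apply: hurwitzP => j; apply: (fE i j).
  rewrite /coef2 ff0 //= andbT; apply/negP => /andP[].
  rewrite !leqn0 => /eqP m0 /eqP m1.
  have := mmax _ (mlead_supp P0); rewrite m0 m1 /code.
  have := mlead_deg P0; rewrite mdegE big_ord_recl big_ord1.
  rewrite (_ : lift ord0 ord0 = ord_max); last exact: val_inj.
  by move: sP; nia.
- move=> f f' i j _ _ agree; rewrite /E !coef2D opprD addrACA subrr addr0.
  rewrite /op_series !coef2_sum -sumrB.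
  pose G (m' : 'X_{1..2}) (f : H) : H := iter (m' ord0) (@der_x _ Lchar)
    (iter (m' ord_max) (@der_y _ Lchar) f).
  have coefG m' i' j' : m' \in msupp P -> (i' <= i)%N -> (j' <= j)%N ->
      (i', j', m') != (i, j, m) -> coef2 (G m' f - G m' f') i' j' = 0.
    move=> m'P ii jj ne; rewrite coef2D coef2N !coef2_iter.
    apply/eqP; rewrite subr_eq0; apply/eqP; apply: agree.
    have := mmax _ m'P; rewrite /code leq_eqVlt => /orP[/eqP/code_inj[e0 e1]|lt].
      have em : m' = m by apply/mnmP; apply: ord2P.
      by move: ne; rewrite em !xpair_eqE eqxx andbT; nia.
    exact: code_lt_add lt ii jj.
  have diffG m' : m' \in msupp P ->
      coef2 (tau P@_m' * G m' f) i j - coef2 (tau P@_m' * G m' f') i j =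
      t P@_m' * coef2 (G m' f - G m' f') i j.
    move=> m'P; rewrite -coef2N -coef2D -mulrBr coef2M_first //.
    move=> i' j' ii jj ne; apply: coefG => //.
    by apply: contra_neq ne => -[-> ->].
  rewrite (bigD1_seq m) ?msupp_uniq //= [X in _ + X]big1_seq ?addr0.
    by rewrite diffG // coef2D coef2N !coef2_iter.
  move=> m' /andP[m'm m'P]; rewrite diffG // coefG ?mulr0 //.
  by apply: contra_neq m'm => -[->].
- by rewrite fmorph_eq0 mcoeff_eq0 mP.
by move=> i j i' j' /code_inj.
Qed.
End LinearSeries.

(** * From power series to elements of the differentially closed field *)

Section DifferentialClosure.
Variables (F : fieldType) (dx dy : F -> F).
Hypothesis Fchar : [pchar F] =i pred0.
Hypothesis DF : differential_field dx dy.
Hypothesis closedF : differentially_closed dx dy.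

Let dxP : derivation dx. Proof. by case: DF. Qed.
Let dyP : derivation dy. Proof. by case: DF. Qed.
Let dxy x : dx (dy x) = dy (dx x). Proof. by case: DF. Qed.

Section Transfer.
Variables (L : fieldType) (t : {rmorphism F -> L}).
Variable Lchar : [pchar L] =i pred0.
Local Notation H := (series2 Lchar).
Local Notation tau := (taylor2 t Lchar dxP dyP).
Local Notation ex := (frac_der (@der_x _ Lchar)).
Local Notation ey := (frac_der (@der_y _ Lchar)).

Definition series_embed : F -> {fraction H} := @tofrac H \o tau.

HB.instance Definition _ := GRing.RMorphism.on series_embed.

Lemma iter_frac_der (h : H) i j :
  iter i ex (iter j ey (tofrac h)) =
  tofrac (iter i (@der_x _ Lchar) (iter j (@der_y _ Lchar) h)).
Proof.
elim: i => [|i IH] /=; last first.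
  by rewrite IH frac_der_tofrac //; apply: der_x_derivation.
elim: j => [//|j IH] /=.
by rewrite IH frac_der_tofrac //; apply: der_y_derivation.
Qed.

(* A power series solution lives in the fraction field of a ring of series, a
   differential field extension of F. *)
Lemma closed_by_series (p : dpoly F 'I_1) (r : dpoly F 'I_1) (h : H) :
  dpoly_eval ex ey series_embed (fun=> tofrac h) p = 0 ->
  dpoly_eval ex ey series_embed (fun=> tofrac h) r != 0 ->
  exists a : F, dpoly_eval dx dy id (fun=> a) p = 0 /\
                dpoly_eval dx dy id (fun=> a) r != 0.
Proof.
move=> hp hr; have [|a [ap ar]] := closedF (m := 1) (ps := [:: p]) (r := r).
  exists {fraction H}, ex, ey, series_embed, (fun=> tofrac h); split=> //.
  - split; [exact/frac_der_derivation/der_x_derivation|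
      exact/frac_der_derivation/der_y_derivation|].
    by apply: frac_der_comm; [exact: der_x_derivation|exact: der_y_derivation|].
  - move=> a; rewrite /series_embed /=.
    rewrite !frac_der_tofrac; [|exact: der_y_derivation|exact: der_x_derivation].
    by rewrite der_x_taylor2 der_y_taylor2.
  by move=> q; rewrite inE => /eqP ->.
exists (a ord0).
have ea : a = (fun=> a ord0) by apply: boolp.funext => i; rewrite (ord1 i).
by rewrite -ea; split=> //; apply: ap; rewrite mem_head.
Qed.

(** The series has gradient [v] at the origin, where [r] does not vanish, so the inequation holds in
    the fraction field and passes to [F]. The field [L] may be larger than [F], as
    [closed_has_roots] requires. *)
Lemma first_order_solution (p r : {mpoly F[2]}) (v : 'I_2 -> L) (l : 'I_2) :
  mmap t v p = 0 -> mmap t v p^`M(l) != 0 -> mmap t v r != 0 ->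
  exists f, p.@[gradient dx dy f] = 0 /\ r.@[gradient dx dy f] != 0.
Proof.
move=> pv plv rv.
have [h [hp hv]] := first_order_series Lchar dxP dyP pv plv.
have evh q : dpoly_eval ex ey series_embed (fun=> tofrac h)
      (grad_dpoly (ord0 : 'I_1) q) =
    tofrac (mmap tau (fun k => if k == ord0 then der_x h else der_y h) q).
  rewrite dpoly_eval_grad /mmap rmorph_sum; apply: eq_bigr => m _ /=.
  rewrite rmorphM /mmap1 rmorph_prod; congr (_ * _); apply: eq_bigr => k _ /=.
  rewrite rmorphXn /=; congr (_ ^+ _); case: ifP => _.
    exact: frac_der_tofrac (@der_x_derivation _ Lchar) _.
  exact: frac_der_tofrac (@der_y_derivation _ Lchar) _.
have [||a] := @closed_by_series (grad_dpoly ord0 p) (grad_dpoly ord0 r) h.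
- by rewrite evh hp rmorph0.
- rewrite evh tofrac_eq0; apply: (@series2_neq0 _ _ _ 0 0).
  have -> : coef2 (mmap tau (fun k => if k == ord0 then der_x h else der_y h) r)
      0 0 = mmap t v r; last by [].
  elim/mpoly_ring_ind: r {rv} => [c|k|q s IHq IHs|q s IHq IHs].
  + by rewrite !mmapC.
  + by rewrite !mmapX !mmap1U hv.
  + by rewrite !mmapD coef2D IHq IHs.
  by rewrite !rmorphM /= coef2M00 IHq IHs.
have eva q : dpoly_eval dx dy id (fun=> a) (grad_dpoly (ord0 : 'I_1) q) =
    q.@[gradient dx dy a].
  exact: (dpoly_eval_grad dx dy idfun (fun=> a) ord0 q).
by move=> h'; exists a; rewrite -(eva p) -(eva r).
Qed.

Lemma linear_solution (P : lpdo F) (r : F) : P != 0 ->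
  exists h, \sum_(m <- msupp P) P@_m * iter (m ord0) dx (iter (m ord_max) dy h)
     = r /\ ((1 < msize P)%N -> h != 0).
Proof.
move=> P0; have [h [hP h00]] := linear_series t Lchar dxP dyP r P0.
pose q : dpoly F 'I_1 := if (1 < msize P)%N then dvar ord0 0 0 else 1.
have ev u Q (h' : H) : dpoly_eval ex ey series_embed (fun=> tofrac h') (lin_dpoly u Q) =
   tofrac (op_series t dxP dyP Q h').
  rewrite dpoly_eval_lin /op_series rmorph_sum; apply: eq_bigr => m _ /=.
  by rewrite rmorphM /= iter_frac_der.
have [||a] := @closed_by_series (lin_dpoly ord0 P - r%:A) q h.
- rewrite dpoly_evalE raddfB /= -!dpoly_evalE dpoly_evalC ev hP.
  by rewrite /series_embed /= subrr.
- rewrite /q; case: ifP => sP; last by rewrite dpoly_evalE rmorph1 oner_eq0.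
  rewrite dpoly_eval_var /= tofrac_eq0; apply: (@series2_neq0 _ _ _ 0 0).
  by rewrite h00 ?oner_eq0.
have eva := dpoly_evalE dx dy idfun (fun=> a).
rewrite -[id]/(idfun : F -> F) eva raddfB /= -!eva dpoly_evalC dpoly_eval_lin.
move=> /= [/eqP]; rewrite subr_eq0 => /eqP aP aq; exists a; split=> // sP.
by move: aq; rewrite /q sP dpoly_eval_var.
Qed.

End Transfer.
End DifferentialClosure.

(** * Lowest and highest degrees, factorizations *)

Section ClosedHasRoots.
Variables (F : fieldType) (dx dy : F -> F).
Hypothesis Fchar : [pchar F] =i pred0.
Hypothesis DF : differential_field dx dy.
Hypothesis closedF : differentially_closed dx dy.

Lemma of_bipoly_coef_mmap (L : fieldType) (t : {rmorphism F -> L}) v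
    (q : {poly F}) : mmap t v (of_bipoly_coef q) = (map_poly t q).[v ord0].
Proof.
elim/poly_ind: q => [|q c IH]; first by rewrite !rmorph0 horner0.
rewrite !rmorphD !rmorphM /= hornerD hornerM IH of_bipoly_coefX of_bipoly_coefC.
by rewrite mmapC mmapX mmap1U map_polyX map_polyC hornerX hornerC.
Qed.

Lemma of_bipoly_coef_deriv (q : {poly F}) :
  (of_bipoly_coef q)^`M(ord0) = of_bipoly_coef q^`().
Proof.
elim/poly_ind: q => [|q c IH]; first by rewrite deriv0 rmorph0 mderiv0.
rewrite rmorphD rmorphM /= of_bipoly_coefX of_bipoly_coefC mderivD mderivM.
rewrite derivD derivM derivX derivC addr0 mulr1 rmorphD rmorphM /= IH.
by rewrite of_bipoly_coefX mderivC addr0 mderivXU eqxx mulr1.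
Qed.

Lemma irreducible_factor (q : {poly F}) : (1 < size q)%N ->
  exists2 p, irreducible_poly p & p %| q.
Proof.
move e: (size q) => n; elim/ltn_ind: n q e => n IH q sq q1.
case: (boolp.pselect (irreducible_poly q)) => [irr|nirr]; first by exists q.
have [p [p1 pq npq]] : exists p : {poly F}, [/\ size p != 1%N, p %| q & ~~ (p %= q)].
  apply: boolp.contrapT => h; apply: nirr; split=> [|p p1 pq]; first by rewrite sq.
  by apply/negPn/negP => npq; apply: h; exists p.
have q0 : q != 0 by rewrite -size_poly_gt0 sq; apply: ltnW.
have p0 : p != 0 by apply: contraTneq pq => ->; rewrite dvd0p.
have sp : (size p < n)%N.
  rewrite -sq ltn_neqAle (dvdp_leq q0 pq) andbT.
  by apply: contra npq => spq; rewrite -(dvdp_size_eqp pq).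
have p2 : (1 < size p)%N by rewrite ltn_neqAle eq_sym p1 size_poly_gt0.
by have [r irr rp] := IH _ sp p erefl p2; exists r => //; apply: dvdp_trans pq.
Qed.

(** Let z be a root of an irreducible factor p in the extension it generates. Then p'(z) != 0 in
    characteristic 0, and the equation p(d_x f) = 0 has a series solution with d_x f = z at the
    origin. By differential closedness it has a solution f in [F], and d_x f is a root. *)
Lemma closed_has_roots : has_roots F.
Proof.
move=> q /irreducible_factor[p irrp pq].
suff [x px] : exists x, root p x.
  by exists x; move: pq => /dvdpP[r ->]; rewrite rootM px orbT.
have [L _ [z pz _]] := irredp_FAdjoin irrp.
have sp : (1 < size p)%N by case: irrp.
have p0 : p != 0 by rewrite -size_poly_gt0 ltnW.
have p'0 : p^`() != 0.
  apply/eqP => /(congr1 (fun r : {poly F} => r`_(size p).-2)) /eqP.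
  rewrite coef_deriv coef0 -mulr_natr mulf_eq0 prednK; last first.
    by case: (size p) sp => [|[]].
  rewrite -/(lead_coef p) lead_coef_eq0 (negPf p0) ((pcharf0P F).1 Fchar).
  by case: (size p) sp => [|[]].
have cop : coprimep p p^`().
  case: irrp => _ irrp; rewrite /coprimep; apply/negPn/negP => s1.
  have /eqp_size sg := irrp _ s1 (dvdp_gcdl _ _).
  have := dvdp_leq p'0 (dvdp_gcdr p p^`()); rewrite sg.
  by rewrite leqNgt lt_size_deriv.
pose t : {rmorphism F -> L} := in_alg L.
have tE r : (map_poly t r).[z] = mmap t (fun=> z) (of_bipoly_coef r).
  by rewrite of_bipoly_coef_mmap.
have [|||f [pf _]] := @first_order_solution F dx dy DF closedF L t
  (pchar_rmorph t Fchar) (of_bipoly_coef p) 1 (fun=> z) ord0.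
- by rewrite -tE; apply/rootP.
- rewrite of_bipoly_coef_deriv -tE; move/Bezout_eq1_coprimepP: cop => [[u w] /= uw].
  have := congr1 (fun r => (map_poly t r).[z]) uw.
  rewrite /= rmorphD !rmorphM /= rmorph1 hornerD !hornerM hornerC.
  rewrite (rootP pz) mulr0 add0r.
  by apply: contra_eq_neq => ->; rewrite mulr0 eq_sym oner_eq0.
- by rewrite rmorph1 oner_eq0.
exists (gradient dx dy f ord0); apply/rootP; rewrite -pf /meval.
by rewrite of_bipoly_coef_mmap map_poly_id.
Qed.

End ClosedHasRoots.

Section LowDegree.
Variables (n : nat) (R : idomainType).
Implicit Types (p q : {mpoly R[n]}).

Definition topdeg p : nat := (msize p).-1.
Definition lowdeg p : nat := mdeg (mlast p).

Lemma topdegM p q : p != 0 -> q != 0 -> topdeg (p * q) = (topdeg p + topdeg q)%N.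
Proof.
move=> p0 q0; rewrite /topdeg msizeM //.
by move: p0 q0; rewrite -!msize_poly_eq0; case: (msize p) (msize q) => [|a] [|b];
  rewrite //= addnS.
Qed.

Lemma topdegX p k : p != 0 -> topdeg (p ^+ k) = (k * topdeg p)%N.
Proof.
move=> p0; elim: k => [|k IH]; first by rewrite /topdeg msize1.
by rewrite exprS topdegM ?expf_neq0 // IH mulSn.
Qed.

Lemma mdeg_topdeg p m : m \in msupp p -> (mdeg m <= topdeg p)%N.
Proof. by move/msize_mdeg_lt; rewrite /topdeg; case: (msize p). Qed.

Lemma topdeg_mem p : p != 0 -> exists2 m, m \in msupp p & mdeg m = topdeg p.
Proof.
by move=> p0; exists (mlead p); rewrite ?mlead_supp // /topdeg -mlead_deg.
Qed.

Lemma lowdeg_mdeg p m : m \in msupp p -> (lowdeg p <= mdeg m)%N.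
Proof. by move/mlast_lemc/lemc_mdeg. Qed.

Lemma lowdeg_mem p : p != 0 -> exists2 m, m \in msupp p & mdeg m = lowdeg p.
Proof. by move=> p0; exists (mlast p); rewrite ?mlast_supp. Qed.

Lemma lowdegE p m : m \in msupp p ->
  (forall m', m' \in msupp p -> (mdeg m <= mdeg m')%N) -> lowdeg p = mdeg m.
Proof.
move=> mp mmin; apply/eqP; rewrite eqn_leq lowdeg_mdeg //=.
apply/mmin/mlast_supp; apply: contraTneq mp => ->; by rewrite msupp0.
Qed.

Lemma low_le_top p : p != 0 -> (lowdeg p <= topdeg p)%N.
Proof. by move/mlast_supp/mdeg_topdeg. Qed.

(** The monomial order is compatible with addition: a pair of monomials whose sum is at most the sum
    of the two lowest ones consists of these. *)
Lemma mlastM p q : p != 0 -> q != 0 ->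
  mlast (p * q) = (mlast p + mlast q)%MM.
Proof.
move=> p0 q0.
have coef m : (m <= (mlast p + mlast q)%MM)%O -> (p * q)@_m =
   if m == (mlast p + mlast q)%MM then p@_(mlast p) * q@_(mlast q) else 0.
  move=> mle; rewrite mcoeffM.
  have zero (k : 'X_{1..n} * 'X_{1..n}) : m = (k.1 + k.2)%MM ->
      k != (mlast p, mlast q) -> p@_k.1 * q@_k.2 = 0.
    move=> mk; apply: contraNeq.
    rewrite mulf_eq0 negb_or -!mcoeff_msupp => /andP[k1 k2]; apply/eqP.
    have [h1 h2] := (mlast_lemc k1, mlast_lemc k2).
    case: (eqVneq k.1 (mlast p)) => [e1|n1].
      rewrite mk e1 lemc_add2r in mle; rewrite [k]surjective_pairing e1.
      by congr (_, _); apply/le_anti; rewrite mle.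
    have : ((mlast p + mlast q)%MM < (k.1 + k.2)%MM)%O.
      by apply: ltmc_le_add => //; rewrite lt_neqAle eq_sym n1.
    by rewrite -mk ltNge mle.
  case: eqVneq => [em|nm]; last first.
    rewrite big1 // => k /eqP mk; apply: (zero (val k.1, val k.2)) => //.
    by apply: contra_neq nm => -[e1 e2]; rewrite mk /= e1 e2.
  have lt1 : (mdeg (mlast p) < (mdeg m).+1)%N by rewrite em mdegD; lia.
  have lt2 : (mdeg (mlast q) < (mdeg m).+1)%N by rewrite em mdegD; lia.
  rewrite (bigD1 (BMultinom lt1, BMultinom lt2)) /=; last by rewrite em.
  rewrite big1 ?addr0 // => k /andP[/eqP mk nk].
  exact: (zero (val k.1, val k.2)).
apply: mlastE.
  by rewrite mcoeff_msupp coef // eqxx mulf_neq0 // -mcoeff_msupp mlast_supp.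
move=> m mpq; rewrite leNgt; apply/negP => lt.
by move: mpq; rewrite mcoeff_msupp coef ?ltW // lt_eqF // eqxx.
Qed.

Lemma lowdegM p q : p != 0 -> q != 0 ->
  lowdeg (p * q) = (lowdeg p + lowdeg q)%N.
Proof. by move=> p0 q0; rewrite /lowdeg mlastM // mdegD. Qed.

Lemma lowdegX p k : p != 0 -> lowdeg (p ^+ k) = (k * lowdeg p)%N.
Proof.
move=> p0; elim: k => [|k IH].
  by rewrite expr0 (@lowdegE _ 0%MM) ?mdeg0 // -mpolyC1 msuppC oner_eq0 inE.
by rewrite exprS lowdegM ?expf_neq0 // IH mulSn.
Qed.

Lemma homog_degP p : p != 0 -> (p \is homog mdeg) = (lowdeg p == topdeg p).
Proof.
move=> p0; apply/idP/eqP => [|lt].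
  rewrite homog_msize => /dhomogP hp.
  have [m mp <-] := lowdeg_mem p0; exact: hp.
apply/homogP; exists (topdeg p); apply/dhomogP => m mp.
by apply/eqP; rewrite eqn_leq mdeg_topdeg // -lt lowdeg_mdeg.
Qed.

Lemma nonhomog_lt p : p \isn't homog mdeg -> (lowdeg p < topdeg p)%N.
Proof.
move=> np; have p0 : p != 0.
  by apply: contraNneq np => ->; apply/homogP; exists 0%N; apply: dhomog0.
by rewrite ltn_neqAle low_le_top // andbT -homog_degP.
Qed.

Lemma homog_factor p q : p * q != 0 -> p * q \is homog mdeg -> p \is homog mdeg.
Proof.
move=> pq0; have [p0 q0] : p != 0 /\ q != 0.
  by apply/andP; rewrite -negb_or -mulf_eq0.
rewrite !homog_degP // lowdegM // topdegM // => /eqP h.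
have := low_le_top p0; have := low_le_top q0; lia.
Qed.

End LowDegree.

(** * Translations and factorizations of plane curves *)

Section Shift.
Variable F : fieldType.
Implicit Types (p q r : {mpoly F[2]}) (v : 'I_2 -> F).

(** The polynomial q(X + v); its lowest degree is the multiplicity of the point [v] on the curve q =
    0. *)
Definition mshift v : {mpoly F[2]} -> {mpoly F[2]} :=
  mmap (@mpolyC 2 F) (fun i => 'X_i + (v i)%:MP).

HB.instance Definition _ v := GRing.RMorphism.on (mshift v).

Lemma mshiftC v c : mshift v c%:MP = c%:MP.
Proof. by rewrite /mshift mmapC. Qed.

Lemma mshiftX v i : mshift v 'X_i = 'X_i + (v i)%:MP.
Proof. by rewrite /mshift mmapX mmap1U. Qed.

Lemma mshift_coef0 v q : (mshift v q)@_0%MM = q.@[v].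
Proof.
elim/mpoly_ring_ind: q => [c|i|p q IHp IHq|p q IHp IHq].
- by rewrite mshiftC mevalC mcoeffC eqxx mulr1.
- rewrite mshiftX mevalXU mcoeffD mcoeffX mcoeffC eqxx mulr1 mnm1_eq0.
  by rewrite add0r.
- by rewrite rmorphD mcoeffD mevalD IHp IHq.
by rewrite !rmorphM /= IHp IHq.
Qed.

Lemma mshift_deriv v i q : (mshift v q)^`M(i) = mshift v q^`M(i).
Proof.
elim/mpoly_ring_ind: q => [c|j|p q IHp IHq|p q IHp IHq].
- by rewrite mshiftC mderivC rmorph0.
- by rewrite mshiftX mderivD mderivC addr0 mderivXU rmorph_nat.
- by rewrite rmorphD !mderivD rmorphD IHp IHq.
by rewrite rmorphM !mderivM rmorphD !rmorphM /= IHp IHq.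
Qed.

Lemma mshift_coef1 v i q : (mshift v q)@_U_(i)%MM = (q^`M(i)).@[v].
Proof.
rewrite -mshift_coef0 -mshift_deriv mcoeff_deriv mnm0E mulr1n.
by rewrite add0m.
Qed.

Lemma lowdeg_mshift0 v q : q.@[v] != 0 -> lowdeg (mshift v q) = 0%N.
Proof.
by move=> qv; rewrite (@lowdegE _ _ _ 0%MM) ?mdeg0 // mcoeff_msupp mshift_coef0.
Qed.

Lemma lowdeg_mshift1 v q i :
  q.@[v] = 0 -> (q^`M(i)).@[v] != 0 -> lowdeg (mshift v q) = 1%N.
Proof.
move=> qv qiv; rewrite (@lowdegE _ _ _ U_(i)%MM) ?mdeg1 //.
  by rewrite mcoeff_msupp mshift_coef1.
move=> m; rewrite mcoeff_msupp lt0n mdeg_eq0; apply: contraNneq => ->.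
by rewrite mshift_coef0 qv.
Qed.

Lemma mshift_neq0 v q : q != 0 -> mshift v q != 0.
Proof.
have K : mshift (fun i => - v i) (mshift v q) = q.
  elim/mpoly_ring_ind: q => [c|j|p q IHp IHq|p q IHp IHq].
  - by rewrite !mshiftC.
  - by rewrite mshiftX rmorphD /= mshiftX mshiftC mpolyCN subrK.
  - by rewrite !rmorphD /= IHp IHq.
  by rewrite !rmorphM /= IHp IHq.
by apply: contra_neq => q0; rewrite -K q0 rmorph0.
Qed.

End Shift.

(** The two ways in which a factor of multiplicity m and degree a makes up at most half of the
    degree t in the sense that 2 m <= t: here a > 1; in the next lemma there is another factor, of
    degree b and multiplicity x >= m. *)
Lemma double_bound1 (m a s t : nat) :
  (t = m * a + s)%N -> (1 < a)%N -> (2 * m <= t)%N.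
Proof. by nia. Qed.

Lemma double_bound2 (m a x b u c t : nat) :
  (t = m * a + (x * b + u + c))%N -> (0 < a)%N -> (m <= x)%N -> (0 < b)%N ->
  (2 * m <= t)%N.
Proof. by nia. Qed.

Section PlaneFactorization.
Variable F : fieldType.
Implicit Types (p q r a b w : {mpoly F[2]}) (v : 'I_2 -> F).

Lemma munit_topdeg p : p != 0 -> (p \is a GRing.unit) = (topdeg p == 0%N).
Proof.
move=> p0; apply/munitP/eqP => [[q qp]|].
  have q0 : q != 0.
    by apply: contra_eq_neq qp => ->; rewrite mul0r eq_sym oner_eq0.
  have := topdegM q0 p0; rewrite qp /topdeg msize1; lia.
rewrite /topdeg => sp; have : msize p == 1%N.
  by move: p0 sp; rewrite -msize_poly_eq0; case: (msize p) => [|[]].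
move/msize_poly1P => [c c0 ->]; exists (c^-1)%:MP.
by rewrite -mpolyCM mulVf.
Qed.

Lemma nonunit_topdeg p : p != 0 -> p \isn't a GRing.unit -> (0 < topdeg p)%N.
Proof. by move=> p0; rewrite munit_topdeg // lt0n. Qed.

Lemma munit_const p : p \is a GRing.unit -> exists2 c : F, c != 0 & p = c%:MP.
Proof.
move=> up; have p0 : p != 0 by apply: contraTneq up => ->; rewrite unitr0.
apply/msize_poly1P; move: up; rewrite munit_topdeg // /topdeg.
by move: p0; rewrite -msize_poly_eq0; case: (msize p) => [|[]].
Qed.

Lemma mirreducible_topdeg p : mirreducible p -> (0 < topdeg p)%N.
Proof. by case=> p0 /(nonunit_topdeg p0). Qed.

Lemma topdegZ (c : F) p : c != 0 -> topdeg (c *: p) = topdeg p.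
Proof. by move=> c0; rewrite /topdeg msizeZ. Qed.

Lemma unit_scale (c : F) p : c != 0 ->
  (c *: p \is a GRing.unit) = (p \is a GRing.unit).
Proof.
move=> c0; have [->|p0] := eqVneq p 0; first by rewrite scaler0.
by rewrite !munit_topdeg ?topdegZ // mscalerI (negPf c0) (negPf p0).
Qed.

Lemma homog_scale (c : F) p : c != 0 ->
  (c *: p \is homog mdeg) = (p \is homog mdeg).
Proof.
move=> c0; have H (d : F) q : q \is homog mdeg -> d *: q \is homog mdeg.
  by move=> /homogP[k qk]; apply/homogP; exists k; apply: dhomogZ.
apply/idP/idP => [/(H c^-1)|/(H c)//].
by rewrite scalerA mulVf // scale1r.
Qed.

Lemma mirreducible_scale (c : F) p :
  c != 0 -> mirreducible p -> mirreducible (c *: p).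
Proof.
move=> c0 [p0 nup irrp]; split.
- by rewrite mscalerI (negPf c0) (negPf p0).
- by rewrite unit_scale.
move=> q r e; have : p = (c^-1 *: q) * r.
  by rewrite -scalerAl -e scalerA mulVf // scale1r.
by case/irrp; rewrite ?unit_scale ?invr_eq0 //; [left|right].
Qed.

Lemma normalizedE p : p != 0 -> mleadc ((mleadc p)^-1 *: p) = 1.
Proof.
by move=> p0; rewrite mleadZ ?invr_eq0 ?mleadc_eq0 // mcoeffZ mulVf ?mleadc_eq0.
Qed.

Lemma normalized_proportional (c : F) p q :
  mleadc p = 1 -> mleadc q = 1 -> p = c *: q -> p = q.
Proof.
move=> p1 q1 e; have c0 : c != 0.
  apply: contra_eq_neq p1 => c0; rewrite e c0 scale0r mcoeff0.
  by rewrite eq_sym oner_eq0.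
by move: p1; rewrite e mleadZ // mcoeffZ q1 mulr1 => ->; rewrite scale1r.
Qed.

Lemma mirreducible_divides p q : mirreducible p -> mirreducible q ->
  mdivides p q -> exists2 c : F, c != 0 & q = c *: p.
Proof.
move=> [_ nup _] [_ _ irrq] [r e]; case: (irrq _ _ e) => [/munit_const[c c0 ec]|up].
  by exists c => //; rewrite e ec mul_mpolyC.
by rewrite up in nup.
Qed.

Lemma mirreducible1 p : topdeg p = 1%N -> mirreducible p.
Proof.
move=> p1; have p0 : p != 0.
  by apply: contra_eq_neq p1 => ->; rewrite /topdeg msize0.
split=> //; first by rewrite munit_topdeg // p1.
move=> q r e; have [q0 r0] : q != 0 /\ r != 0.
  by apply/andP; rewrite -negb_or -mulf_eq0 -e.
rewrite !munit_topdeg //; move: p1; rewrite e topdegM //.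
by case: (topdeg q) (topdeg r) => [|a] [|b]; lia.
Qed.

Lemma not_mirreducible p : p != 0 -> p \isn't a GRing.unit ->
  ~ mirreducible p ->
  exists a b, [/\ p = a * b, a \isn't a GRing.unit & b \isn't a GRing.unit].
Proof.
move=> p0 nup nirr; apply: boolp.contrapT => h; apply: nirr; split=> // a b e.
apply: boolp.contrapT => nu; apply: h; exists a, b.
by split=> //; apply/negP => u; apply: nu; [left|right].
Qed.

Lemma nonhomog_neq0 p : p \isn't homog mdeg -> p != 0.
Proof.
by apply: contraNneq => ->; apply/homogP; exists 0%N; apply: dhomog0.
Qed.

Lemma nonhomog_factor q : q \isn't homog mdeg ->
  exists p r, [/\ q = r * p, mirreducible p, p \isn't homog mdeg
                & mleadc p = 1].
Proof.
move e: (topdeg q) => n; elim/ltn_ind: n q e => n IH q eq nhq.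
have q0 := nonhomog_neq0 nhq.
have nuq : q \isn't a GRing.unit.
  by rewrite munit_topdeg // -lt0n (leq_ltn_trans _ (nonhomog_lt nhq)).
case: (boolp.pselect (mirreducible q)) => [irr|/not_mirreducible].
  have c0 : (mleadc q)^-1 != 0 by rewrite invr_eq0 mleadc_eq0.
  exists ((mleadc q)^-1 *: q), (mleadc q)%:MP; split.
  - by rewrite mul_mpolyC scalerA divff ?scale1r // mleadc_eq0.
  - exact: mirreducible_scale.
  - by rewrite homog_scale.
  exact: normalizedE.
case=> // a [b [eab nua nub]].
have [a0 b0] : a != 0 /\ b != 0.
  by apply/andP; rewrite -negb_or -mulf_eq0 -eab.
have [ta tb] := (nonunit_topdeg a0 nua, nonunit_topdeg b0 nub).
have tab := topdegM a0 b0; rewrite -eab eq in tab.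
have [ha|nha] := boolP (a \is homog mdeg); last first.
  have [|p [r [ea irrp nhp p1]]] := IH (topdeg a) _ a erefl nha; first lia.
  by exists p, (r * b); split=> //; rewrite eab ea mulrAC.
have nhb : b \isn't homog mdeg.
  apply: contra nhq => hb; rewrite eab; apply/homogP.
  have [/homogP[d1 h1] /homogP[d2 h2]] := (ha, hb).
  by exists (d1 + d2)%N; apply: dhomogM.
have [|p [r [eb irrp nhp p1]]] := IH (topdeg b) _ b erefl nhb; first lia.
by exists p, (a * r); split=> //; rewrite eab eb mulrA.
Qed.

Lemma max_power p q : mirreducible p -> q != 0 ->
  exists m w, q = p ^+ m * w /\ ~ mdivides p w.
Proof.
move=> irrp; move e: (topdeg q) => n; elim/ltn_ind: n q e => n IH q eq q0.
case: (boolp.pselect (mdivides p q)) => [[r er]|]; last first.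
  by exists 0%N, q; rewrite mul1r.
have [r0 p0] : r != 0 /\ p != 0 by apply/andP; rewrite -negb_or -mulf_eq0 -er.
have := topdegM r0 p0; rewrite -er eq => tr.
have [|m [w [e nw]]] := IH (topdeg r) _ r erefl r0.
  by have := mirreducible_topdeg irrp; lia.
by exists m.+1, w; split=> //; rewrite er e exprS mulrC mulrA.
Qed.

Lemma normal_factorization q : q != 0 -> exists fs b,
  [/\ factorization q fs b, {in fs, forall x, mleadc x.1 = 1}
    & {in fs, forall x, mdivides x.1 q}].
Proof.
move e: (topdeg q) => n; elim/ltn_ind: n q e => n IH q eq q0.
have [hq|nhq] := boolP (q \is homog mdeg).
  exists [::], q; split=> //; split=> //.
    by rewrite big_nil mul1r.
  by move=> i j /andP[].
have [p [r [er irrp nhp p1]]] := nonhomog_factor nhq.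
have [m [w [ew nw]]] := max_power irrp q0.
have m0 : (0 < m)%N.
  by case: m ew => // ew; case: nw; exists r; rewrite -er ew mul1r.
have [pm0 w0] : p ^+ m != 0 /\ w != 0.
  by apply/andP; rewrite -negb_or -mulf_eq0 -ew.
have p0 : p != 0 by case: irrp.
have tq := topdegM pm0 w0; rewrite -ew eq topdegX // in tq.
have [|fs [b [[ew' hb fsP npr] fs1 fsd]]] := IH (topdeg w) _ w erefl w0.
  have := mirreducible_topdeg irrp; nia.
exists ((p, m) :: fs), b; split.
- split=> //.
  + by rewrite big_cons /= -mulrA -ew'.
  + by move=> x; rewrite inE => /orP[/eqP-> //|/fsP].
  move=> [|i] [|j] //=; last exact: npr.
  rewrite ltnS => jfs [c ec]; apply: nw.
  have xfs := mem_nth (0, 0%N) jfs.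
  have <- : (nth (0, 0%N) fs j).1 = p; last exact: fsd.
  by apply/esym/(normalized_proportional _ _ ec) => //; apply: fs1.
- by move=> x; rewrite inE => /orP[/eqP-> //|/fs1].
move=> x; rewrite inE => /orP[/eqP-> /=|/fsd[s es]]; first by exists r.
by exists (p ^+ m * s); rewrite ew es mulrA.
Qed.

Hypothesis Froots : has_roots F.

Lemma mdivides_pow p q N : mirreducible p -> mdivides p (q ^+ N) -> mdivides p q.
Proof.
move=> irrp; elim: N => [|N IH]; last first.
  by rewrite exprS => /(mirreducible_prime Froots irrp)[].
case=> r e; case: irrp => _ /negP[]; apply/munitP.
by exists r; rewrite -e expr0.
Qed.

Lemma mdivides_prod p (s : seq ({mpoly F[2]} * nat)) : mirreducible p ->
  mdivides p (\prod_(x <- s) x.1 ^+ x.2) ->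
  exists2 x, x \in s & mdivides p x.1.
Proof.
move=> irrp; elim: s => [|x s IH].
  rewrite big_nil => -[r e]; case: irrp => _ /negP[]; apply/munitP.
  by exists r; rewrite -e.
rewrite big_cons => /(mirreducible_prime Froots irrp)[/mdivides_pow|/IH].
  by move=> /(_ irrp) px; exists x; rewrite ?mem_head.
by case=> y ys py; exists y; rewrite // inE ys orbT.
Qed.

Lemma mdivides_coprime_pow p a r m : mirreducible p -> ~ mdivides p a ->
  mdivides (p ^+ m) (a * r) -> mdivides (p ^+ m) r.
Proof.
move=> irrp npa; have p0 : p != 0 by case: irrp.
elim: m r => [|m IH] r; first by exists r; rewrite mulr1.
case=> s es; case: (mirreducible_prime Froots irrp (q := a) (r := r)) => //.
  by exists (s * p ^+ m); rewrite es exprS; ring.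
case=> u eu; have [|w ew] := IH u.
  exists s; apply: (mulfI p0).
  transitivity (a * r); first by rewrite eu; ring.
  by rewrite es exprS; ring.
by exists w; rewrite eu ew exprS; ring.
Qed.

(** Distinct normalized irreducible polynomials do not divide each other, so their powers can be
    split off one after the other. *)
Lemma mdivides_prod_coprime (s : seq ({mpoly F[2]} * nat)) q :
  uniq [seq x.1 | x <- s] ->
  {in s, forall x, [/\ mirreducible x.1, mleadc x.1 = 1
                     & mdivides (x.1 ^+ x.2) q]} ->
  mdivides (\prod_(x <- s) x.1 ^+ x.2) q.
Proof.
elim: s => [|x s IH] /=; first by exists q; rewrite big_nil mulr1.
move=> /andP[xs us] sP; have [irrx x1 xq] := sP x (mem_head _ _).
have sP' y : y \in s -> _ := fun ys => sP y (mem_behead (s := x :: s) ys).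
have [r er] := IH us sP'.
have nxs : ~ mdivides x.1 (\prod_(x <- s) x.1 ^+ x.2).
  move=> /(mdivides_prod irrx)[y ys xy]; have [irry y1 _] := sP' y ys.
  have [c _ ec] := mirreducible_divides irrx irry xy.
  case/negP: xs; apply/mapP; exists y => //.
  exact/esym/(normalized_proportional _ _ ec).
rewrite er mulrC in xq; have [w ew] := mdivides_coprime_pow irrx nxs xq.
by exists w; rewrite big_cons er ew; ring.
Qed.

Lemma topdeg_divides p q : q != 0 -> mdivides p q ->
  (topdeg p <= topdeg q)%N /\ (topdeg p - lowdeg p <= topdeg q - lowdeg q)%N.
Proof.
move=> q0 [r er]; have [r0 p0] : r != 0 /\ p != 0.
  by apply/andP; rewrite -negb_or -mulf_eq0 -er.
rewrite er topdegM // lowdegM //.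
by have := low_le_top r0; have := low_le_top p0; lia.
Qed.

Lemma topdeg_prod (s : seq ({mpoly F[2]} * nat)) :
  {in s, forall x, x.1 != 0} ->
  [/\ \prod_(x <- s) x.1 ^+ x.2 != 0,
      topdeg (\prod_(x <- s) x.1 ^+ x.2) = (\sum_(x <- s) x.2 * topdeg x.1)%N
    & lowdeg (\prod_(x <- s) x.1 ^+ x.2) = (\sum_(x <- s) x.2 * lowdeg x.1)%N].
Proof.
elim: s => [|x s IH] sP.
  rewrite !big_nil oner_eq0 /topdeg msize1; split=> //.
  by have := @lowdegX 2 F 1 0 (oner_neq0 _); rewrite expr0.
have [] := IH (fun y ys => sP y (mem_behead (s := x :: s) ys)).
have x0 := sP x (mem_head _ _); rewrite !big_cons => s0 <- <-.
by rewrite mulf_neq0 ?expf_neq0 // topdegM ?lowdegM ?expf_neq0 // topdegX //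
  lowdegX.
Qed.

(** Write the reduced equation as r = s p. Nonsingularity of r at [v] means that neither s nor some
    derivative of p vanishes there, and the cofactor w of p^m divides a power of s. If p is linear
    and the only non-homogeneous factor, w is the homogeneous rest; otherwise minimality of m gives
    2 m <= deg q. *)
Lemma generic_case_spec q p v : q != 0 -> generic_case q p v ->
  exists m w,
    [/\ q = p ^+ m * w, (0 < m)%N, p.@[v] = 0, w.@[v] != 0
      & exists i, (p^`M(i)).@[v] != 0] /\
    [/\ mirreducible p, p \isn't homog mdeg
      & (2 * m <= topdeg q)%N \/ (topdeg p = 1%N /\ w \is homog mdeg)].
Proof.
move=> q0 [fs [b [m [[eq hb fsP npr] pfs mmin pv [r [[sqr rq [N qr]] rv rv']]]]]].
have [irrp nhp m0] := fsP _ pfs; rewrite /= in irrp nhp m0.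
have [p0 _ _] := irrp.
have b0 : b != 0 by apply: contraNneq q0 => b0; rewrite eq b0 mulr0.
case/splitPr: pfs => fs1 fs2 in eq fsP npr mmin *.
pose w := \prod_(x <- fs1 ++ fs2) x.1 ^+ x.2 * b.
have mem_fs x : x \in fs1 ++ fs2 -> x \in fs1 ++ (p, m) :: fs2.
  by rewrite !mem_cat inE => /orP[->|->]; rewrite ?orbT.
have ew : q = p ^+ m * w.
  by rewrite eq /w !big_cat big_cons /=; ring.
have npx x : x \in fs1 ++ fs2 -> ~ mdivides p x.1.
  move=> xfs pdx; have [irrx _ _] := fsP _ (mem_fs _ xfs).
  have [c c0 ec] := mirreducible_divides irrp irrx pdx.
  move: xfs; rewrite mem_cat => /orP[xfs|xfs].
    apply: (npr (index x fs1) (size fs1)).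
      by rewrite index_mem xfs size_cat /=; lia.
    exists c; rewrite nth_cat index_mem xfs nth_index //.
    by rewrite nth_cat ltnn subnn.
  apply: (npr (size fs1) (size fs1 + (index x fs2).+1)%N).
    by move: xfs; rewrite -index_mem size_cat /=; lia.
  exists c^-1; rewrite !nth_cat ltnn subnn /= ltnNge leq_addr /= addKn /=.
  by rewrite nth_index // ec scalerA mulVf // scale1r.
have npw : ~ mdivides p w.
  move=> /(mirreducible_prime Froots irrp)[/(mdivides_prod irrp)[x xfs]|].
    exact: npx.
  case=> s es; case/negP: nhp; apply: (@homog_factor _ _ p s).
    by rewrite mulrC -es.
  by rewrite mulrC -es.
have [s es] : mdivides p r.
  apply: (mdivides_pow (N := N)) => //; case: qr => z ->; rewrite ew.
  by exists (z * (p ^+ m.-1 * w)); rewrite -{1}(prednK m0) exprS; ring.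
have sv : s.@[v] != 0.
  case: rv' => i; rewrite es mderivM mevalD !mevalM pv mulr0 add0r.
  by rewrite mulf_eq0 negb_or => /andP[].
have wv : w.@[v] != 0.
  (* Here q divides s^N p^N; as [p] is prime and does not divide [w], the power p^N comes from the
     other factor and cancels. *)
  have [z ez] : mdivides w (s ^+ N).
    case: qr => z; rewrite es exprMn ew => ez.
    have [|u eu] := @mdivides_coprime_pow p w (z * p ^+ m) N irrp npw.
      by exists (s ^+ N); rewrite ez; ring.
    exists u; apply: (mulfI (expf_neq0 N p0)).
    transitivity (z * p ^+ m * w); first by rewrite mulrC ez mulrA.
    by rewrite eu; ring.
  apply: contraNneq sv => wv; have := congr1 (meval v) ez.
  by rewrite rmorphXn rmorphM /= wv mulr0 => /eqP; rewrite expf_eq0 => /andP[].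
have [i piv] : exists i, (p^`M(i)).@[v] != 0.
  case: rv' => i; rewrite es mderivM mevalD !mevalM pv mulr0 add0r.
  by rewrite mulf_eq0 negb_or => /andP[_ h]; exists i.
exists m, w; split; split=> //; first by exists i.
have fs0 : {in fs1 ++ fs2, forall x, x.1 != 0}.
  by move=> x /mem_fs/fsP[[]].
have [A0 tA _] := topdeg_prod fs0.
have w0 : w != 0 by rewrite mulf_neq0.
have tq : topdeg q = (m * topdeg p +
    (\sum_(x <- fs1 ++ fs2) x.2 * topdeg x.1 + topdeg b))%N.
  by rewrite ew topdegM ?expf_neq0 // topdegX // [topdeg w]topdegM // tA.
have tp := mirreducible_topdeg irrp.
case efs : (fs1 ++ fs2) => [|x fs'].
  case: (ltnP 1 (topdeg p)) => tp1; first by left; apply: double_bound1 tq tp1.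
  right; split; first by apply/eqP; rewrite eqn_leq tp1 tp.
  by rewrite /w efs big_nil mul1r.
left; have xfs : x \in fs1 ++ fs2 by rewrite efs mem_head.
have [irrx _ _] := fsP _ (mem_fs _ xfs).
have mx := mmin _ (mem_fs _ xfs); have tx := mirreducible_topdeg irrx.
by move: tq; rewrite efs big_cons /= => tq; apply: double_bound2 tq tp mx tx.
Qed.

End PlaneFactorization.

Section PlaneForms.
Variable F : fieldType.
Hypothesis Froots : has_roots F.
Hypothesis Fchar : [pchar F] =i pred0.
Implicit Types (p q r a b w : {mpoly F[2]}) (v : 'I_2 -> F).

(** Take r of least degree among the divisors of [q] a power of which is divisible by [q]. If r = s
    u^2, then s u is another such divisor, so that u is constant. *)
Lemma reduced_equation_exists q : q != 0 -> exists r, reduced_equation q r.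
Proof.
move=> q0.
have ex : exists n, boolp.asbool (exists r, [/\ topdeg r = n, mdivides r q
    & exists N, mdivides q (r ^+ N)]).
  exists (topdeg q); apply/boolp.asboolP; exists q; split=> //.
    by exists 1; rewrite mul1r.
  by exists 1%N; exists 1; rewrite mul1r.
case: (ex_minnP ex) => n /boolp.asboolP[r [er rq [N qr]]] nmin.
exists r; split=> //; last by exists N.
have r0 : r != 0.
  by case: rq => z ez; apply: contraNneq q0 => r0; rewrite ez r0 mulr0.
move=> u [s es]; have [s0 u20] : s != 0 /\ u ^+ 2 != 0.
  by apply/andP; rewrite -negb_or -mulf_eq0 -es.
have u0 : u != 0 by move: u20; rewrite expf_eq0.
rewrite munit_topdeg //.
have tr : topdeg r = (topdeg s + 2 * topdeg u)%N by rewrite es topdegM // topdegX.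
have : (n <= topdeg (s * u))%N.
  apply: nmin; apply/boolp.asboolP; exists (s * u); split=> //.
    by case: rq => z ez; exists (z * u); rewrite ez es; ring.
  exists (2 * N)%N; case: qr => z ez; exists (s ^+ N * z).
  rewrite exprM (_ : (s * u) ^+ 2 = s * r); last by rewrite es; ring.
  by rewrite exprMn ez mulrA.
rewrite topdegM // -er; lia.
Qed.

Lemma mderiv_topdeg p i : p^`M(i) != 0 -> (topdeg p^`M(i) < topdeg p)%N.
Proof.
move=> pi0; have [m + <-] := topdeg_mem pi0.
rewrite mcoeff_msupp mcoeff_deriv => mp.
have : (m + U_(i))%MM \in msupp p.
  by rewrite mcoeff_msupp; apply: contraNneq mp => ->; rewrite mul0rn.
by move/mdeg_topdeg; rewrite mdegD mdeg1 addn1.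
Qed.

Lemma mderiv_neq0 p : (0 < topdeg p)%N -> exists i, p^`M(i) != 0.
Proof.
move=> tp; have p0 : p != 0 by apply: contraTneq tp => ->; rewrite /topdeg msize0.
have [m mp em] := topdeg_mem p0.
have [i mi] : exists i, m i != 0%N.
  apply: boolp.contrapT => h; move: tp; rewrite -em lt0n mdeg_eq0 => /eqP[].
  apply/mnmP => i; rewrite mnm0E; apply/eqP/negPn/negP => mi; apply: h.
  by exists i.
exists i; apply: contraTneq mp => pi0; rewrite mcoeff_msupp negbK.
have := congr1 (mcoeff (m - U_(i))%MM) pi0.
rewrite mcoeff_deriv submK ?lep1mP // mcoeff0 -mulr_natr => /eqP.
by rewrite mulf_eq0 ((pcharf0P F).1 Fchar) orbF.
Qed.

(** A non-zero derivative of [p] has smaller degree, so [p] does not divide its product with [s];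
    some point of p = 0 lies off that product. *)
Lemma irreducible_nonsingular p s : mirreducible p -> ~ mdivides p s ->
  exists v i, [/\ p.@[v] = 0, (p^`M(i)).@[v] != 0 & s.@[v] != 0].
Proof.
move=> irrp nps; have [i pi0] := mderiv_neq0 (mirreducible_topdeg irrp).
have [|v [pv]] := mirreducible_point Froots (u := p^`M(i) * s) Fchar irrp.
  case/(mirreducible_prime Froots irrp) => // /(topdeg_divides pi0)[+ _].
  by rewrite leqNgt mderiv_topdeg.
by rewrite mevalM mulf_eq0 negb_or => /andP[piv sv]; exists v, i.
Qed.

Lemma squarefree_cofactor p s :
  mirreducible p -> msquarefree (s * p) -> ~ mdivides p s.
Proof.
move=> [_ nup _] sqf [u eu]; case/negP: nup; apply: sqf.
by exists u; rewrite eu; ring.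
Qed.

Lemma dim2_linear_form a v v' : a \is 1.-homog -> a != 0 ->
  a.@[v] = 0 -> a.@[v'] = 0 -> (exists i, v i != 0) ->
  exists c, forall i, v' i = c * v i.
Proof.
move=> ha a0 av av' [i vi].
have ea : a = a@_U_(ord0) *: 'X_ord0 + a@_U_(ord_max) *: 'X_ord_max.
  apply/mpolyP => m; rewrite mcoeffD !mcoeffZ !mcoeffX.
  have [e|ne] := eqVneq (mdeg m) 1%N.
    have /mdeg1P[j /eqP ->] : mdeg m == 1%N by rewrite e.
    move: j; apply: ord2P; rewrite !eq_mnm1 eqxx mulr1.
      by rewrite (_ : ord_max == ord0 = false) // mulr0 addr0.
    by rewrite (_ : ord0 == ord_max = false) // mulr0 add0r.
  rewrite (dhomog_nemf_coeff ha) //.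
  have z (j : 'I_2) : (U_(j)%MM == m) = false.
    by apply: contraNF ne => /eqP <-; rewrite mdeg1.
  by rewrite !z !mulr0 addr0.
set al := a@_U_(ord0) in ea; set be := a@_U_(ord_max) in ea.
have ab : al != 0 \/ be != 0.
  have [al0|] := eqVneq al 0; [right|by left].
  by apply: contraNneq a0 => be0; rewrite ea al0 be0 !scale0r addr0.
move: av av'; rewrite ea !mevalD !mevalZ !mevalXU => av av'.
exists (v' i / v i).
have cross : v' ord0 * v ord_max = v' ord_max * v ord0.
  apply/eqP; rewrite -subr_eq0; apply/eqP; case: ab => h; apply: (mulfI h).
    transitivity ((al * v' ord0 + be * v' ord_max) * v ord_max -
      (al * v ord0 + be * v ord_max) * v' ord_max); first by ring.
    by rewrite av av' !mul0r subrr mulr0.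
  transitivity ((al * v ord0 + be * v ord_max) * v' ord0 -
    (al * v' ord0 + be * v' ord_max) * v ord0); first by ring.
  by rewrite av av' !mul0r subrr mulr0.
have key j : v' j * v i = v' i * v j.
  by move: i j vi; apply: ord2P; apply: ord2P => // _; rewrite cross.
by move=> j; rewrite mulrAC -key mulfK.
Qed.

Lemma meval_homog d w v c : w \is d.-homog ->
  w.@[fun i => c * v i] = c ^+ d * w.@[v].
Proof.
move=> hw; rewrite !mevalE mulr_sumr; apply: eq_big_seq => m mw.
rewrite [RHS]mulrCA; congr (_ * _).
have /= <- := dhomog_mf hw mw; rewrite mdegE expr_sum -big_split.
by apply: eq_bigr => i _; rewrite exprMn.
Qed.

Lemma linear_topdeg a : a \is 1.-homog -> a != 0 -> topdeg a = 1%N.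
Proof.
by move=> ha a0; have [m ma <-] := topdeg_mem a0; apply: (dhomog_mf ha).
Qed.

(** Otherwise some point of the line a = 0 lies off w = 0. It is a multiple of [v], where the form
    [w] vanishes. *)
Lemma linear_divides a w v : a \is 1.-homog -> a != 0 -> w \is homog mdeg ->
  a.@[v] = 0 -> w.@[v] = 0 -> (exists i, v i != 0) -> mdivides a w.
Proof.
move=> ha a0 /homogP[d hw] av wv vi; apply: boolp.contrapT => naw.
have irra := mirreducible1 (linear_topdeg ha a0).
have [u [au]] := mirreducible_point Froots Fchar irra naw.
have [c ec] := dim2_linear_form ha a0 av au vi.
rewrite (_ : w.@[u] = 0) ?eqxx //.
by rewrite (meval_eq _ ec) (meval_homog _ _ hw) wv mulr0.
Qed.

(** The counterpart of [generic_case_spec] for the starting step: by [linear_divides], the cofactor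
    of the full power of [a] does not vanish at [v]. *)
Lemma linear_factor_spec a w v : w != 0 -> w \is homog mdeg ->
  a \is 1.-homog -> a != 0 -> mdivides a w ->
  a.@[v] = 0 -> (exists i, v i != 0) ->
  exists m w', [/\ w = a ^+ m * w', (0 < m)%N, w'.@[v] != 0
                 & exists i, (a^`M(i)).@[v] != 0].
Proof.
move=> w0 hw ha a0 aw av vi.
have irra := mirreducible1 (linear_topdeg ha a0).
have [m [w' [ew naw]]] := max_power irra w0.
have w'0 : w' != 0 by apply: contraNneq w0 => h; rewrite ew h mulr0.
have hw' : w' \is homog mdeg.
  by apply: (@homog_factor _ _ w' (a ^+ m)); rewrite mulrC -ew.
exists m, w'; split=> //.
- by case: m ew => // ew; case: naw; rewrite -[w']mul1r -ew.
- by apply/negP => /eqP w'v; apply: naw; apply: linear_divides vi.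
have [i ai] := mderiv_neq0 (mirreducible_topdeg irra).
exists i; have : topdeg a^`M(i) = 0%N.
  by have := mderiv_topdeg ai; rewrite (linear_topdeg ha a0); lia.
rewrite /topdeg => s0; have /msize_poly1P[c c0 ->] : msize a^`M(i) == 1%N.
  by move: ai s0; rewrite -msize_poly_eq0; case: (msize _) => [|[]].
by rewrite mevalC.
Qed.

Lemma irreducible_divisor q : (0 < topdeg q)%N ->
  exists p r, q = r * p /\ mirreducible p.
Proof.
move e: (topdeg q) => n; elim/ltn_ind: n q e => n IH q eq n0.
have q0 : q != 0 by apply: contraTneq n0 => h; rewrite -eq h /topdeg msize0.
case: (boolp.pselect (mirreducible q)) => [irr|/not_mirreducible].
  by exists q, 1; rewrite mul1r.
rewrite munit_topdeg // eq -lt0n => /(_ q0 n0)[a [b [eab nua nub]]].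
have [a0 b0] : a != 0 /\ b != 0.
  by apply/andP; rewrite -negb_or -mulf_eq0 -eab.
have [ta tb] := (nonunit_topdeg a0 nua, nonunit_topdeg b0 nub).
have tab := topdegM a0 b0; rewrite -eab eq in tab.
have [|p [r [er irrp]]] := IH (topdeg b) _ b erefl tb; first by lia.
by exists p, (a * r); rewrite eab er mulrA.
Qed.

(** An irreducible divisor of [w] cannot divide both variables, hence has a zero v other than the
    origin; the linear form vanishing at v divides [w]. *)
Lemma linear_factor_exists w : w \is homog mdeg -> (0 < topdeg w)%N ->
  exists a v, [/\ a \is 1.-homog, mleadc a = 1, mdivides a w, a.@[v] = 0
                & exists i, v i != 0].
Proof.
move=> hw tw.
have w0 : w != 0 by apply: contraTneq tw => ->; rewrite /topdeg msize0.
have [p [r [er irrp]]] := irreducible_divisor tw.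
have [j npX] : exists j, ~ mdivides p 'X_j.
  apply: boolp.contrapT => h.
  have pX j : mdivides p 'X_j.
    by apply: boolp.contrapT => npX; apply: h; exists j.
  have irrX j : mirreducible ('X_j : {mpoly F[2]}).
    by apply: mirreducible1; rewrite /topdeg msizeX mdeg1.
  have [c c0 ec] := mirreducible_divides irrp (irrX ord0) (pX ord0).
  have [d d0 ed] := mirreducible_divides irrp (irrX ord_max) (pX ord_max).
  have : d *: 'X_ord0 = c *: 'X_ord_max :> {mpoly F[2]}.
    by rewrite ec ed !scalerA mulrC.
  move/(congr1 (mcoeff U_(ord0)%MM)).
  by rewrite !mcoeffZ !mcoeffXU eqxx mulr1 mulr0 => /eqP; rewrite (negPf d0).
have [v [pv]] := mirreducible_point Froots Fchar irrp npX.
rewrite mevalXU => vj; have vi : exists i, v i != 0 by exists j.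
have wv : w.@[v] = 0 by rewrite er mevalM pv mulr0.
pose a0 : {mpoly F[2]} := v ord_max *: 'X_ord0 - v ord0 *: 'X_ord_max.
have a0v : a0.@[v] = 0.
  by rewrite mevalB !mevalZ !mevalXU mulrC subrr.
have ha0 : a0 \is 1.-homog.
  rewrite dhomogD // ?dhomogN; by apply: dhomogZ; rewrite dhomogX /= mdeg1.
have a00 : a0 != 0.
  apply/eqP => e0; case/eqP: vj; move: j {npX}; apply: ord2P.
    move/(congr1 (mcoeff U_(ord_max)%MM)): e0.
    rewrite mcoeffB !mcoeffZ !mcoeffXU mcoeff0 eqxx mulr1 mulr0 sub0r.
    by move/eqP; rewrite oppr_eq0 => /eqP.
  move/(congr1 (mcoeff U_(ord0)%MM)): e0.
  by rewrite mcoeffB !mcoeffZ !mcoeffXU mcoeff0 eqxx mulr1 mulr0 subr0.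
have c0 : (mleadc a0)^-1 != 0 by rewrite invr_eq0 mleadc_eq0.
exists ((mleadc a0)^-1 *: a0), v; split=> //.
- exact: dhomogZ.
- exact: normalizedE.
- apply: (linear_divides (v := v)) => //.
  + exact: dhomogZ.
  + by rewrite mscalerI (negPf c0) (negPf a00).
  by rewrite mevalZ a0v mulr0.
by rewrite mevalZ a0v mulr0.
Qed.

End PlaneForms.

(** * Choice of the functions f in the procedure *)

Section GenericChoice.
Variables (F : fieldType) (dx dy : F -> F).
Hypothesis Fchar : [pchar F] =i pred0.
Hypothesis DF : differential_field dx dy.
Hypothesis closedF : differentially_closed dx dy.

Let Froots : has_roots F := closed_has_roots Fchar DF closedF.

Lemma curve_gradient (p s : {mpoly F[2]}) v i :
  p.@[v] = 0 -> (p^`M(i)).@[v] != 0 -> s.@[v] != 0 ->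
  exists f, p.@[gradient dx dy f] = 0 /\ s.@[gradient dx dy f] != 0.
Proof.
exact: (@first_order_solution F dx dy DF closedF F idfun Fchar p s v i).
Qed.

Lemma generic_choice_exists (q : {mpoly F[2]}) : q \isn't homog mdeg ->
  exists p f, [/\ mleadc p = 1, generic_case q p (gradient dx dy f)
                & q.@[gradient dx dy f] = 0].
Proof.
move=> nhq; have q0 := nonhomog_neq0 nhq.
have [fs [b [fact fs1 fsq]]] := normal_factorization q0.
have [x0 x0fs] : exists x, x \in fs.
  case: fs fact {fs1 fsq} => [[e hb _ _]|x fs _]; last first.
    by exists x; apply: mem_head.
  by case/negP: nhq; rewrite e big_nil mul1r.
have [[p m] pfs mmin] : exists2 x, x \in fs &
    forall y, y \in fs -> (x.2 <= y.2)%N.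
  have [x xfs xmax] := seq_argmax (fun y => - (y.2%:R : rat)) x0fs.
  by exists x => // y /xmax; rewrite lerN2 ler_nat.
have [_ _ fsP _] := fact; have [irrp _ _] := fsP _ pfs; rewrite /= in irrp.
have [r red] := reduced_equation_exists q0; have [sqr rq [N qr]] := red.
have [s es] : mdivides p r.
  apply: (mdivides_pow Froots (N := N)) => //; case: qr => z ->.
  by case: (fsq _ pfs) => u ->; exists (z * u); rewrite mulrA.
have nps : ~ mdivides p s by apply: squarefree_cofactor; rewrite -?es.
have [v [i [pv piv sv]]] := irreducible_nonsingular Froots Fchar irrp nps.
(* The gradient of [f] need not be [v]: only the inequation passes to it, and it states at once that
   [p] is nonsingular there and that the cofactor [s] does not vanish. *)
have [|f [pf]] := @curve_gradient p (p^`M(i) * s) v i pv piv.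
  by rewrite mevalM mulf_neq0.
rewrite mevalM mulf_eq0 negb_or => /andP[pif sf].
exists p, f; split; first exact: (fs1 _ pfs); last first.
  by case: (fsq _ pfs) => u ->; rewrite mevalM pf mulr0.
exists fs, b, m; split=> //; exists r; split=> //.
  by rewrite es mevalM pf mulr0.
by exists i; rewrite es mderivM mevalD !mevalM pf mulr0 add0r mulf_neq0.
Qed.

Lemma start_choice_exists (w : {mpoly F[2]}) :
  w \is homog mdeg -> (0 < topdeg w)%N ->
  exists a f, [/\ a \is 1.-homog, mleadc a = 1, mdivides a w,
                a.@[gradient dx dy f] = 0 & (dx f, dy f) != (0, 0)].
Proof.
move=> hw tw; have [a [v [ha a1 aw av [j vj]]]] :=
  linear_factor_exists Froots Fchar hw tw.
have a0 : a != 0.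
  by apply: contra_eq_neq a1 => ->; rewrite mcoeff0 eq_sym oner_eq0.
have [i ai] := mderiv_neq0 Fchar (mirreducible_topdeg
  (mirreducible1 (linear_topdeg ha a0))).
have w0 : w != 0 by apply: contraTneq tw => ->; rewrite /topdeg msize0.
have [_ [_ [_ _ _ [k ak]]]] := linear_factor_spec Froots Fchar w0 hw ha a0 aw av
  (ex_intro _ j vj).
(* The inequation for ['X_j] keeps the gradient of [f] from being zero. *)
have [|f [af]] := @curve_gradient a 'X_j v k av ak; first by rewrite mevalXU.
rewrite mevalXU => fj; exists a, f; split=> //.
apply: contraNneq fj => -[fx fy]; rewrite /gradient.
by case: ifP; rewrite ?fx ?fy.
Qed.

End GenericChoice.

(** * Conjugation of an operator by G *)

Section LinearExtension.
Variables (n : nat) (R : comNzRingType) (W : lmodType R) (phi : 'X_{1..n} -> W).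
Implicit Types P Q : {mpoly R[n]}.

Definition mlin P : W := \sum_(m <- msupp P) P@_m *: phi m.

Lemma mlinE k P : (msize P <= k)%N ->
  mlin P = \sum_(m : 'X_{1..n < k}) P@_m *: phi m.
Proof.
move=> le_Pk; pose I : subFinType _ := 'X_{1..n < k}.
rewrite /mlin (big_mksub I) ?msupp_uniq //=; first last.
  by move=> m /msize_mdeg_lt /leq_trans; apply.
rewrite big_rmcond //= => m /memN_msupp_eq0 ->.
by rewrite scale0r.
Qed.

Lemma mlin_is_linear : linear mlin.
Proof.
move=> a P Q; pose k := maxn (msize P) (msize Q).
have kle : (msize (a *: P + Q) <= k)%N.
  apply: (leq_trans (mmeasureD_le _ _ _)).
  by rewrite geq_max leq_maxr leq_max mmeasureZ_le.
rewrite (mlinE kle) (@mlinE k P) ?leq_maxl // (@mlinE k Q) ?leq_maxr //.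
rewrite scaler_sumr -big_split; apply: eq_bigr => m _ /=.
by rewrite mcoeffD mcoeffZ scalerDl scalerA.
Qed.

HB.instance Definition _ := GRing.isLinear.Build R {mpoly R[n]} W _ mlin
  mlin_is_linear.

Lemma mlinX m : mlin 'X_[m] = phi m.
Proof. by rewrite /mlin msuppX big_seq1 mcoeffX eqxx scale1r. Qed.

End LinearExtension.

(* The pairs (j, P) stand for the operator h |-> \sum_(j, P) (P h) G^(j). *)
Definition opfam (F : fieldType) := seq (rat * lpdo F).

Section Operators.
Variable F : fieldType.
Implicit Types (P Q T : lpdo F) (e : opfam F) (g : seq (rat * F)).

Definition cder (d : F -> F) P : lpdo F :=
  \sum_(m <- msupp P) d P@_m *: 'X_[m].

Lemma cder_coef d P m : derivation d -> (cder d P)@_m = d P@_m.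
Proof.
move=> dP; rewrite /cder raddf_sum /=.
under eq_bigr do rewrite mcoeffZ mcoeffX.
have [mP|mP] := boolP (m \in msupp P); last first.
  rewrite (memN_msupp_eq0 mP) (derivation0 dP) big1_seq // => k /= kP.
  by case: eqP kP => [->|]; rewrite ?(negPf mP) ?mulr0.
rewrite (bigD1_seq m) ?msupp_uniq //= eqxx mulr1 big1 ?addr0 // => k /negPf ->.
by rewrite mulr0.
Qed.

(* The composition d P, where 'X_i stands for d. *)
Definition comp_left (d : F -> F) (i : 'I_2) P : lpdo F :=
  cder d P + \sum_(m <- msupp P) P@_m *: 'X_[m + U_(i)].

(** The Leibniz rule for d on (P h) G^(j): one term for the coefficient and, for each (s, f) in [g],
    one with exponent j + s. *)
Definition fam_der (d : F -> F) (i : 'I_2) g e : opfam F :=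
  flatten [seq (p.1, comp_left d i p.2) ::
    [seq (p.1 + x.1, d x.2 *: p.2) | x <- g] | p <- e].

(** The derivations d_y are applied before the d_x. They meet operators free of d_x only, on which
    composition with d_y on the left just raises an exponent. *)
Definition yonly P : Prop := forall m, m \in msupp P -> m ord0 = 0%N.

Definition fam_coef e (j : rat) : lpdo F := \sum_(p <- e | p.1 == j) p.2.

Lemma big_fam_der (V : zmodType) d i g e (f : rat * lpdo F -> V) :
  \sum_(p <- fam_der d i g e) f p =
  \sum_(p <- e) (f (p.1, comp_left d i p.2) +
                 \sum_(x <- g) f (p.1 + x.1, d x.2 *: p.2)).
Proof.
rewrite big_flatten big_map; apply: eq_bigr => p _.
by rewrite big_cons big_map.
Qed.

Variables (dx dy : F -> F).

(* T (h G) = \sum_((j, P) <- conj_list T g) (P h) G^(j). *)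
Definition conj_list T g : opfam F :=
  flatten [seq [seq (p.1, T@_m *: p.2) |
      p <- iter (m ord0) (fam_der dx ord0 g)
             (iter (m ord_max) (fam_der dy ord_max g) [:: (0, 1)])]
    | m <- msupp T].

Definition conj_coef T g j : lpdo F := fam_coef (conj_list T g) j.

Hypothesis dxP : derivation dx.
Hypothesis dyP : derivation dy.

Section Action.
Variables (W : lmodType F) (Dx Dy : W -> W) (tau : rat -> W -> W).
Hypothesis DxD : {morph Dx : u v / u + v}.
Hypothesis DyD : {morph Dy : u v / u + v}.
Hypothesis DxZ : forall a u, Dx (a *: u) = dx a *: u + a *: Dx u.
Hypothesis DyZ : forall a u, Dy (a *: u) = dy a *: u + a *: Dy u.
Hypothesis tauD : forall i, {morph tau i : u v / u + v}.
Hypothesis tauZ : forall i a u, tau i (a *: u) = a *: tau i u.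
Hypothesis tau_tau : forall i j u, tau i (tau j u) = tau (j + i) u.
Hypothesis tau0 : forall u, tau 0 u = u.
Hypothesis Dx_tau : forall i u, Dx (tau i u) = tau i (Dx u).
Hypothesis Dy_tau : forall i u, Dy (tau i u) = tau i (Dy u).

Definition mon_act (w : W) (m : 'X_{1..2}) : W :=
  iter (m ord0) Dx (iter (m ord_max) Dy w).
Definition act P w : W := mlin (mon_act w) P.

(* The action of d on w G, where tau i w stands for w G^(i); the coefficients w
   may be series, families of operators or differential polynomials. *)
Definition twisted (d : F -> F) (D : W -> W) g w : W :=
  D w + \sum_(x <- g) d x.2 *: tau x.1 w.

Definition twisted_act g T w : W :=
  \sum_(m <- msupp T) T@_m *: iter (m ord0) (twisted dx Dx g)
    (iter (m ord_max) (twisted dy Dy g) w).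

Lemma morph_sum (D : W -> W) (I : eqType) (s : seq I) (u : I -> W) :
  {morph D : x y / x + y} -> D (\sum_(i <- s) u i) = \sum_(i <- s) D (u i).
Proof.
move=> DD; have D0 : D 0 = 0 by apply: (addrI (D 0)); rewrite -DD !addr0.
by elim: s => [|i s IH]; rewrite ?big_nil // !big_cons DD IH.
Qed.

Lemma act_comp_left_x P w : Dx (act P w) = act (comp_left dx ord0 P) w.
Proof.
rewrite {1}/act {1}/mlin morph_sum // /act linearD !linear_sum -big_split.
apply: eq_bigr => m _ /=; rewrite !linearZ /= !mlinX DxZ; congr (_ + _ *: _).
by rewrite /mon_act !mnmDE !mnm1E /= addn1 addn0.
Qed.

Lemma act_comp_left_y P w : yonly P ->
  Dy (act P w) = act (comp_left dy ord_max P) w.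
Proof.
move=> yP; rewrite {1}/act {1}/mlin morph_sum // /act linearD !linear_sum -big_split.
apply: eq_big_seq => m /yP my /=; rewrite !linearZ /= !mlinX DyZ.
congr (_ + _ *: _).
by rewrite /mon_act !mnmDE !mnm1E my /= addn1.
Qed.

Lemma tau_iter (D : W -> W) k i w : (forall u, D (tau i u) = tau i (D u)) ->
  iter k D (tau i w) = tau i (iter k D w).
Proof. by move=> Dt; elim: k => //= k ->. Qed.

Lemma tau_act i P w : tau i (act P w) = act P (tau i w).
Proof.
rewrite /act /mlin morph_sum //; apply: eq_bigr => m _.
by rewrite tauZ /mon_act !tau_iter.
Qed.

Definition fam_act e w : W := \sum_(p <- e) act p.2 (tau p.1 w).

Lemma fam_act_der_x g e w :
  twisted dx Dx g (fam_act e w) = fam_act (fam_der dx ord0 g e) w.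
Proof.
rewrite /fam_act big_fam_der big_split /= /twisted (morph_sum _ _ DxD).
congr (_ + _); first by apply: eq_bigr => p _; apply: act_comp_left_x.
rewrite exchange_big /=; apply: eq_bigr => x _.
rewrite (morph_sum _ _ (tauD _)) scaler_sumr; apply: eq_bigr => p _.
by rewrite tau_act tau_tau /act linearZ.
Qed.

Lemma fam_act_der_y g e w : (forall p, p \in e -> yonly p.2) ->
  twisted dy Dy g (fam_act e w) = fam_act (fam_der dy ord_max g e) w.
Proof.
move=> ye; rewrite /fam_act big_fam_der big_split /= /twisted (morph_sum _ _ DyD).
congr (_ + _); first by apply: eq_big_seq => p /ye; apply: act_comp_left_y.
rewrite exchange_big /=; apply: eq_bigr => x _.
rewrite (morph_sum _ _ (tauD _)) scaler_sumr; apply: eq_bigr => p _.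
by rewrite tau_act tau_tau /act linearZ.
Qed.

Lemma msupp_sumZ (I : eqType) (s : seq I) (a : I -> F) (f : I -> 'X_{1..2}) m :
  m \in msupp (\sum_(i <- s) a i *: 'X_[f i]) -> exists2 i, i \in s & m = f i.
Proof.
rewrite mcoeff_msupp raddf_sum /= => h; apply: boolp.contrapT => nh.
case/negP: h; apply/eqP; apply: big1_seq => i /= si.
rewrite mcoeffZ mcoeffX; case: eqP => [e|]; rewrite ?mulr0 //.
by case: nh; exists i.
Qed.

Lemma yonly_fam_der g e : (forall p, p \in e -> yonly p.2) ->
  forall p, p \in fam_der dy ord_max g e -> yonly p.2.
Proof.
move=> ye p /flattenP[l /mapP[q qe ->]]; rewrite inE => /orP[/eqP-> /=|].
  move=> m /msuppD_le; rewrite mem_cat => /orP[|] /msupp_sumZ[k /(ye _ qe) k0 ->] //.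
  by rewrite mnmDE mnm1E k0.
by case/mapP => x _ -> /= m /msuppZ_le; apply: ye.
Qed.

(** The twisted derivations of a family are again families, given by [fam_der]. Hence one list,
    computed from [T] and [g], describes the action of [T] on w G for every kind of coefficients
    w. *)
Lemma conj_act T g w : twisted_act g T w = fam_act (conj_list T g) w.
Proof.
rewrite /fam_act /conj_list big_flatten big_map /twisted_act.
apply: eq_bigr => m _; rewrite big_map /=.
transitivity (T@_m *: fam_act (iter (m ord0) (fam_der dx ord0 g)
    (iter (m ord_max) (fam_der dy ord_max g) [:: (0, 1)])) w); last first.
  by rewrite scaler_sumr; apply: eq_bigr => p _; rewrite /act linearZ.
congr (_ *: _).
have [-> _] : iter (m ord_max) (twisted dy Dy g) w =
    fam_act (iter (m ord_max) (fam_der dy ord_max g) [:: (0, 1)]) w /\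
    forall p, p \in iter (m ord_max) (fam_der dy ord_max g) [:: (0, 1)] ->
      yonly p.2.
  elim: (m ord_max) => [|k [IH yk]] /=.
    split=> [|p]; last first.
      rewrite inE => /eqP-> k; rewrite -mpolyC1 msuppC oner_eq0 inE.
      by move/eqP->; rewrite mnm0E.
    rewrite /fam_act big_seq1 /= tau0 /act -mpolyX0 mlinX /mon_act.
    by rewrite !mnm0E.
  by split; [rewrite IH fam_act_der_y|apply: yonly_fam_der].
by elim: (m ord0) => [|k IH] //=; rewrite IH fam_act_der_x.
Qed.

End Action.
End Operators.

Lemma sum_funE (A : Type) (V : zmodType) (I : Type) (s : seq I)
    (f : I -> A -> V) a :
  (\sum_(i <- s) f i) a = \sum_(i <- s) f i a.
Proof. by elim/big_rec2: _ => // i u w _ <-. Qed.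

(** * Collected families of operators and their leading forms *)

Section FamilyTwist.
Variables (F : fieldType) (dx dy : F -> F).
Hypothesis dxP : derivation dx.
Hypothesis dyP : derivation dy.
Implicit Types (P Q T : lpdo F) (l : opfam F) (g : seq (rat * F)).
Implicit Types (e : rat -> lpdo F) (i : 'I_2) (d : F -> F).

(** The effect of [fam_der] after the operators with equal exponents have been added up. *)
Definition fam_twist d i g e : rat -> lpdo F :=
  fun j => comp_left d i (e j) + \sum_(x <- g) d x.2 *: e (j - x.1).

Definition fam_one : rat -> lpdo F := fun j => (j == 0)%:R.

Lemma cderD d P Q : derivation d -> cder d (P + Q) = cder d P + cder d Q.
Proof.
move=> dP; apply/mpolyP => m; rewrite mcoeffD !cder_coef // mcoeffD.
by case: dP => ->.
Qed.

Lemma comp_leftE d i P : comp_left d i P = cder d P + 'X_i * P.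
Proof.
rewrite /comp_left; congr (_ + _); rewrite [in RHS](mpolyE P) mulr_sumr.
by apply: eq_bigr => m _; rewrite -scalerAr mulrC -mpolyXD.
Qed.

Lemma comp_leftD d i P Q : derivation d ->
  comp_left d i (P + Q) = comp_left d i P + comp_left d i Q.
Proof. by move=> dP; rewrite !comp_leftE cderD // mulrDr addrACA. Qed.

Lemma comp_left0 d i : derivation d -> comp_left d i 0 = 0.
Proof.
move=> dP; apply: (addrI (comp_left d i 0)).
by rewrite -comp_leftD // !addr0.
Qed.

Lemma comp_leftZ d i a P : derivation d ->
  comp_left d i (a *: P) = d a *: P + a *: comp_left d i P.
Proof.
move=> dP; rewrite !comp_leftE scalerDr addrA -scalerAr; congr (_ + _).
apply/mpolyP => m; rewrite mcoeffD !cder_coef // !mcoeffZ cder_coef //.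
by case: dP => _ ->.
Qed.

Lemma fam_coef_cons p l j :
  fam_coef (p :: l) j = (if p.1 == j then p.2 else 0) + fam_coef l j.
Proof. by rewrite /fam_coef big_cons; case: ifP; rewrite ?add0r. Qed.

Lemma fam_coefE l j : fam_coef l j = \sum_(p <- l) if p.1 == j then p.2 else 0.
Proof. by rewrite /fam_coef big_mkcond. Qed.

Lemma fam_coef_der d i g l : derivation d ->
  fam_coef (fam_der d i g l) = fam_twist d i g (fam_coef l).
Proof.
move=> dP; apply: boolp.funext => j; rewrite fam_coefE big_fam_der big_split /=.
congr (_ + _).
  rewrite fam_coefE; elim: l => [|p l IH]; first by rewrite !big_nil comp_left0.
  by rewrite !big_cons comp_leftD // -IH; case: ifP; rewrite ?comp_left0.
rewrite exchange_big /=; apply: eq_bigr => x _.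
rewrite fam_coefE scaler_sumr; apply: eq_bigr => p _.
rewrite [p.1 == _ - _]eq_sym subr_eq /= [_ == j]eq_sym.
by case: ifP; rewrite ?scaler0.
Qed.

Lemma fam_coef_one : fam_coef [:: (0, 1)] = fam_one.
Proof.
apply: boolp.funext => j; rewrite fam_coef_cons /fam_coef big_nil addr0 /=.
by rewrite /fam_one eq_sym; case: eqP.
Qed.

Definition mon_twist g (m : 'X_{1..2}) : rat -> lpdo F :=
  iter (m ord0) (fam_twist dx ord0 g)
    (iter (m ord_max) (fam_twist dy ord_max g) fam_one).

Lemma conj_coefE T g j :
  conj_coef dx dy T g j = mlin (fun m => mon_twist g m j) T.
Proof.
rewrite /conj_coef fam_coefE /conj_list big_flatten big_map.
apply: eq_bigr => m _; rewrite big_map.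
transitivity (T@_m *: fam_coef (iter (m ord0) (fam_der dx ord0 g)
   (iter (m ord_max) (fam_der dy ord_max g) [:: (0, 1)])) j).
  rewrite fam_coefE scaler_sumr; apply: eq_bigr => p _ /=.
  by case: ifP; rewrite ?scaler0.
congr (_ *: _); rewrite /mon_twist -fam_coef_one.
have -> : forall k l, fam_coef (iter k (fam_der dx ord0 g) l) =
    iter k (fam_twist dx ord0 g) (fam_coef l).
  by elim=> //= k IH l; rewrite fam_coef_der // IH.
congr (iter _ _ _ _).
by elim: (m ord_max) => //= k IH; rewrite fam_coef_der // IH.
Qed.

(** Conjugation is done in two stages. The families twisted by [[:: x]] form a module with
    derivations, and twisting these by [g] is the same as twisting by [rcons g x]; so [conj_act]
    applies to this module. *)
Lemma conj_coef_rcons T g x j :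
  conj_coef dx dy T (rcons g x) j =
  \sum_(p <- conj_list dx dy T g) conj_coef dx dy p.2 [:: x] (j - p.1).
Proof.
pose tau (i : rat) (e : rat -> lpdo F) : rat -> lpdo F := fun j => e (j - i).
pose D d i : (rat -> lpdo F) -> rat -> lpdo F := fam_twist d i [:: x].
have DD d i : derivation d -> {morph D d i : u v / u + v}.
  move=> dP u v; apply: boolp.funext => k.
  transitivity (D d i u k + D d i v k); last by [].
  rewrite /D /fam_twist !big_seq1 [RHS]addrACA -comp_leftD // -scalerDr.
  by [].
have DZ d i : derivation d ->
    forall a u, D d i (a *: u) = d a *: u + a *: D d i u.
  move=> dP a u; apply: boolp.funext => k.
  transitivity (d a *: u k + a *: D d i u k); last by [].
  rewrite /D /fam_twist !big_seq1 scalerDr addrA -comp_leftZ //.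
  by congr (_ + _); rewrite !scalerA mulrC -scalerA.
have Dtau d i : forall k u, D d i (tau k u) = tau k (D d i u).
  move=> k u; apply: boolp.funext => k'; rewrite /D /fam_twist /tau !big_seq1.
  by congr (_ + _ *: u _); rewrite addrAC.
have tau_tau k k' u : tau k (tau k' u) = tau (k' + k) u.
  by apply: boolp.funext => k''; rewrite /tau opprD addrA [in LHS]addrAC.
have tau0 u : tau 0 u = u by apply: boolp.funext => k; rewrite /tau subr0.
have := @conj_act F dx dy (rat -> lpdo F) (D dx ord0) (D dy ord_max) tau
  (DD _ _ dxP) (DD _ _ dyP) (DZ _ _ dxP) (DZ _ _ dyP) (fun _ _ _ => erefl)
  (fun _ _ _ => erefl) tau_tau tau0 (Dtau _ _) (Dtau _ _) T g fam_one.
move/(congr1 (fun u => u j)).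
have twD d i : derivation d ->
    twisted tau d (D d i) g = fam_twist d i (rcons g x).
  move=> dP; apply: boolp.funext => u; apply: boolp.funext => k.
  transitivity (D d i u k + (\sum_(y <- g) d y.2 *: tau y.1 u) k); first by [].
  rewrite sum_funE /D /fam_twist big_seq1 -cats1 big_cat /= big_seq1 -addrA.
  by congr (_ + _); apply: addrC.
rewrite /twisted_act /fam_act !twD // !sum_funE => h.
rewrite conj_coefE; apply: (etrans h).
apply: eq_bigr => p _; rewrite conj_coefE.
rewrite -(@tau_act F _ (D dx ord0) (D dy ord_max) tau) //.
by rewrite /tau /act /mlin sum_funE.
Qed.

Section LeadingForm.
Variables (c : rat) (f : F).
Hypothesis dxy : forall x, dx (dy x) = dy (dx x).

Local Notation wt m := (c * (mdeg m)%:R).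

(* The monomial m of e j is placed at the point (j, mdeg m). *)
Definition below (M : rat) (e : rat -> lpdo F) : Prop :=
  forall j m, (e j)@_m != 0 -> j + wt m <= M.

Definition leading_form (M : rat) (e : rat -> lpdo F) (Q : {mpoly F[2]}) : Prop :=
  forall m, Q@_m = (e (M - wt m))@_m.

Lemma coef_mulX i P m :
  ('X_i * P)@_m = if m i == 0%N then 0 else P@_(m - U_(i)).
Proof.
rewrite mulrC; case: ifP => [mi|/negbT mi]; last first.
  by rewrite -{1}(submK (m := U_(i)) (m' := m)) ?lep1mP // addmC mcoeffMX.
rewrite [P]mpolyE mulr_suml raddf_sum /= big1 // => k _.
rewrite -scalerAl mcoeffZ -mpolyXD mcoeffX.
case: eqP => [e|]; last by rewrite mulr0.
by move: mi; rewrite -e mnmDE mnm1E eqxx addn1.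
Qed.

Lemma mdeg_sub1 (m : 'X_{1..2}) i : m i != 0%N ->
  mdeg m = (mdeg (m - U_(i))%MM).+1.
Proof.
by move=> mi; rewrite -[in LHS](submK (m := U_(i)) (m' := m)) ?lep1mP //
  mdegD mdeg1 addn1.
Qed.

Lemma below_twist d i M e : derivation d -> 0 < c -> below M e ->
  below (M + c) (fam_twist d i [:: (c, f)] e).
Proof.
move=> dP c0 be j m; rewrite /fam_twist big_seq1 comp_leftE !mcoeffD mcoeffZ /=.
rewrite cder_coef // coef_mulX => h.
have [|e1] := boolP ((e j)@_m != 0); first by move/be => h'; lra.
have [|e2] := boolP ((e (j - c))@_m != 0); first by move/be => h'; lra.
move: h; move: e1 e2; rewrite !negbK => /eqP-> /eqP->.
rewrite derivation0 // mulr0 add0r addr0; case: ifP => [_|/negbT mi].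
  by rewrite eqxx.
by move/be => h'; rewrite (mdeg_sub1 mi) -natr1 mulrDr mulr1 addrA lerD2r.
Qed.

(** The line moves from M to M + c. It is reached by raising the degree by one and by raising the
    exponent by c, which yields the factor X_i + d f; differentiating coefficients does not reach it
    because c > 0. *)
Lemma leading_twist d i M e Q : derivation d -> 0 < c ->
  below M e -> leading_form M e Q ->
  leading_form (M + c) (fam_twist d i [:: (c, f)] e) (('X_i + (d f)%:MP) * Q).
Proof.
move=> dP c0 be lQ m; rewrite /fam_twist big_seq1 comp_leftE !mcoeffD mcoeffZ /=.
rewrite cder_coef // mulrDl mcoeffD mcoeffCM !coef_mulX !lQ.
rewrite (_ : M + c - wt m - c = M - wt m); last by ring.
congr (_ + _).
have -> : (e (M + c - wt m))@_m = 0.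
  by apply: contraTeq isT => /be; lra.
rewrite derivation0 // add0r; case: ifP => // /negbT mi.
by rewrite (mdeg_sub1 mi) -natr1; congr ((e _)@__); ring.
Qed.

Lemma below_one : below 0 fam_one.
Proof.
move=> j m; rewrite /fam_one; have [->|j0] := eqVneq j 0; last first.
  by rewrite mcoeff0 eqxx.
rewrite ?eqxx mcoeff1; case: (m =P 0%MM) => [->|]; rewrite ?eqxx //.
by rewrite mdeg0 mulr0 addr0.
Qed.

Lemma leading_one : 0 < c -> leading_form 0 fam_one 1.
Proof.
move=> c0 m; rewrite /fam_one sub0r oppr_eq0 mulf_eq0 gt_eqF //= pnatr_eq0.
rewrite mdeg_eq0 mcoeff1; case: (m =P 0%MM) => [->|]; last by rewrite mcoeff0.
by rewrite mcoeff1 eqxx.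
Qed.

Definition grad : 'I_2 -> F := gradient dx dy f.

Lemma mon_twist_leading m : 0 < c ->
  below (wt m) (mon_twist [:: (c, f)] m) /\
  leading_form (wt m) (mon_twist [:: (c, f)] m) (mshift grad 'X_[m]).
Proof.
move=> c0; have -> : mshift grad 'X_[m] =
   ('X_ord0 + (dx f)%:MP) ^+ m ord0 * ('X_ord_max + (dy f)%:MP) ^+ m ord_max.
  rewrite mpolyXE_id rmorph_prod big_ord_recl big_ord1 /=.
  rewrite (_ : lift ord0 ord0 = ord_max); last exact: val_inj.
  by rewrite !rmorphXn /= !mshiftX.
have -> : wt m = c * (m ord_max)%:R + c * (m ord0)%:R.
  rewrite mdegE big_ord_recl big_ord1 natrD mulrDr addrC.
  by rewrite (_ : lift ord0 ord0 = ord_max) //; apply: val_inj.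
rewrite /mon_twist; elim: (m ord0) => [|k [bk lk]] /=; last first.
  rewrite -natr1 mulrDr mulr1 addrA exprS -mulrA.
  by split; [apply: below_twist|apply: leading_twist].
rewrite expr0 mul1r mulr0 addr0; elim: (m ord_max) => [|k [bk lk]] /=.
  by rewrite expr0 mulr0; split; [apply: below_one|apply: leading_one].
rewrite -natr1 mulrDr mulr1 exprS.
by split; [apply: below_twist|apply: leading_twist].
Qed.

Lemma sum_fam_act (V : lmodType F) l (phi : lpdo F -> rat -> V) j :
  (forall k, linear (phi^~ k)) ->
  \sum_(p <- l) phi p.2 (j - p.1) =
  \sum_(i <- undup [seq p.1 | p <- l]) phi (fam_coef l i) (j - i).
Proof.
move=> lphi.
have phiD k P Q : phi (P + Q) k = phi P k + phi Q k.
  by have := lphi k 1 P Q; rewrite !scale1r.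
have phi0 k : phi 0 k = 0 by apply: (addrI (phi 0 k)); rewrite -phiD !addr0.
have phi_sum k (s : opfam F) (B : pred (rat * lpdo F)) :
    phi (\sum_(p <- s | B p) p.2) k = \sum_(p <- s | B p) phi p.2 k.
  by elim/big_rec2: _ => // p u w _ <-; rewrite phiD.
transitivity (\sum_(i <- undup [seq p.1 | p <- l]) \sum_(p <- l)
    if p.1 == i then phi p.2 (j - i) else 0).
  rewrite exchange_big /=; apply: eq_big_seq => p pl.
  have pk : p.1 \in undup [seq q.1 | q <- l] by rewrite mem_undup map_f.
  rewrite (bigD1_seq p.1) ?undup_uniq //= eqxx big1 ?addr0 // => i /negPf.
  by rewrite eq_sym => ->.
by apply: eq_bigr => i _; rewrite -big_mkcond /= -phi_sum.
Qed.

End LeadingForm.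
End FamilyTwist.

Section ConjugationLeading.
Variables (F : fieldType) (dx dy : F -> F).
Hypothesis dxP : derivation dx.
Hypothesis dyP : derivation dy.
Implicit Types (P Q T : lpdo F) (g : seq (rat * F)) (m k : 'X_{1..2}).

Local Notation conj := (conj_coef dx dy).
Local Notation wt c m := (c * (mdeg m)%:R).

(** The exponents that may occur, each once; by cancellation, [conj T g j] can still be zero at some
    of them. *)
Definition keys T g : seq rat := undup [seq p.1 | p <- conj_list dx dy T g].

Lemma conj_keys T g j : conj T g j != 0 -> j \in keys T g.
Proof.
rewrite mem_undup; apply: contraR => jk; rewrite /conj_coef /fam_coef.
rewrite big1_seq // => p /andP[/eqP pj pl]; case/negP: jk.
by rewrite -pj map_f.
Qed.

Lemma conj_rcons_keys T g x j :
  conj T (rcons g x) j = \sum_(i <- keys T g) conj (conj T g i) [:: x] (j - i).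
Proof.
rewrite (conj_coef_rcons dxP dyP).
rewrite (sum_fam_act _ (phi := fun P r => conj P [:: x] r)) // => k a P Q.
by rewrite !(conj_coefE dxP dyP) linearP.
Qed.

Lemma mcoeff_mlin (phi : 'X_{1..2} -> lpdo F) P k :
  (mlin phi P)@_k = \sum_(m <- msupp P) P@_m * (phi m)@_k.
Proof. by rewrite raddf_sum; apply: eq_bigr => m _ /=; rewrite mcoeffZ. Qed.

(** By [conj_rcons_keys] each monomial m of T_i can be conjugated by (c, f) alone. The result stays
    below the line of slope c through (i, |m|), with leading form the shift of X^m; so only the
    points on the line M contribute to the new leading form. *)
Lemma conj_leading T g c f M Q : 0 < c ->
  below c M (conj T g) -> leading_form c M (conj T g) Q ->
  below c M (conj T (rcons g (c, f))) /\
  leading_form c M (conj T (rcons g (c, f))) (mshift (gradient dx dy f) Q).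
Proof.
move=> c0 bT lT.
pose E m := mon_twist dx dy [:: (c, f)] m.
have bE m : below c (wt c m) (E m).
  by case: (mon_twist_leading dxP dyP f m c0).
have lE m : leading_form c (wt c m) (E m) (mshift (gradient dx dy f) 'X_[m]).
  by case: (mon_twist_leading dxP dyP f m c0).
have coefE j k : (conj T (rcons g (c, f)) j)@_k =
    \sum_(i <- keys T g) \sum_(m <- msupp (conj T g i))
      (conj T g i)@_m * (E m (j - i))@_k.
  rewrite conj_rcons_keys raddf_sum; apply: eq_bigr => i _ /=.
  by rewrite (conj_coefE dxP dyP) mcoeff_mlin.
split=> [j k|k].
  rewrite coefE => h; apply: contraNT h; rewrite -ltNge => lt.
  rewrite big1 // => i _; rewrite big1_seq // => m /= mC.
  have bm : i + wt c m <= M by apply: bT; rewrite -mcoeff_msupp.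
  have [->|/bE h] := eqVneq ((E m (j - i))@_k) 0; first by rewrite mulr0.
  by exfalso; lra.
pose S m := (mshift (gradient dx dy f) 'X_[m])@_k.
transitivity (\sum_(m <- msupp Q) Q@_m * S m).
  rewrite [in LHS](mpolyE Q) rmorph_sum raddf_sum /=; apply: eq_bigr => m _.
  by rewrite -mul_mpolyC rmorphM /= mshiftC mul_mpolyC mcoeffZ.
rewrite coefE.
transitivity (\sum_(i <- keys T g)
   \sum_(m <- msupp Q | i == M - wt c m) Q@_m * S m).
  under [RHS]eq_bigr do rewrite big_mkcond /=.
  rewrite exchange_big; apply: eq_big_seq => m mQ /=.
  rewrite (bigD1_seq (M - wt c m)) ?undup_uniq //=.
    by rewrite eqxx big1 ?addr0 // => i /negPf ->.
  apply: conj_keys; move: mQ; rewrite mcoeff_msupp lT.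
  by apply: contraNneq => ->; rewrite mcoeff0.
apply: eq_bigr => i _.
transitivity (\sum_(m <- msupp (conj T g i) | i == M - wt c m) Q@_m * S m).
  rewrite -big_filter -[RHS]big_filter; apply: perm_big.
  apply: uniq_perm; rewrite ?filter_uniq ?msupp_uniq // => m.
  rewrite !mem_filter; case: eqP => //= ->.
  by rewrite !mcoeff_msupp lT.
rewrite big_mkcond /=; apply: eq_big_seq => m mC.
case: eqP => [ei|ni].
  rewrite lT -ei /S lE; congr (_ * (E m _)@__).
  by rewrite ei; ring.
have bm : i + wt c m <= M by apply: bT; rewrite -mcoeff_msupp.
have [->|/bE h] := eqVneq ((E m (M - wt c k - i))@_k) 0; first by rewrite mulr0.
by case: ni; lra.
Qed.

(** The exponents are sums of the s_i. This serves for their non-negativity and for their becoming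
    integers when multiplied by the denominator. *)
Lemma keys_in (S : rat -> Prop) T g : S 0 -> (forall i j, S i -> S j -> S (i + j)) ->
  (forall x, x \in g -> S x.1) -> forall j, j \in keys T g -> S j.
Proof.
move=> S0 SD Sg j; rewrite mem_undup => /mapP[p + ->].
have der d i l : (forall q, q \in l -> S q.1) ->
    forall q, q \in fam_der d i g l -> S q.1.
  move=> Sl q /flattenP[s /mapP[r rl ->]]; rewrite inE => /orP[/eqP->|].
    exact: (Sl r rl).
  by case/mapP => x xg -> /=; apply: SD; [apply: Sl|apply: Sg].
have iter_der d i l (k : nat) : (forall q, q \in l -> S q.1) ->
    forall q, q \in iter k (fam_der d i g) l -> S q.1.
  by move=> Sl; elim: k => //= k IH; apply: der.
move=> /flattenP[s /mapP[m _ ->]] /mapP[q + ->] /=.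
apply: (iter_der) => r; apply: (iter_der) => r'.
by rewrite inE => /eqP->.
Qed.

Lemma conj_nil T j : conj T [::] j = if j == 0 then T else 0.
Proof.
have comp_X d i m : derivation d -> comp_left d i 'X_[m] = 'X_[m + U_(i)].
  move=> dP; rewrite comp_leftE mulrC -mpolyXD (_ : cder d _ = 0) ?add0r //.
  apply/mpolyP => k; rewrite cder_coef // mcoeffX mcoeff0.
  by case: eqP; rewrite ?derivation1 ?derivation0.
pose mono m : rat -> lpdo F := fun u => if u == 0 then 'X_[m] else 0.
have twX d i m (r : nat) : derivation d ->
    iter r (fam_twist d i [::]) (mono m) = mono (m + U_(i) *+ r)%MM.
  move=> dP; elim: r => [|r IH] /=; first by rewrite mulm0n addm0.
  rewrite IH; apply: boolp.funext => u; rewrite /fam_twist /mono big_nil addr0.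
  by case: (u == 0); rewrite ?comp_left0 // comp_X // -addmA -mulmSr.
have one : @fam_one F = mono 0%MM.
  by apply: boolp.funext => u; rewrite /fam_one /mono mpolyX0; case: (u == 0).
rewrite (conj_coefE dxP dyP) (mpolyE T) linear_sum /=.
under eq_bigr do rewrite linearZ /= mlinX /mon_twist one !twX // /mono.
case: (j == 0); last by rewrite big1 // => m _; rewrite scaler0.
apply: eq_bigr => m _; congr (_ *: 'X_[_]); apply/mnmP.
by apply: ord2P; rewrite !mnmDE !mulmnE !mnm1E mnm0E /= ?mul1n ?mul0n ?addn0.
Qed.

End ConjugationLeading.

(** * The expansion of T(hG) *)

Section MalgExtension.
Variables (K : choiceType) (G V : zmodType) (phi : K -> G -> V).
Hypothesis phiD : forall k, {morph phi k : a b / a + b}.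

Definition malg_ext (p : monalg.malg K G) : V :=
  \sum_(k <- monalg.msupp p) phi k (monalg.mcoeff k p).

Lemma malg_ext0 k : phi k 0 = 0.
Proof. by apply: (addrI (phi k 0)); rewrite -phiD !addr0. Qed.

Lemma malg_ext_widen (s : {fset K}) (p : monalg.malg K G) :
  (monalg.msupp p `<=` s)%fset ->
  malg_ext p = \sum_(k <- s) phi k (monalg.mcoeff k p).
Proof.
move=> ps; apply: big_fset_incl => // k _ kp.
by rewrite (monalg.mcoeff_outdom kp) malg_ext0.
Qed.

Lemma malg_extD : {morph malg_ext : p q / p + q}.
Proof.
move=> p q; pose s := (monalg.msupp p `|` monalg.msupp q)%fset.
rewrite !(@malg_ext_widen s) ?fsubsetUl ?fsubsetUr ?monalg.msuppD_le //.
by rewrite -big_split; apply: eq_bigr => k _; rewrite monalg.mcoeffD phiD.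
Qed.

Lemma malg_extU k a : malg_ext (monalg.mkmalgU k a) = phi k a.
Proof.
rewrite (@malg_ext_widen [fset k]%fset) ?monalg.msuppU_le // big_seq_fset1.
by rewrite monalg.mcoeffUU.
Qed.

End MalgExtension.

Lemma malg_ind (K : choiceType) (G : zmodType) (P : monalg.malg K G -> Prop) :
  P 0 -> (forall p q, P p -> P q -> P (p + q)) ->
  (forall k a, P (monalg.mkmalgU k a)) -> forall p, P p.
Proof.
by move=> P0 PD PU p; rewrite [p]monalg.monalgE; elim/big_ind: _.
Qed.

Lemma mcoeff_expansion (F : fieldType) (U : lmodType F) (D M : U -> U)
    (d : F -> F) (g : seq (rat * F)) (e : monalg.malg (rat * nat)%type U) q :
  {morph D : u v / u + v} -> {morph M : u v / u + v} ->
  monalg.mcoeff q (\sum_(p <- monalg.msupp e)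
    (monalg.mkmalgU p (D (monalg.mcoeff p e)) +
     \sum_(x <- g) monalg.mkmalgU (p.1 + x.1, p.2) (d x.2 *: monalg.mcoeff p e) +
     monalg.mkmalgU (p.1, p.2.+1) (M (monalg.mcoeff p e)))) =
  D (monalg.mcoeff q e) +
  (if q.2 is t.+1 then M (monalg.mcoeff (q.1, t) e) else 0) +
  \sum_(x <- g) d x.2 *: monalg.mcoeff (q.1 - x.1, q.2) e.
Proof.
move=> DD MD.
have D0 : D 0 = 0 by apply: (addrI (D 0)); rewrite -DD !addr0.
have M0 : M 0 = 0 by apply: (addrI (M 0)); rewrite -MD !addr0.
pose phi (p : rat * nat) (a : U) : monalg.malg (rat * nat)%type U :=
  monalg.mkmalgU p (D a) +
  \sum_(x <- g) monalg.mkmalgU (p.1 + x.1, p.2) (d x.2 *: a) +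
  monalg.mkmalgU (p.1, p.2.+1) (M a).
have phiD p : {morph phi p : a b / a + b}.
  move=> a b; rewrite /phi DD monalg.monalgUD MD monalg.monalgUD [RHS]addrACA.
  congr (_ + _); rewrite [RHS]addrACA; congr (_ + _); rewrite -big_split.
  by apply: eq_bigr => x _; rewrite scalerDr monalg.monalgUD.
change (monalg.mcoeff q (malg_ext phi e) = D (monalg.mcoeff q e) +
  (if q.2 is t.+1 then M (monalg.mcoeff (q.1, t) e) else 0) +
  \sum_(x <- g) d x.2 *: monalg.mcoeff (q.1 - x.1, q.2) e).
elim/malg_ind: e => [|e1 e2 IH1 IH2|p a].
- have -> : malg_ext phi 0 = 0 by rewrite /malg_ext monalg.msupp0 big_seq_fset0.
  rewrite !monalg.mcoeff0.
  rewrite D0 add0r big1 ?addr0 => [|x _]; last by rewrite monalg.mcoeff0 scaler0.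
  by case: q.2 => // t; rewrite monalg.mcoeff0 M0.
- rewrite (malg_extD phiD) !monalg.mcoeffD IH1 IH2 DD [LHS]addrACA.
  congr (_ + _).
    rewrite [LHS]addrACA; congr (_ + _); case: q.2 => [|t]; first by rewrite addr0.
    by rewrite monalg.mcoeffD MD.
  rewrite -big_split; apply: eq_bigr => x _ /=.
  by rewrite monalg.mcoeffD scalerDr.
rewrite (malg_extU phiD) /phi !monalg.mcoeffD !monalg.mcoeffU.
rewrite -addrA [X in _ + X]addrC addrA; congr (_ + _ + _).
- by case: (p == q); rewrite ?mulr1n ?mulr0n ?D0.
- case: q => u [|t]; first by rewrite xpair_eqE andbF.
  case: p => u' t' /=; rewrite !monalg.mcoeffU !xpair_eqE eqSS.
  by case: (_ && _); rewrite ?mulr1n ?mulr0n ?M0.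
rewrite raddf_sum; apply: eq_bigr => x _ /=; rewrite !monalg.mcoeffU.
case: p q => u t [u' t'] /=; rewrite !xpair_eqE.
rewrite [u == _]eq_sym subr_eq [_ == u']eq_sym.
by case: (_ && _); rewrite ?mulr1n ?mulr0n ?scaler0.
Qed.

Lemma big_finsupp_ucm (V : zmodType) (J : choiceType) (v : J) (f : J -> V) :
  \sum_(w <- finsupp (monalg.ucm v)) f w = f v.
Proof. by rewrite monalg.mdomU big_seq_fset1. Qed.

Section DpolyDerivation.
Variables (F : fieldType) (I : choiceType) (d : F -> F).
Variable up : I * (nat * nat) -> I * (nat * nat).
Hypothesis dP : derivation d.
Implicit Types p q : dpoly F I.

Local Notation term := (fun (m : monalg.cmonom (I * (nat * nat))%type) (a : F) =>
    monalg.mkmalgU m (d a) +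
    \sum_(v <- finsupp m)
      monalg.mkmalgU (monalg.mulcm (monalg.divcm m (monalg.ucm v))
        (monalg.ucm (up v))) (a *+ m v) : dpoly F I).

Lemma dpoly_termD m : {morph term m : a b / a + b}.
Proof.
move=> a b; have [dD _] := dP; rewrite dD monalg.monalgUD.
rewrite addrACA; congr (_ + _); rewrite -big_split; apply: eq_bigr => v _ /=.
by rewrite mulrnDl monalg.monalgUD.
Qed.

Lemma dpoly_derD : {morph dpoly_der d up : p q / p + q}.
Proof. exact: malg_extD dpoly_termD. Qed.

Lemma dpoly_derU m a : dpoly_der d up (monalg.mkmalgU m a) =
  monalg.mkmalgU m (d a) + \sum_(v <- finsupp m)
      monalg.mkmalgU (monalg.mulcm (monalg.divcm m (monalg.ucm v))
        (monalg.ucm (up v))) (a *+ m v).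
Proof. exact: malg_extU dpoly_termD m a. Qed.

Lemma dpoly_der0 : dpoly_der d up 0 = 0.
Proof. by apply: (addrI (dpoly_der d up 0)); rewrite -dpoly_derD !addr0. Qed.

Lemma scale_malgU (c a : F) (k : monalg.cmonom (I * (nat * nat))%type) :
  c *: (monalg.mkmalgU k a : dpoly F I) = monalg.mkmalgU k (c * a).
Proof.
apply: (monalg.malgP _ _).1 => k'.
have E x : monalg.mcoeff k' (monalg.mkmalgU k x : dpoly F I) = x *+ (k == k').
  exact: monalg.mcoeffU.
apply: (etrans (monalg.mcoeffZ _ _ _)); apply: (etrans _ (esym (E _))).
by apply: (etrans (congr1 _ (E _))); apply: mulrnAr.
Qed.

Lemma dpoly_derZ c p :
  dpoly_der d up (c *: p) = d c *: p + c *: dpoly_der d up p.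
Proof.
have [dD dM] := dP.
elim/malg_ind: p => [|p q IHp IHq|m a].
- by rewrite !scaler0 dpoly_der0 scaler0 addr0.
- apply: (etrans (congr1 _ (scalerDr c p q))); apply: (etrans (dpoly_derD _ _)).
  apply: (etrans (congr2 +%R IHp IHq)); apply: (etrans (addrACA _ _ _ _)).
  apply: (congr2 +%R (esym (scalerDr _ _ _))).
  apply: (etrans (esym (scalerDr c _ _))).
  exact: (congr1 (GRing.scale c) (esym (dpoly_derD p q))).
apply: (etrans (congr1 _ (scale_malgU c a m))).
apply: (etrans (dpoly_derU _ _)).
apply: (etrans _ (esym (congr2 +%R (scale_malgU (d c) a m)
  (congr1 (GRing.scale c) (dpoly_derU m a))))).
apply: (etrans _ (esym (congr1 (+%R _) (scalerDr _ _ _)))).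
apply: (etrans _ (esym (addrA _ _ _))); congr (_ + _).
  apply: (etrans (congr1 _ (dM c a))); apply: (etrans (monalg.monalgUD _ _ _)).
  exact: (congr1 (+%R _) (esym (scale_malgU c (d a) m))).
apply: (etrans _ (esym (scaler_sumr _ _ _ _))); apply: eq_bigr => v _.
apply: (etrans _ (esym (scale_malgU _ _ _))).
exact: (congr1 _ (esym (mulrnAr _ _ _))).
Qed.

Lemma dpoly_der_var u i j v :
  up (u, (i, j)) = v -> dpoly_der d up (dvar u i j) = monalg.mkmalgU (monalg.ucm v) 1.
Proof.
move=> upv; apply: (etrans (dpoly_derU _ _)).
have -> : d 1 = 0 by apply: derivation1.
set S := \sum_(w <- _) _; transitivity (0 + S).
  by congr (_ + _); apply: monalg.monalgU0.
apply: (etrans (add0r _)); apply: (etrans (big_finsupp_ucm _ _)).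
rewrite upv monalg.cmUU; apply: (congr1 (monalg.mkmalgU^~ _)).
apply/eqP/monalg.cmP => w; rewrite monalg.mulcmE monalg.divcmE subnn.
by rewrite add0n.
Qed.

End DpolyDerivation.

Section Expansion.
Variables (F : fieldType) (dx dy : F -> F).
Hypothesis dxP : derivation dx.
Hypothesis dyP : derivation dy.
Implicit Types (P Q T : lpdo F) (g : seq (rat * F)) (m : 'X_{1..2}).

Local Notation dp := (dpoly F 'I_2).
Local Notation W := (rat * nat -> dp).
Local Notation conj := (conj_coef dx dy).

Definition exp_der d up (dphi : dp) (w : W) : W :=
  fun q => dpoly_der d up (w q) +
    (if q.2 is t.+1 then dphi * w (q.1, t) else 0).

Definition exp_shift (i : rat) (w : W) : W := fun q => w (q.1 - i, q.2).

Local Notation exp_x := (exp_der dx up_x (dvar ind_phi 1 0)).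
Local Notation exp_y := (exp_der dy up_y (dvar ind_phi 0 1)).

Definition exp_one : W := fun q => if q == (0, 0%N) then dvar ind_h 0 0 else 0.

Definition coefs (e : monalg.malg (rat * nat)%type dp) : W :=
  fun q => monalg.mcoeff q e.

Lemma coefs_expansion_der d up dphi g e : derivation d ->
  coefs (expansion_der d up dphi g e) =
  twisted exp_shift d (exp_der d up dphi) g (coefs e).
Proof.
move=> dP.
apply: boolp.funext => q.
have DD := dpoly_derD (I := 'I_2) up dP.
have MD : {morph (fun a : dp => dphi * a) : u v / u + v}.
  by move=> a b; apply: mulrDr.
apply: (etrans (mcoeff_expansion d g e q DD MD)).
apply: (etrans _ (esym (congr1 (+%R _) (sum_funE _ _ _)))).
by [].
Qed.

Lemma coefs_iter d up dphi g k e : derivation d ->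
  coefs (iter k (expansion_der d up dphi g) e) =
  iter k (twisted exp_shift d (exp_der d up dphi) g) (coefs e).
Proof.
move=> dP; elim: k => // k IH.
exact: (etrans (coefs_expansion_der up dphi g _ dP) (congr1 _ IH)).
Qed.

Lemma coefs_expand T g :
  coefs (expand dx dy T g) =
  twisted_act dx dy exp_x exp_y exp_shift g T exp_one.
Proof.
have coefs_sum (I : Type) (s : seq I) (f : I -> monalg.malg (rat * nat)%type dp) :
    coefs (\sum_(i <- s) f i) = \sum_(i <- s) coefs (f i).
  apply: boolp.funext => q; rewrite sum_funE.
  by rewrite /coefs raddf_sum.
rewrite /expand coefs_sum /twisted_act; apply: eq_bigr => m _.
have one : coefs (monalg.mkmalgU (0, 0%N) (dvar ind_h 0 0)) = exp_one.
  apply: boolp.funext => q; rewrite /exp_one eq_sym.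
  apply: (etrans (monalg.mcoeffU _ _ _)).
  by case: (_ == q).
apply: (etrans _ (congr1 (fun w => T@_m *: iter (m ord0) _ (iter (m ord_max) _ w))
  one)).
apply: (etrans _ (congr1 (fun w => T@_m *: iter (m ord0) _ w)
  (coefs_iter up_y _ g _ _ dyP))).
apply: (etrans _ (congr1 (fun w => T@_m *: w) (coefs_iter up_x _ g _ _ dxP))).
apply: boolp.funext => q; apply: (etrans (monalg.mcoeffZ _ _ _)).
by rewrite -scalerAl mul1r.
Qed.

End Expansion.

Section AbstractExpansion.
Variables (F : fieldType) (U : lmodType F) (dx dy : F -> F).
Variables (Dx Dy Mx My : U -> U).
Hypothesis DxD : {morph Dx : u v / u + v}.
Hypothesis DyD : {morph Dy : u v / u + v}.
Hypothesis DxZ : forall a u, Dx (a *: u) = dx a *: u + a *: Dx u.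
Hypothesis DyZ : forall a u, Dy (a *: u) = dy a *: u + a *: Dy u.
Hypothesis MxD : {morph Mx : u v / u + v}.
Hypothesis MyD : {morph My : u v / u + v}.
Hypothesis MxZ : forall a u, Mx (a *: u) = a *: Mx u.
Hypothesis MyZ : forall a u, My (a *: u) = a *: My u.
Variable u0 : U.

Local Notation W := (rat * nat -> U).

(* w stands for \sum_(j, t) w (j, t) G^(j + sigma t), D for a derivation of the
   coefficients and M for the multiplication by its value at phi. *)
Definition gexp (D M : U -> U) (w : W) : W :=
  fun q => D (w q) + (if q.2 is t.+1 then M (w (q.1, t)) else 0).
Definition gshift (i : rat) (w : W) : W := fun q => w (q.1 - i, q.2).
Definition gone : W := fun q => if q == (0, 0%N) then u0 else 0.

Lemma gexpD D M : {morph D : u v / u + v} -> {morph M : u v / u + v} ->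
  {morph gexp D M : u v / u + v}.
Proof.
move=> DD MD u v; apply: boolp.funext => q.
transitivity (gexp D M u q + gexp D M v q); last by [].
rewrite /gexp DD [RHS]addrACA; congr (_ + _).
by case: q.2 => [|t]; rewrite ?addr0 // MD.
Qed.

Lemma gexpZ d D M : (forall a u, D (a *: u) = d a *: u + a *: D u) ->
  (forall a u, M (a *: u) = a *: M u) ->
  forall a u, gexp D M (a *: u) = d a *: u + a *: gexp D M u.
Proof.
move=> DZ MZ a u; apply: boolp.funext => q.
transitivity (d a *: u q + a *: gexp D M u q); last by [].
rewrite /gexp DZ scalerDr addrA; congr (_ + _).
by case: q.2 => [|t]; rewrite ?scaler0 // MZ.
Qed.

Local Notation gact := (mon_act (gexp Dx Mx) (gexp Dy My) gone).

Lemma gexp_iter_supp D M w k : {morph D : u v / u + v} ->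
  {morph M : u v / u + v} ->
  (forall i t, i != 0 -> w (i, t) = 0) ->
  forall i t, i != 0 -> iter k (gexp D M) w (i, t) = 0.
Proof.
move=> DD MD ws; have D0 : D 0 = 0 by apply: (addrI (D 0)); rewrite -DD !addr0.
have M0 : M 0 = 0 by apply: (addrI (M 0)); rewrite -MD !addr0.
elim: k => [|k IH] i t i0; first exact: ws.
rewrite iterS /gexp -/(gexp D M) IH //= D0 add0r.
by case: t => // t; rewrite IH ?M0.
Qed.

Lemma gact_supp m i t : i != 0 -> gact m (i, t) = 0.
Proof.
move=> i0; rewrite /mon_act; do 2! apply: gexp_iter_supp => // {}i {}t {}i0.
by rewrite /gone xpair_eqE (negPf i0).
Qed.

Lemma gexp_iter0 D M w k i : iter k (gexp D M) w (i, 0%N) = iter k D (w (i, 0%N)).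
Proof. by elim: k => //= k IH; rewrite /gexp /= -/(gexp D M) addr0 IH. Qed.

Lemma gact0 m : gact m (0, 0%N) = iter (m ord0) Dx (iter (m ord_max) Dy u0).
Proof. by rewrite /mon_act !gexp_iter0 /gone eqxx. Qed.

Lemma gexp_iter_top D M w k r i : {morph D : u v / u + v} ->
  {morph M : u v / u + v} -> (forall t, (r < t)%N -> w (i, t) = 0) ->
  (forall t, (r + k < t)%N -> iter k (gexp D M) w (i, t) = 0) /\
  iter k (gexp D M) w (i, (r + k)%N) = iter k M (w (i, r)).
Proof.
move=> DD MD ws; have D0 : D 0 = 0 by apply: (addrI (D 0)); rewrite -DD !addr0.
have M0 : M 0 = 0 by apply: (addrI (M 0)); rewrite -MD !addr0.
elim: k => [|k [IH1 IH2]]; first by rewrite addn0.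
split=> [t lt|]; rewrite iterS /gexp -/(gexp D M) /=.
  rewrite IH1; last by lia.
  by case: t lt => // t lt; rewrite D0 IH1 ?M0 ?addr0 //; lia.
by rewrite addnS IH1 ?D0 ?add0r ?IH2.
Qed.

(** Each derivation either acts on the coefficient or, through G, brings out a factor d phi and
    raises t by one; t = |m| is reached only if every derivation does the latter. *)
Lemma gact_top m :
  (forall t, (mdeg m < t)%N -> gact m (0, t) = 0) /\
  gact m (0, mdeg m) = iter (m ord0) Mx (iter (m ord_max) My u0).
Proof.
have [|top1 e1] := @gexp_iter_top Dy My gone (m ord_max) 0 0 DyD MyD.
  by case=> // t _; rewrite /gone xpair_eqE andbF.
rewrite !add0n in top1 e1.
have [top2 e2] := @gexp_iter_top Dx Mx _ (m ord0) _ 0 DxD MxD top1.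
have -> : mdeg m = (m ord_max + m ord0)%N.
  rewrite mdegE big_ord_recl big_ord1 addnC.
  by rewrite (_ : lift ord0 ord0 = ord_max) //; apply: val_inj.
by rewrite /mon_act e2 e1 /gone eqxx.
Qed.

Definition gpsi (P : lpdo F) (t : nat) : U := mlin (fun m => gact m (0, t)) P.

(** Conjugation by phi alone leaves the first index at 0 ([gact_supp]), so the coefficient at (j, t)
    involves only the operator T_j. *)
Lemma gtwisted (T : lpdo F) g j t :
  twisted_act dx dy (gexp Dx Mx) (gexp Dy My) gshift g T gone (j, t) =
  gpsi (conj_coef dx dy T g j) t.
Proof.
have gs i u q : gshift i u q = u (q.1 - i, q.2) by [].
rewrite (@conj_act F dx dy W (gexp Dx Mx) (gexp Dy My) gshift) //; first last.
- by move=> u; apply: boolp.funext => -[i k]; rewrite gs /= subr0.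
- move=> i k u; apply: boolp.funext => -[r s]; rewrite !gs /=.
  by rewrite opprD addrA [in LHS]addrAC.
- exact: gexpZ.
- exact: gexpZ.
- exact: gexpD.
- exact: gexpD.
rewrite /fam_act sum_funE.
have psi_sum (l : opfam F) :
    gpsi (fam_coef l j) t = \sum_(p <- l) if p.1 == j then gpsi p.2 t else 0.
  rewrite /fam_coef /gpsi linear_sum -big_mkcond; apply: eq_bigr => p _ /=.
  by [].
rewrite /conj_coef psi_sum; apply: eq_bigr => p _.
rewrite -(@tau_act F W (gexp Dx Mx) (gexp Dy My) gshift) // gs /=.
rewrite /act /mlin sum_funE eq_sym; case: eqP => [->|/eqP ne].
  by rewrite subrr.
rewrite big1 // => m _.
transitivity (p.2@_m *: gact m (j - p.1, t)); first by [].
by rewrite gact_supp ?scaler0 // subr_eq0.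
Qed.

End AbstractExpansion.

Lemma iter_mul (R : comNzRingType) (x y h : R) m n :
  iter m (fun a => x * a) (iter n (fun a => y * a) h) = h * (x ^+ m * y ^+ n).
Proof.
elim: m => [|m IH] /=; last by rewrite IH exprS; ring.
rewrite expr0 mul1r; elim: n => [|n IH] /=; first by rewrite mulr1.
by rewrite IH exprS mulrCA.
Qed.

Section ExpandCoefficients.
Variables (F : fieldType) (dx dy : F -> F).
Hypothesis dxP : derivation dx.
Hypothesis dyP : derivation dy.
Implicit Types (P Q T : lpdo F) (g : seq (rat * F)) (m : 'X_{1..2}).

Local Notation dp := (dpoly F 'I_2).
Local Notation conj := (conj_coef dx dy).

Definition psi P t : dp := gpsi (dpoly_der dx up_x) (dpoly_der dy up_y)
  (fun a : dp => dvar ind_phi 1 0 * a) (fun a : dp => dvar ind_phi 0 1 * a)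
  (dvar ind_h 0 0) P t.

Lemma dmulD (b : dp) : {morph (fun a : dp => b * a) : u v / u + v}.
Proof. by move=> u v; apply: mulrDr. Qed.

Lemma dmulZ (b : dp) : forall a u, b * (a *: u) = a *: (b * u).
Proof. by move=> a u; apply/esym/scalerAr. Qed.

(** Each column j of the expansion depends on T_j alone. Its bottom is T_j applied to h ([psi0]),
    and its top the symbol of T_j in grad phi ([psi_top]); the polygon requires no more than these
    two. *)
Lemma expand_coefE T g j t : expand_coef dx dy T g j t = psi (conj T g j) t.
Proof.
apply: (etrans (congr1 (fun w => w (j, t)) (coefs_expand dxP dyP T g))).
exact: (@gtwisted F dp dx dy (dpoly_der dx up_x) (dpoly_der dy up_y)
  (fun a : dp => dvar ind_phi 1 0 * a) (fun a : dp => dvar ind_phi 0 1 * a)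
  (dpoly_derD _ dxP) (dpoly_derD _ dyP) (dpoly_derZ _ dxP)
  (dpoly_derZ _ dyP) (dmulD _) (dmulD _) (dmulZ _) (dmulZ _)).
Qed.

Definition dmon m : dp := dvar ind_h 0 0 * (dvar ind_phi 1 0 ^+ m ord0 *
  dvar ind_phi 0 1 ^+ m ord_max).

Lemma psi0 P : psi P 0 = lin_dpoly ind_h P.
Proof.
have iy k : iter k (dpoly_der dy up_y) (dvar ind_h 0 0) = dvar ind_h 0 k :> dp.
  elim: k => [|k IH]; first exact: erefl.
  exact: (etrans (congr1 (dpoly_der dy up_y) IH) (dpoly_der_var dyP erefl)).
have ix j k : iter k (dpoly_der dx up_x) (dvar ind_h 0 j) = dvar ind_h k j :> dp.
  elim: k => [|k IH]; first exact: erefl.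
  exact: (etrans (congr1 (dpoly_der dx up_x) IH) (dpoly_der_var dxP erefl)).
apply: eq_bigr => m _; apply: (congr1 (GRing.scale P@_m)).
apply: (etrans (gact0 _ _ _ _ _ _)).
exact: (etrans (congr1 (iter (m ord0) (dpoly_der dx up_x)) (iy (m ord_max)))
  (ix (m ord_max) (m ord0))).
Qed.

Lemma psi_top P t : (msize P <= t.+1)%N ->
  psi P t = \sum_(m <- msupp P | mdeg m == t) P@_m *: dmon m.
Proof.
move=> sP; rewrite big_mkcond; apply: eq_big_seq => m mP.
have [top e] := @gact_top F dp (dpoly_der dx up_x) (dpoly_der dy up_y)
  (fun a : dp => dvar ind_phi 1 0 * a) (fun a : dp => dvar ind_phi 0 1 * a)
  (dpoly_derD _ dxP) (dpoly_derD _ dyP) (dmulD _) (dmulD _) (dvar ind_h 0 0) m.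
have [et|ne] := eqVneq (mdeg m) t.
  rewrite -et; apply: (congr1 (GRing.scale P@_m)); apply: (etrans e).
  exact: iter_mul.
have lt : (mdeg m < t)%N.
  by rewrite ltn_neqAle ne -ltnS (leq_trans (msize_mdeg_lt mP)).
apply: (etrans (congr1 _ (top t lt))); exact: scaler0.
Qed.

End ExpandCoefficients.

Lemma mul_scale_alg (R : comNzRingType) (A : comAlgType R) (a : R) (h x : A) :
  h * (a%:A * x) = a *: (h * x).
Proof. by rewrite mulrCA -scalerAl mul1r. Qed.

Section GradientMonomials.
Variable F : fieldType.
Local Notation dp := (dpoly F 'I_2).
Local Notation var := ('I_2 * (nat * nat))%type.
Implicit Types (P Q : {mpoly F[2]}) (m : 'X_{1..2}).

Definition bimon (i j : nat) : {mpoly F[2]} := 'X_ord0 ^+ i * 'X_ord_max ^+ j.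

Lemma bimonE m : bimon (m ord0) (m ord_max) = 'X_[m].
Proof.
rewrite mpolyXE_id big_ord_recl big_ord1.
by rewrite (_ : lift ord0 ord0 = ord_max) //; apply: val_inj.
Qed.

(* Setting h to 1 and the derivatives of phi to X and Y, resp. sending the
   derivatives of h to monomials. *)
Definition val_phi (v : var) : {mpoly F[2]} :=
  if v.1 == ind_phi then bimon v.2.1 v.2.2 else 1.
Definition val_h (v : var) : {mpoly F[2]} := bimon v.2.1 v.2.2.

Definition specialize (val : var -> {mpoly F[2]}) : dp -> {mpoly F[2]} :=
  monalg.mmap (@mpolyC 2 F) (monom_eval val).

HB.instance Definition _ val := GRing.RMorphism.on (specialize val).

Lemma specialize_var val u i j : specialize val (dvar u i j) = val (u, (i, j)).
Proof.
rewrite /specialize /dvar monalg.mmapU /= mpolyC1 mul1r.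
exact: monom_eval_ucm.
Qed.

Lemma specializeZ val c (p : dp) :
  specialize val (c *: p) = c *: specialize val p.
Proof. by apply: (etrans (monalg.mmapZ _ _)); rewrite mul_mpolyC. Qed.

Lemma specializeM val (p q : dp) :
  specialize val (p * q) = specialize val p * specialize val q.
Proof. exact: rmorphM. Qed.

Lemma specializeX val (p : dp) k : specialize val (p ^+ k) = specialize val p ^+ k.
Proof. exact: rmorphXn. Qed.

Lemma specialize_dmon m : specialize val_phi (dmon F m) = 'X_[m].
Proof.
have X i j k : specialize val_phi (dvar ind_phi i j ^+ k) = bimon i j ^+ k.
  exact: etrans (specializeX _ _ _) (congr1 (fun z => z ^+ k) (specialize_var _ _ _ _)).
apply: (etrans (specializeM _ _ _)).
apply: (etrans (congr2 *%R (specialize_var _ _ _ _) (specializeM _ _ _))).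
apply: (etrans (congr2 (fun y z => _ * (y * z)) (X _ _ _) (X _ _ _))).
rewrite /val_phi /= mul1r.
rewrite /bimon !expr0 !expr1 mulr1 mul1r; exact: bimonE.
Qed.

Lemma specialize_sum val (s : seq 'X_{1..2}) (B : pred 'X_{1..2}) (c : 'X_{1..2} -> F)
    (b : 'X_{1..2} -> dp) :
  specialize val (\sum_(m <- s | B m) c m *: b m) =
  \sum_(m <- s | B m) c m *: specialize val (b m).
Proof.
apply: (etrans (rmorph_sum _ _ _ _)); apply: eq_bigr => m _.
exact: specializeZ.
Qed.

Lemma specialize_lin P : specialize val_h (lin_dpoly ind_h P) = P.
Proof.
apply: (etrans (specialize_sum _ _ _ _ _)); rewrite [RHS]mpolyE.
apply: eq_bigr => m _; apply: (congr1 (GRing.scale _)).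
by apply: (etrans (specialize_var _ _ _ _)); rewrite /val_h /= bimonE.
Qed.

Lemma h_gradE Q : dvar ind_h 0 0 * grad_dpoly ind_phi Q =
  \sum_(m <- msupp Q) Q@_m *: dmon F m.
Proof.
rewrite /grad_dpoly /mmap mulr_sumr; apply: eq_bigr => m _.
rewrite /mmap1 big_ord_recl big_ord1 (_ : lift ord0 ord0 = ord_max);
  last exact: val_inj.
exact: (@mul_scale_alg F dp).
Qed.

Lemma h_grad_inj Q Q' :
  dvar ind_h 0 0 * grad_dpoly ind_phi Q = dvar ind_h 0 0 * grad_dpoly ind_phi Q' ->
  Q = Q'.
Proof.
have E P : specialize val_phi (dvar ind_h 0 0 * grad_dpoly ind_phi P) = P.
  rewrite h_gradE; apply: (etrans (specialize_sum _ _ _ _ _)).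
  rewrite [RHS]mpolyE; apply: eq_bigr => m _.
  exact: (congr1 (GRing.scale _) (specialize_dmon m)).
move=> h.
exact: etrans (esym (E Q)) (etrans (congr1 (specialize val_phi) h) (E Q')).
Qed.

End GradientMonomials.

Section Psi.
Variables (F : fieldType) (dx dy : F -> F).
Hypothesis dxP : derivation dx.
Hypothesis dyP : derivation dy.
Implicit Types (P : lpdo F).

Lemma psi_neq0 P t : psi dx dy P t != 0 -> P != 0 /\ (t <= topdeg P)%N.
Proof.
move=> pt; case: (leqP t (topdeg P)) => [le|lt].
  split=> //; apply: contraNneq pt => ->.
  by rewrite /psi /gpsi linear0.
case/eqP: pt; rewrite (psi_top dxP dyP); last first.
  by apply: (leq_trans (leqSpred _)); rewrite ltnS ltnW.
rewrite big1_seq // => m /andP[/eqP mt mP].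
by have := mdeg_topdeg mP; rewrite mt leqNgt lt.
Qed.

Lemma psi0_neq0 P : P != 0 -> psi dx dy P 0 != 0.
Proof.
apply: contraNneq => p0; apply/eqP; rewrite -(specialize_lin P) -(psi0 dxP dyP) p0.
exact: (rmorph0 (specialize _)).
Qed.

Lemma psi_top_neq0 P : P != 0 -> psi dx dy P (topdeg P) != 0.
Proof.
move=> P0; have [m mP mt] := topdeg_mem P0.
apply: contraTneq mP; rewrite (psi_top dxP dyP (leqSpred _)).
move/(congr1 (specialize (@val_phi F))) => h.
have e : \sum_(k <- msupp P | mdeg k == (msize P).-1) P@_k *: 'X_[k] = 0.
  apply: (etrans _ (etrans h (rmorph0 (specialize (@val_phi F))))).
  apply: (etrans _ (esym (specialize_sum _ _ _ _ _))); apply: eq_bigr => k _.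
  exact: (congr1 (GRing.scale _) (esym (specialize_dmon F k))).
rewrite mcoeff_msupp negbK -(mcoeff0 _ m) -e raddf_sum big_mkcond /=.
have [mP|mP] := boolP (m \in msupp P); last first.
  rewrite (memN_msupp_eq0 mP) big1_seq // => k /= kP; case: ifP => // _.
  by rewrite mcoeffZ mcoeffX; case: eqP kP mP => [->->//|]; rewrite mulr0.
rewrite (bigD1_seq m) ?msupp_uniq //= -/(topdeg P) mt eqxx.
rewrite mcoeffZ mcoeffX eqxx mulr1 big1 ?addr0 // => k km; case: ifP => // _.
by rewrite mcoeffZ mcoeffX (negPf km) mulr0.
Qed.

End Psi.

(** * Convex hulls of finite sets of points *)

Section ConvexHull.
Variable s : seq (rat * rat).

Lemma hull_mem u : u \in s -> convex_hull s u.
Proof.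
(* The list may repeat [u]: the weight 1 is shared among its occurrences. *)
move=> us; pose c : rat := (count_mem u s)%:R.
have c0 : c != 0 by rewrite pnatr_eq0 -lt0n -has_count has_pred1.
have sumw (f : rat * rat -> rat) :
    \sum_(v <- s) (if v == u then c^-1 else 0) * f v = f u.
  transitivity (\sum_(v <- s | v == u) c^-1 * f u).
    rewrite [RHS]big_mkcond; apply: eq_bigr => v _.
    by case: eqP => [->|]; rewrite ?mul0r.
  by rewrite big_const_seq iter_addr_0 -mulr_natr -/c mulrAC mulVf ?mul1r.
exists (fun v => if v == u then c^-1 else 0); split.
- by move=> v _; case: ifP; rewrite // invr_ge0 ler0n.
- have := sumw (fun=> 1); under eq_bigr do rewrite mulr1.
  by [].
by rewrite !sumw -surjective_pairing.
Qed.

Lemma hull_le c c' M p : (forall u, u \in s -> c' * u.1 + c * u.2 <= M) ->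
  convex_hull s p -> c' * p.1 + c * p.2 <= M.
Proof.
move=> sM [w [w0 w1 ->]] /=; rewrite !mulr_sumr -big_split /=.
rewrite -[M]mul1r -w1 mulr_suml big_seq [leRHS]big_seq.
apply: ler_sum => u us.
by rewrite mulrCA [c * _]mulrCA -mulrDr ler_wpM2l ?sM ?w0.
Qed.

(** The weighted distances of the points to the supporting line are non-negative with sum 0, so the
    weight of every point off the line is 0. *)
Lemma hull_face c M p : (forall u, u \in s -> u.1 + c * u.2 <= M) ->
  convex_hull s p -> p.1 + c * p.2 = M ->
  forall u0, (forall u, u \in s -> u.1 + c * u.2 = M -> u = u0) -> p = u0.
Proof.
move=> sM [w [w0 w1 ->]] /= eM u0 hu0.
have tight u : u \in s -> w u = 0 \/ u = u0.
  move=> us; pose gap v := w v * (M - (v.1 + c * v.2)).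
  have gap0 v : v \in s -> 0 <= gap v.
    by move=> vs; rewrite mulr_ge0 ?w0 // subr_ge0 sM.
  have sum_gap : \sum_(v <- s) gap v = 0.
    have -> : \sum_(v <- s) gap v = M * \sum_(v <- s) w v -
       (\sum_(v <- s) w v * v.1 + c * \sum_(v <- s) w v * v.2).
      rewrite !mulr_sumr -big_split -sumrB; apply: eq_bigr => v _ /=.
      by rewrite /gap; ring.
    by rewrite w1 eM mulr1 subrr.
  have gu : gap u = 0.
    apply/eqP; have : \sum_(v <- s) gap v == 0 by rewrite sum_gap.
    rewrite big_seq psumr_eq0 // => /allP/(_ u us).
    by rewrite us.
  move/eqP: gu; rewrite mulf_eq0 subr_eq0 => /orP[/eqP|/eqP e]; first by left.
  by right; apply: hu0.
have sumE (f : rat * rat -> rat) : \sum_(u <- s) w u * f u = f u0.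
  rewrite -[RHS]mul1r -w1 mulr_suml; apply: eq_big_seq => u /tight[->|->] //.
  by rewrite !mul0r.
by rewrite !sumE -surjective_pairing.
Qed.

End ConvexHull.

(** * The polygon *)

Section Polygon.
Variables (F : fieldType) (dx dy : F -> F).
Hypothesis dxP : derivation dx.
Hypothesis dyP : derivation dy.
Variables (T : lpdo F) (g : seq (rat * F)).
Hypothesis g_pos : forall x, x \in g -> 0 < x.1.

Local Notation C := (conj_coef dx dy T g).
Local Notation wt c m := (c * (mdeg m)%:R).
Local Notation pts := ((0 : rat, 0 : rat) :: [seq (p.1, p.2%:R : rat) |
   p <- monalg.msupp (expand dx dy T g)]).
Implicit Types (k m : 'X_{1..2}) (j c M : rat).

Lemma conj_ge0 j : C j != 0 -> 0 <= j.
Proof.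
move/conj_keys; apply: (keys_in (S := fun i => 0 <= i)) => //.
  by move=> i i' hi hi'; rewrite addr_ge0.
by move=> x /g_pos/ltW.
Qed.

Lemma mem_expand j t :
  ((j, t) \in (monalg.msupp (expand dx dy T g) : seq _)) =
  (psi dx dy (C j) t != 0).
Proof.
change (((j, t) \in monalg.msupp (expand dx dy T g)) = (psi dx dy (C j) t != 0)).
by rewrite -monalg.mcoeff_neq0 -(expand_coefE dxP dyP). Qed.

Lemma ptsP u : u \in pts -> u = (0, 0) \/
  exists j t, [/\ u = (j, t%:R), C j != 0 & (t <= topdeg (C j))%N].
Proof.
rewrite inE => /orP[/eqP->|/mapP[[j t] jt ->]]; [by left|right].
have : psi dx dy (C j) t != 0 by rewrite -mem_expand; exact: jt.
move=> /(psi_neq0 dxP dyP)[Cj lt]; by exists j, t.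
Qed.

Lemma pts_mem0 j : C j != 0 -> (j, 0) \in pts.
Proof.
move=> Cj; rewrite inE; apply/orP; right; apply/mapP; exists (j, 0%N) => //.
have : psi dx dy (C j) 0 != 0 by apply: psi0_neq0.
by rewrite -mem_expand.
Qed.

Lemma pts_mem_top j : C j != 0 -> (j, (topdeg (C j))%:R) \in pts.
Proof.
move=> Cj; rewrite inE; apply/orP; right; apply/mapP.
exists (j, topdeg (C j)) => //.
have : psi dx dy (C j) (topdeg (C j)) != 0 by apply: psi_top_neq0.
by rewrite -mem_expand.
Qed.

Lemma coef_neq0 j k : (C j)@_k != 0 -> C j != 0.
Proof. by apply: contraNneq => ->; rewrite mcoeff0. Qed.

Lemma pts_below c M : 0 < c -> 0 <= M -> below c M C ->
  forall u, u \in pts -> u.1 + c * u.2 <= M.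
Proof.
move=> c0 M0 bC u /ptsP[->|[j [t [-> Cj lt]]]] /=; first by rewrite mulr0 addr0.
have [k kC ek] := topdeg_mem Cj.
have : j + wt c k <= M by apply: bC; rewrite -mcoeff_msupp.
apply: le_trans; rewrite lerD2l ler_pM2l // ler_nat ek.
exact: lt.
Qed.

Lemma below_ge0 c M j k : 0 < c -> below c M C -> (C j)@_k != 0 -> 0 <= M.
Proof.
move=> c0 bC Cjk; apply: le_trans (bC _ _ Cjk).
by rewrite addr_ge0 ?(conj_ge0 (coef_neq0 Cjk)) // mulr_ge0 ?ler0n ?ltW.
Qed.

Lemma face_topdeg c M j k : 0 < c -> below c M C -> (C j)@_k != 0 ->
  j + wt c k = M -> mdeg k = topdeg (C j).
Proof.
move=> c0 bC Cjk ek; apply/eqP; rewrite eqn_leq mdeg_topdeg ?mcoeff_msupp //.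
have [k' k'C ek'] := topdeg_mem (coef_neq0 Cjk).
have : j + wt c k' <= M by apply: bC; rewrite -mcoeff_msupp.
by rewrite -ek lerD2l ler_pM2l // ler_nat ek'.
Qed.

Lemma leading_mem c M Q k : leading_form c M C Q -> k \in msupp Q ->
  (C (M - wt c k))@_k != 0.
Proof. by move=> lQ; rewrite mcoeff_msupp lQ. Qed.

Lemma edge_line_intro c M Q k k' : 0 < c -> below c M C -> leading_form c M C Q ->
  k \in msupp Q -> k' \in msupp Q -> mdeg k != mdeg k' ->
  edge_line (polygon dx dy T g) c M.
Proof.
move=> c0 bC lQ kQ k'Q ne.
have [Ck Ck'] := (leading_mem lQ kQ, leading_mem lQ k'Q).
have hb := pts_below c0 (below_ge0 c0 bC Ck) bC.
have mem m : (C (M - wt c m))@_m != 0 ->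
    convex_hull pts (M - wt c m, (mdeg m)%:R).
  move=> Cm; apply: hull_mem; have := pts_mem_top (coef_neq0 Cm).
  by rewrite -(face_topdeg c0 bC Cm) ?subrK.
split.
  left=> p hp; rewrite -[p.1]mul1r; apply: hull_le hp => u us.
  by rewrite mul1r hb.
exists (M - wt c k, (mdeg k)%:R), (M - wt c k', (mdeg k')%:R); split=> //=.
- exact: mem.
- exact: mem.
- by move=> [_ /eqP]; rewrite eqr_nat (negPf ne).
- by rewrite subrK.
by rewrite subrK.
Qed.

(** An edge requires two distinct points of the list on the line, by [hull_face]. The origin, which
    belongs to the polygon by convention, must be excluded; the other points on a line of positive
    slope are tops of their columns. *)
Lemma edge_line_elim c M j0 : 0 < c -> C j0 != 0 ->
  edge_line (polygon dx dy T g) c M ->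
  below c M C /\ exists k k', [/\ (C (M - wt c k))@_k != 0,
    (C (M - wt c k'))@_k' != 0 & mdeg k != mdeg k'].
Proof.
move=> c0 Cj0 [side [p [p' [hp hp' npp' ep ep']]]].
have ge0 u : convex_hull pts u -> 0 <= u.1 /\ 0 <= u.2.
  move=> hu; split; rewrite -oppr_le0.
    have := @hull_le pts 0 (-1) 0 u _ hu; rewrite mulN1r mul0r addr0; apply.
    move=> w /ptsP[->|[j [t [-> Cj _]]]] /=; rewrite mulN1r mul0r addr0 oppr_le0 //.
    exact: conj_ge0.
  have := @hull_le pts (-1) 0 0 u _ hu; rewrite mulN1r mul0r add0r; apply.
  by move=> w /ptsP[->|[j [t [-> Cj _]]]] /=; rewrite mulN1r mul0r add0r oppr_le0.
(* The polygon lies in the first quadrant and contains the origin, so a line of positive slope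
   supporting it from below meets it in the origin at most. *)
case: side => side; last first.
  have M0 : M <= 0.
    by have := side (0, 0) (hull_mem (mem_head _ _)); rewrite /= mulr0 addr0.
  have zero u : convex_hull pts u -> u.1 + c * u.2 = M -> u = (0, 0).
    move=> /ge0[u1 u2] eu; have cu2 : 0 <= c * u.2 by rewrite mulr_ge0 // ltW.
    have e1 : u.1 = 0 by lra.
    have /eqP : c * u.2 = 0 by lra.
    rewrite mulf_eq0 gt_eqF //= => /eqP e2.
    by rewrite [u]surjective_pairing e1 e2.
  by case: npp'; rewrite (zero p) // (zero p').
have bC : below c M C.
  move=> j k Cjk; have := side _ (hull_mem (pts_mem_top (coef_neq0 Cjk))).
  apply: le_trans; rewrite /= lerD2l ler_pM2l // ler_nat.
  by rewrite mdeg_topdeg // mcoeff_msupp.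
split=> //.
have [k00 k00C] : exists k, (C j0)@_k != 0.
  by exists (mlead (C j0)); rewrite mleadc_eq0.
have hb := pts_below c0 (below_ge0 c0 bC k00C) bC.
have [u [u' [us u's nu eu eu']]] : exists u u', [/\ u \in pts, u' \in pts, u <> u',
    u.1 + c * u.2 = M & u'.1 + c * u'.2 = M].
  apply: boolp.contrapT => h; apply: npp'.
  have [u0 u0s eu0] : exists2 u, u \in pts & u.1 + c * u.2 = M.
    apply: boolp.contrapT => nu.
    have all u0 : p = u0.
      by apply: (hull_face hb hp ep) => u us eu; case: nu; exists u.
    by have := etrans (esym (all (0, 0))) (all (1, 0)).
  have uniq u : u \in pts -> u.1 + c * u.2 = M -> u = u0.
    move=> us eu; apply: boolp.contrapT => ne; apply: h.
    by exists u, u0.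
  by rewrite (hull_face hb hp ep uniq) (hull_face hb hp' ep' uniq).
have face w : w \in pts -> w.1 + c * w.2 = M ->
    w = (0, 0) \/ exists j k, [/\ w = (j, (mdeg k)%:R), (C j)@_k != 0
                                & j = M - wt c k].
  move=> /ptsP[->|[j [t [-> Cj lt]]]] /=; [by left|move=> ew; right].
  have [k kC ek] := topdeg_mem Cj.
  have bk : j + wt c k <= M by apply: bC; rewrite -mcoeff_msupp.
  have tk : t = mdeg k.
    apply/eqP; rewrite eqn_leq ek lt /= -ek -(ler_nat rat).
    by rewrite -(ler_pM2l c0); lra.
  exists j, k; rewrite -tk -mcoeff_msupp; split=> //.
  by rewrite -ew tk addrK.
have face0 w : w \in pts -> w.1 + c * w.2 = M -> M = 0 -> w = (0, 0).
  move=> ws ew M0; have [w1 w2] := ge0 _ (hull_mem ws).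
  have cw2 : 0 <= c * w.2 by rewrite mulr_ge0 // ltW.
  have e1 : w.1 = 0 by lra.
  have /eqP : c * w.2 = 0 by lra.
  rewrite mulf_eq0 gt_eqF //= => /eqP e2.
  by rewrite [w]surjective_pairing e1 e2.
(* On the line M = 0 the only point of the quadrant is the origin; hence M != 0, and the origin is
   not on the line. *)
have M0 : M <> 0.
  by move=> M0; apply: nu; rewrite (face0 u) // (face0 u').
have n0 : (0 : rat) + c * 0 <> M by rewrite mulr0 addr0 => /esym.
case: (face u us eu) => [e|[j [k [eu1 Ck ej]]]]; first by case: n0; rewrite -eu e.
case: (face u' u's eu') => [e|[j' [k' [eu1' Ck' ej']]]].
  by case: n0; rewrite -eu' e.
exists k, k'; rewrite -ej -ej'; split=> //.
by apply: contra_not_neq nu => e; rewrite eu1 eu1' ej ej' e.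
Qed.

Lemma leading_form_exists c M : exists Q, leading_form c M C Q.
Proof.
exists (\sum_(j <- keys dx dy T g) \sum_(m <- msupp (C j) | j + wt c m == M)
  (C j)@_m *: 'X_[m]) => k.
rewrite raddf_sum /=.
have inner j : (\sum_(m <- msupp (C j) | j + wt c m == M)
    (C j)@_m *: 'X_[m])@_k = if j == M - wt c k then (C j)@_k else 0.
  rewrite raddf_sum big_mkcond /= eq_sym subr_eq eq_sym.
  have [kC|kC] := boolP (k \in msupp (C j)); last first.
    rewrite (memN_msupp_eq0 kC) if_same big1_seq // => m /= mC.
    rewrite mcoeffZ mcoeffX; case: (m =P k) mC kC => [->->//|_ _ _].
    by rewrite mulr0 if_same.
  rewrite (bigD1_seq k) ?msupp_uniq //= mcoeffZ mcoeffX eqxx mulr1 big1 ?addr0 //.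
  by move=> m /negPf mk; rewrite mcoeffZ mcoeffX mk mulr0 if_same.
under eq_bigr do rewrite inner.
have [Cj|Cj] := boolP (C (M - wt c k) == 0).
  rewrite (eqP Cj) mcoeff0 big1 // => j _; case: eqP => // ->.
  by rewrite (eqP Cj) mcoeff0.
rewrite (bigD1_seq (M - wt c k)) ?undup_uniq ?conj_keys //= eqxx.
by rewrite big1 ?addr0 // => j /negPf ->.
Qed.

(** A point of the expansion on a supporting line of positive slope is the top of its column, so
    that [psi_top] gives its coefficient. *)
Lemma edge_sum c M Q : 0 < c -> below c M C -> leading_form c M C Q ->
  \sum_(p <- monalg.msupp (expand dx dy T g) | p.1 + c * p.2%:R == M)
     expand_coef dx dy T g p.1 p.2 = \sum_(m <- msupp Q) Q@_m *: dmon F m.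
Proof.
move=> c0 bC lQ.
transitivity (\sum_(p <- monalg.msupp (expand dx dy T g) |
     p.1 + c * p.2%:R == M) \sum_(m <- msupp Q | mdeg m == p.2) Q@_m *: dmon F m).
  rewrite big_seq_cond [RHS]big_seq_cond; apply: eq_bigr => -[j t] /=.
  move=> /andP[jt /eqP ej].
  have pt : psi dx dy (C j) t != 0 by rewrite -mem_expand; exact: jt.
  have [Cj lt] := psi_neq0 dxP dyP pt.
  have [k kC ek] := topdeg_mem Cj.
  have bk : j + wt c k <= M by apply: bC; rewrite -mcoeff_msupp.
  have tk : t = topdeg (C j).
    apply/eqP; rewrite eqn_leq lt /= -ek -(ler_nat rat).
    by rewrite -(ler_pM2l c0); lra.
  apply: (etrans (expand_coefE dxP dyP T g j t)).
  apply: (etrans (psi_top dxP dyP _)); first by rewrite tk; apply: leqSpred.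
  have coefE m : mdeg m = t -> Q@_m = (C j)@_m.
    by move=> em; rewrite lQ em -ej addrK.
  transitivity (\sum_(m <- msupp Q | mdeg m == t) (C j)@_m *: dmon F m).
    rewrite -big_filter -[RHS]big_filter; apply: perm_big.
    apply: uniq_perm; rewrite ?filter_uniq ?msupp_uniq // => m.
    rewrite !mem_filter; case: eqP => //= em.
    by rewrite !mcoeff_msupp coefE.
  by apply: eq_bigr => m /eqP em; rewrite (coefE m em).
under eq_bigr do rewrite big_mkcond /=.
rewrite exchange_big /=; apply: eq_big_seq => m mQ.
have Cm := leading_mem lQ mQ.
have mem : (M - wt c m, mdeg m) \in monalg.msupp (expand dx dy T g).
  have : psi dx dy (C (M - wt c m)) (mdeg m) != 0.
    have := psi_top_neq0 dxP dyP (coef_neq0 Cm).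
    by rewrite -(face_topdeg c0 bC Cm) ?subrK.
  by rewrite -mem_expand.
rewrite big_mkcond /= (bigD1_seq (M - wt c m, mdeg m)) ?fset_uniq //=.
rewrite subrK !eqxx big1 ?addr0 // => -[j t] /= ne.
case: eqP => // ej; case: eqP => // et; case/eqP: ne.
by rewrite -ej -et addrK.
Qed.

Lemma edge_poly_leading c M Q j0 : 0 < c -> C j0 != 0 ->
  edge_poly dx dy T g c M Q -> [/\ below c M C, leading_form c M C Q &
    exists k k', [/\ k \in msupp Q, k' \in msupp Q & mdeg k != mdeg k']].
Proof.
move=> c0 Cj0 [/(edge_line_elim c0 Cj0)[bC [k [k' [Ck Ck' ne]]]] eQ].
have [Q' lQ'] := leading_form_exists c M.
have QQ' : Q = Q'.
  apply: h_grad_inj; apply: (etrans (esym eQ)).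
  exact: (etrans (edge_sum c0 bC lQ') (esym (h_gradE Q'))).
rewrite QQ'; split=> //; exists k, k'.
by rewrite !mcoeff_msupp !lQ'.
Qed.

Lemma edge_poly_intro c M Q k k' : 0 < c -> below c M C -> leading_form c M C Q ->
  k \in msupp Q -> k' \in msupp Q -> mdeg k != mdeg k' ->
  edge_poly dx dy T g c M Q.
Proof.
move=> c0 bC lQ kQ k'Q ne; split; first exact: edge_line_intro ne.
exact: (etrans (edge_sum c0 bC lQ) (esym (h_gradE Q))).
Qed.

Lemma right_edge_top j r : (forall i, C i != 0 -> i <= j) -> 0 <= j ->
  convex_hull pts (j, r) -> r <= (topdeg (C j))%:R.
Proof.
move=> maxC j0 [w [w0 w1 [ej ->]]]; set d := topdeg (C j).
have -> : d%:R = \sum_(u <- pts) w u * d%:R by rewrite -mulr_suml w1 mul1r.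
have hb u : u \in pts -> u.1 <= j.
  by move=> /ptsP[->|[i [s [-> Ci _]]]] //=; apply: maxC.
rewrite big_seq [leRHS]big_seq; apply: ler_sum => u us.
have gap v : v \in pts -> 0 <= w v * (j - v.1).
  by move=> vs; rewrite mulr_ge0 ?w0 // subr_ge0 hb.
have /eqP gu : w u * (j - u.1) == 0.
  have : \sum_(v <- pts) w v * (j - v.1) == 0.
    under eq_bigr do rewrite mulrBr.
    by rewrite sumrB -mulr_suml w1 mul1r -ej subrr.
  rewrite big_seq psumr_eq0; last exact: gap.
  by move=> /allP/(_ u us); rewrite us.
have [->|wu] := eqVneq (w u) 0; first by rewrite !mul0r.
move/eqP: gu; rewrite mulf_eq0 (negPf wu) /= subr_eq0 => /eqP ju.
rewrite ler_wpM2l ?w0 //; case: (ptsP us) => [->|[i [s [eu Ci le]]]].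
  exact: ler0n.
by move: ju; rewrite eu /d /= => ->; rewrite ler_nat.
Qed.

Lemma right_edge_elim j t j0 : C j0 != 0 ->
  right_vertical_edge (polygon dx dy T g) j t ->
  [/\ C j != 0, forall i, C i != 0 -> i <= j, t = topdeg (C j) & (0 < t)%N].
Proof.
move=> Cj0 [[_ [p [p' [hp hp' npp' ep ep']]]] maxj [Pt maxt] [P0 min0]].
have max_i i : C i != 0 -> i <= j.
  by move=> Ci; apply: (maxj (i, 0)); apply/hull_mem/pts_mem0.
have hb u : u \in pts -> u.1 + 0 * u.2 <= j.
  by move=> us; rewrite mul0r addr0; apply/maxj/hull_mem.
have jge0 : 0 <= j by apply: (maxj (0, 0)); apply/hull_mem/mem_head.
(* Otherwise only the added point (0, 0) could lie in the last column; then j = 0, and by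
   non-negativity and maximality this is also the column of [j0]. *)
have Cj : C j != 0.
  apply: contraT => /negPn/eqP Cj.
  have all (u0 : rat * rat) : j <> 0 -> (j, t%:R) = u0.
    move=> j0'; have e : (j, t%:R : rat).1 + 0 * (j, t%:R : rat).2 = j.
      by rewrite /= mul0r addr0.
    apply: (hull_face hb Pt e).
    move=> u /ptsP[->|[i [r [-> Ci _]]]] /=; rewrite mul0r addr0 => ei.
      by case: j0'.
    by rewrite ei Cj eqxx in Ci.
  have j00 : j <> 0.
    move=> e; have := max_i _ Cj0; rewrite e => le0.
    have e0 : j0 = 0 by apply/eqP; rewrite eq_le le0 conj_ge0.
    by move: Cj0; rewrite e0 -e Cj eqxx.
  have := etrans (esym (all (0, 0) j00)) (all (1, 0) j00).
  by move=> /eqP; rewrite xpair_eqE.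
have et : t = topdeg (C j).
  apply/eqP; rewrite eqn_leq -!(ler_nat rat) right_edge_top //.
  by apply: maxt; apply/hull_mem/pts_mem_top.
split=> //; rewrite lt0n; apply/eqP => t0; apply: npp'.
have on u : convex_hull pts u -> u.1 + 0 * u.2 = j -> u = (j, 0).
  rewrite mul0r addr0 => hu eu; rewrite [u]surjective_pairing eu; congr (_, _).
  have hj : convex_hull pts (j, u.2) by rewrite -eu -surjective_pairing.
  by apply/eqP; rewrite eq_le min0 // andbT; have := maxt _ hj; rewrite t0.
by rewrite (on p) // (on p').
Qed.

Lemma right_edge_intro j : C j != 0 -> (forall i, C i != 0 -> i <= j) ->
  (0 < topdeg (C j))%N ->
  right_vertical_edge (polygon dx dy T g) j (topdeg (C j)).
Proof.
move=> Cj maxC tj.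
have j0 : 0 <= j by apply: conj_ge0.
have hb u : u \in pts -> 1 * u.1 + 0 * u.2 <= j.
  by move=> /ptsP[->|[i [r [-> Ci _]]]] /=; rewrite mul1r mul0r addr0 // maxC.
have maxj p : polygon dx dy T g p -> p.1 <= j.
  by move=> /(hull_le hb); rewrite mul1r mul0r addr0.
have P0 : polygon dx dy T g (j, 0) by apply/hull_mem/pts_mem0.
have Pt : polygon dx dy T g (j, (topdeg (C j))%:R) by apply/hull_mem/pts_mem_top.
have ge0 u : polygon dx dy T g u -> 0 <= u.2.
  move=> hu; rewrite -oppr_le0.
  have := @hull_le pts (-1) 0 0 u _ hu; rewrite mulN1r mul0r add0r; apply.
  by move=> w /ptsP[->|[i [s [-> Ci _]]]] /=; rewrite mulN1r mul0r add0r oppr_le0.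
split=> //.
- split; first by left=> p /maxj; rewrite mul0r addr0.
  exists (j, (topdeg (C j))%:R), (j, 0); split=> //=; rewrite ?mul0r ?addr0 //.
  by case=> /eqP; rewrite pnatr_eq0 -leqn0 leqNgt tj.
- by split=> // r hr; apply: right_edge_top.
by split=> // r /ge0.
Qed.

(* The line is rotated about its point of lowest degree until it meets the
   rest of the support. *)
Lemma next_edge c M (dg : nat) k J : 0 < c -> below c M C ->
  mdeg k = dg -> (0 < dg)%N -> (C (M - wt c k))@_k != 0 ->
  (forall k', (C (M - wt c k'))@_k' != 0 -> (dg <= mdeg k')%N) ->
  C J != 0 -> (forall i, C i != 0 -> i <= J) -> topdeg (C J) = 0%N ->
  exists c' M' Q k0, [/\ 0 < c' < c, below c' M' C, leading_form c' M' C Q &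
     [/\ k \in msupp Q, k0 \in msupp Q & mdeg k0 != mdeg k]].
Proof.
move=> c0 bC km m0 Ck low CJ maxJ tJ; set j0 := M - wt c k in Ck.
pose s := [seq (j, k') | j <- keys dx dy T g,
  k' <- [seq k' <- msupp (C j) | mdeg k' < dg]%N].
have memS j k' : ((j, k') \in s) = ((C j)@_k' != 0) && (mdeg k' < dg)%N.
  apply/allpairsPdep/andP => [[j1 [k1 [_ + [-> ->]]]]|[Cj lt]].
    by rewrite mem_filter mcoeff_msupp => /andP[].
  exists j, k'; rewrite mem_filter mcoeff_msupp Cj lt; split=> //.
  exact/conj_keys/(coef_neq0 Cj).
have [kJ kJC ekJ] := topdeg_mem CJ.
have Js : (J, kJ) \in s by rewrite memS ekJ tJ m0 andbT -mcoeff_msupp.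
(* The slope for which the line through the pivot (j0, dg) passes through u; the new slope is the
   greatest one among the points of degree less than [dg]. *)
pose sl (u : rat * 'X_{1..2}) : rat := (u.1 - j0) / (dg%:R - (mdeg u.2)%:R).
have [[j1 k1] ]:= seq_argmax sl Js.
rewrite memS => /andP[C1 k1m] slmax.
have slmax' j k' : (C j)@_k' != 0 -> (mdeg k' < dg)%N -> sl (j, k') <= sl (j1, k1).
  by move=> Cj lt; apply: slmax; rewrite memS Cj.
have gap (a : nat) : (a < dg)%N -> 0 < (dg%:R - a%:R : rat).
  by move=> am; rewrite subr_gt0 ltr_nat.
set c' := sl (j1, k1).
have ej1 : j1 = j0 + c' * dg%:R - wt c' k1.
  have := gap _ k1m; rewrite /c' /sl /=; move: (mdeg k1)%:R => a a0.
  by field; rewrite gt_eqF.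
(* By [low], no point of degree less than [dg] lies on the old line. *)
have ltc : c' < c.
  rewrite /c' /sl ltr_pdivrMr ?gap //= /j0.
  have le1 := bC _ _ C1.
  suff : j1 + wt c k1 != M by move=> ne; rewrite -km; move: ne; rewrite neq_lt; lra.
  apply: contraTneq k1m => e; rewrite -leqNgt; apply: low.
  by rewrite -e addrK.
(* The column J is not that of the pivot, because T_J has order 0 while the pivot has degree dg >
   0. *)
have c'0 : 0 < c'.
  suff lt : j0 < J.
    have CJk : (C J)@_kJ != 0 by rewrite -mcoeff_msupp.
    have lt0 : (mdeg kJ < dg)%N by rewrite ekJ tJ.
    apply: lt_le_trans (slmax' J kJ CJk lt0).
    by rewrite /sl /= ekJ tJ subr0 divr_gt0 ?subr_gt0 ?ltr0n.
  rewrite lt_neqAle maxJ ?(coef_neq0 Ck) // andbT.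
  apply: contraTneq m0 => e; rewrite -leqNgt -tJ -e -km.
  by rewrite mdeg_topdeg ?mcoeff_msupp.
(* Points of degree less than [dg] are below the new line by the choice of c'; the others because
   they are below the old one and c' < c. *)
have bC' : below c' (j0 + c' * dg%:R) C.
  move=> j k' Cj; have [lt|le] := ltnP (mdeg k') dg.
    have := slmax' _ _ Cj lt; rewrite -/c' /sl /= ler_pdivrMr ?gap //; lra.
  have := bC _ _ Cj; have : (dg%:R : rat) <= (mdeg k')%:R by rewrite ler_nat.
  rewrite /j0 km; move: (mdeg k')%:R => a ma le1.
  have : 0 <= (c - c') * (a - dg%:R) by rewrite mulr_ge0 ?subr_ge0 // ltW.
  lra.
have [Q lQ] := leading_form_exists c' (j0 + c' * dg%:R).
exists c', (j0 + c' * dg%:R), Q, k1; split=> //; first by rewrite c'0.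
rewrite !mcoeff_msupp !lQ km addrK -ej1; split=> //.
by rewrite neq_ltn k1m.
Qed.

End Polygon.

(** * Terminal series *)

Section SeriesSolution.
Variables (F : fieldType) (dx dy : F -> F).
Hypothesis dxP : derivation dx.
Hypothesis dyP : derivation dy.
Implicit Types (P T : lpdo F) (g : seq (rat * F)) (H : rat -> F).

Local Notation conj := (conj_coef dx dy).
Local Notation keys := (keys dx dy).

Definition op_app P (a : F) : F :=
  \sum_(m <- msupp P) P@_m * iter (m ord0) dx (iter (m ord_max) dy a).

Lemma op_app_mlin P a :
  op_app P a =
  mlin (fun m => iter (m ord0) dx (iter (m ord_max) dy a) : F^o) P.
Proof. by []. Qed.

Lemma op_app0 P : op_app P 0 = 0.
Proof.
have it d k : derivation d -> iter k d (0 : F) = 0.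
  by move=> dP; elim: k => //= k ->; apply: derivation0.
by rewrite /op_app big1 // => m _; rewrite !it ?mulr0.
Qed.

Lemma series_app_conj T g H s :
  series_app dx dy T g H s =
  \sum_(j <- keys T g) op_app (conj T g j) (H (s - j)).
Proof.
pose W := (rat -> F^o).
pose D (d : F -> F) (w : W) : W := fun r => d (w r).
pose tau i (w : W) : W := fun r => w (r - i).
have DD d : derivation d -> {morph D d : u v / u + v}.
  by move=> [dD _] u v; apply: boolp.funext => r; apply: dD.
have DZ d : derivation d -> forall a u, D d (a *: u) = d a *: u + a *: D d u.
  by move=> [_ dM] a u; apply: boolp.funext => r; apply: dM.
have tD i : {morph tau i : u v / u + v} by [].
have tZ i a u : tau i (a *: u) = a *: tau i u by [].
have tt i j u : tau i (tau j u) = tau (j + i) u.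
  by apply: boolp.funext => r; rewrite /tau opprD addrA [in LHS]addrAC.
have t0 u : tau 0 u = u by apply: boolp.funext => r; rewrite /tau subr0.
have Dt d i u : D d (tau i u) = tau i (D d u) by [].
have itD d k (w : W) r : iter k (D d) w r = iter k d (w r).
  by elim: k r => //= k IH r; rewrite {1}/D IH.
have twE d (w : W) : twisted tau d (D d) g w = series_der d g w.
  apply: boolp.funext => r; rewrite /twisted /series_der.
  change (D d w r + (\sum_(x <- g) d x.2 *: tau x.1 w) r =
    d (w r) + \sum_(x <- g) d x.2 * w (r - x.1)).
  by congr (_ + _); rewrite sum_funE.
have itE d k w : iter k (twisted tau d (D d) g) w = iter k (series_der d g) w.
  by elim: k => //= k ->; apply: twE.
transitivity (twisted_act dx dy (D dx) (D dy) tau g T (H : W) s).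
  rewrite /series_app /twisted_act sum_funE; apply: eq_bigr => m _.
  by rewrite !itE.
rewrite (conj_act (DD _ dxP) (DD _ dyP) (DZ _ dxP) (DZ _ dyP) tD tZ tt t0) //.
rewrite /fam_act sum_funE.
rewrite -(@sum_fam_act F F^o (conj_list dx dy T g)
  (fun P r => op_app P (H r)) s); last first.
  by move=> r a P Q; rewrite !op_app_mlin linearP.
apply: eq_bigr => p _.
rewrite /act /mlin sum_funE /op_app; apply: eq_bigr => m _.
change (p.2@_m * iter (m ord0) (D dx) (iter (m ord_max) (D dy) (tau p.1 H)) s =
  p.2@_m * iter (m ord0) dx (iter (m ord_max) dy (tau p.1 H s))).
by rewrite !itD.
Qed.

Lemma denominator_int g x : x \in g ->
  x.1 * (denominator g)%:R \is a Num.int.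
Proof.
move=> xg; have [k ->] : exists k, denominator g = (k * `|denq x.1|)%N.
  apply/dvdnP; rewrite /denominator; elim: g xg => // y g IH.
  rewrite inE big_cons => /orP[/eqP->|/IH xg]; first exact: dvdn_lcml.
  exact/(dvdn_trans xg)/dvdn_lcmr.
rewrite natrM mulrC -mulrA rpredM ?natr_int //.
have -> : (`|denq x.1|%:R : rat) = (denq x.1)%:~R.
  by rewrite -[in RHS](gez0_abs (denq_ge0 _)).
by rewrite mulrC -{1}[x.1]divq_num_den divfK ?intr_int // intr_eq0 denq_neq0.
Qed.

Lemma denominator_gt0 g : (0 < denominator g)%N.
Proof.
rewrite /denominator; elim: g => [|x g IH]; first by rewrite big_nil.
by rewrite big_cons lcmn_gt0 IH absz_gt0 denq_neq0.
Qed.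

Lemma keys_int T g j : j \in keys T g -> j * (denominator g)%:R \is a Num.int.
Proof.
apply: (keys_in (S := fun j => j * (denominator g)%:R \is a Num.int)).
- by rewrite mul0r rpred0.
- by move=> i k ii ik; rewrite mulrDl rpredD.
by move=> x; apply: denominator_int.
Qed.

Hypothesis closedF : differentially_closed dx dy.
Hypothesis DF : differential_field dx dy.
Hypothesis Fchar : [pchar F] =i pred0.

(** The coefficient of G^(J - N/q) is T_J h_N plus terms in h_i with i < N, as the other exponents
    are at least 1/q less than J. The non-zero operator T_J is onto, and having positive order it
    annihilates some h_0 != 0. *)
Lemma terminal_solution T g J : conj T g J != 0 ->
  (forall i, conj T g i != 0 -> i <= J) -> (0 < topdeg (conj T g J))%N ->
  exists h : nat -> F, [/\ h 0%N != 0,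
    dpoly_eval dx dy id (fun i => if i == ind_h then h 0%N else 0)
      (expand_coef dx dy T g J 0) = 0
    & is_solution dx dy T g (frac_series 0 (denominator g) h)].
Proof.
move=> CJ maxJ tJ; set q := denominator g.
have solve r : exists a, op_app (conj T g J) a = r.
  have [a [ea _]] := @linear_solution F dx dy DF closedF F idfun Fchar _ r CJ.
  by exists a.
have [sol solP] := boolp.choice solve.
have [h0 [eh0 h00]] : exists h, op_app (conj T g J) h = 0 /\ h != 0.
  have [a [ea na]] := @linear_solution F dx dy DF closedF F idfun Fchar _ 0 CJ.
  by exists a; split=> //; apply: na; move: tJ; rewrite /topdeg -subn1 subn_gt0.
pose rest (h : nat -> F) N := \sum_(j <- keys T g | j != J)
  op_app (conj T g j) (frac_series 0 q h (J - N%:R / q%:R - j)).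
(* [hs N] is correct at the indices up to [N] only; [h] takes the diagonal values. *)
pose hs := fix hs N : nat -> F := if N is N'.+1 then
  fun i => if i == N'.+1 then sol (- rest (hs N') N'.+1) else hs N' i
  else fun=> h0.
pose h N := hs N N.
have hsE N i : (i <= N)%N -> hs N i = h i.
  elim: N => [|N IH]; first by rewrite leqn0 => /eqP->.
  rewrite leq_eqVlt => /orP[/eqP-> //|lt].
  by rewrite /= ltn_eqF // IH.
have q0 : (q%:R : rat) != 0 by rewrite pnatr_eq0 -lt0n denominator_gt0.
have qgt0 : 0 < (q%:R : rat) by rewrite ltr0n denominator_gt0.
have frac0 (f : nat -> F) s : s * q%:R > 0 -> frac_series 0 q f s = 0.
  move=> s0; rewrite /frac_series sub0r mulNr; case: ifP => //.
  rewrite natrEint => /andP[_]; by rewrite oppr_ge0 leNgt s0.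
have fracN (f : nat -> F) s N : s * q%:R = - N%:R -> frac_series 0 q f s = f N.
  by move=> es; rewrite /frac_series sub0r mulNr es opprK natr_nat natrK.
have gap j : j \in keys T g -> conj T g j != 0 -> j != J ->
    exists l, (0 < l)%N /\ (J - j) * q%:R = l%:R.
  move=> jk Cj nJ; have lt : j < J by rewrite lt_neqAle nJ maxJ.
  have /natrP[l el] : (J - j) * q%:R \is a Num.nat.
    rewrite natrEint; apply/andP; split; last first.
      by rewrite mulr_ge0 ?subr_ge0 ?maxJ ?ler0n.
    by rewrite mulrBl rpredB // (keys_int (T := T)) // conj_keys.
  exists l; split=> //; rewrite -(ltr0n rat) -el mulr_gt0 ?subr_gt0 //.
have eqN N : op_app (conj T g J) (h N) + rest h N = 0.
  case: N => [|N].
    rewrite /h /= eh0 add0r /rest big1_seq // => j /= /andP[nJ jk].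
    have [->|Cj] := eqVneq (conj T g j) 0; first by rewrite /op_app msupp0 big_nil.
    have [l [l0 el]] := gap _ jk Cj nJ.
    rewrite frac0 ?op_app0 // mul0r subr0 el ltr0n //.
  rewrite {1}/h /= eqxx solP /rest addrC; apply/eqP; rewrite subr_eq0; apply/eqP.
  rewrite big_seq_cond [RHS]big_seq_cond; apply: eq_bigr => j /andP[jk nJ].
  have [->|Cj] := eqVneq (conj T g j) 0; first by rewrite /op_app msupp0 !big_nil.
  have [l [l0 el]] := gap _ jk Cj nJ.
  have es : (J - N.+1%:R / q%:R - j) * q%:R = l%:R - N.+1%:R.
    by rewrite -el !mulrBl divfK //; ring.
  have [le|lt] := leqP l N.+1.
    rewrite !(fracN _ _ (N.+1 - l)%N) ?es ?natrB ?opprB // hsE //.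
    by rewrite leq_subLR -add1n leq_add2r.
  by rewrite !frac0 // es subr_gt0 ltr_nat.
exists h; split=> //.
  rewrite (expand_coefE dxP dyP) (psi0 dxP dyP) -[id]/(idfun : F -> F).
  by rewrite dpoly_eval_lin eqxx.
move=> s; rewrite series_app_conj.
rewrite (bigD1_seq J) ?undup_uniq ?conj_keys //=.
(* Exponents that are not in J + Z/q do not occur in the series; those greater than J receive no
   term from it. *)
have [sJ|sJ] := boolP ((J - s) * q%:R \is a Num.int); last first.
  have fr j : j \in keys T g -> frac_series 0 q h (s - j) = 0.
    move=> jk; rewrite /frac_series; case: ifP => // hn; case/negP: sJ.
    have -> : (J - s) * q%:R = (0 - (s - j)) * q%:R + (J - j) * q%:R by ring.
    apply: rpredD; first by move: hn; rewrite natrEint => /andP[].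
    by rewrite mulrBl rpredB // (keys_int (T := T)) // conj_keys.
  rewrite fr ?conj_keys // op_app0 add0r big1_seq // => j /= /andP[_ jk].
  by rewrite fr // op_app0.
have [neg|pos] := ltP ((J - s) * q%:R) 0.
  have fr j : conj T g j != 0 -> frac_series 0 q h (s - j) = 0.
    move=> Cj; apply: frac0.
    have le : (j - s) * q%:R <= (J - s) * q%:R by rewrite ler_pM2r // lerD2r maxJ.
    by have := le_lt_trans le neg; rewrite -opprB mulNr oppr_lt0.
  rewrite fr // op_app0 add0r big1_seq // => j _.
  have [->|Cj] := eqVneq (conj T g j) 0; first by rewrite /op_app msupp0 big_nil.
  by rewrite fr // op_app0.
have /natrP[N eN] : (J - s) * q%:R \is a Num.nat by rewrite natrEint sJ.
have es : s = J - N%:R / q%:R by rewrite -eN mulfK //; ring.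
rewrite (fracN h (s - J) N); last by rewrite -eN; ring.
by rewrite es; apply: eqN.
Qed.

End SeriesSolution.

(** * The tree of the procedure *)

Lemma pihomog_coef (n : nat) (R : nzRingType) (p : {mpoly R[n]}) d m :
  (pihomog mdeg d p)@_m = if mdeg m == d then p@_m else 0.
Proof.
rewrite pihomogE raddf_sum /=.
have [mp|mp] := boolP (m \in msupp p); last first.
  rewrite (memN_msupp_eq0 mp) if_same big1_seq // => k /andP[_ kp].
  rewrite mcoeffZ mcoeffX; case: eqP kp mp => [->->//|_ _ _].
  by rewrite mulr0.
rewrite -big_filter; case: eqP => [em|nm].
  rewrite (bigD1_seq m) ?filter_uniq ?msupp_uniq ?mem_filter ?em ?eqxx //=.
  rewrite mcoeffZ mcoeffX eqxx mulr1 big1 ?addr0 // => k /negPf km.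
  by rewrite mcoeffZ mcoeffX km mulr0.
rewrite big1_seq // => k; rewrite mem_filter => /andP[_ /andP[/eqP ek _]].
rewrite mcoeffZ mcoeffX; case: eqP => [ekm|]; rewrite ?mulr0 //.
by case: nm; rewrite -ekm.
Qed.

(* In p^m w, with p = p_0 + p_1, the two lowest homogeneous components are
   p_0^m w and m p_0^(m-1) p_1 w. *)
Lemma adjacent_degrees (F : fieldType) (p w : {mpoly F[2]}) m :
  [pchar F] =i pred0 -> topdeg p = 1%N -> p \isn't homog mdeg ->
  w \is homog mdeg -> w != 0 -> (0 < m)%N ->
  exists k k', [/\ k \in msupp (p ^+ m * w), k' \in msupp (p ^+ m * w)
                 & mdeg k = (mdeg k').+1].
Proof.
move=> Fchar p1 nhp /homogP[d hw] w0 m0.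
have ep : p = pihomog mdeg 0 p + pihomog mdeg 1 p.
  have sp : (msize p <= 2)%N by move: p1; rewrite /topdeg; case: (msize p) => [|[|[]]].
  by rewrite {1}(pihomog_partitionE sp) !big_ord_recl big_ord0 addr0.
set p0 := pihomog mdeg 0 p in ep; set p1' := pihomog mdeg 1 p in ep.
have h0 : p0 \is 0.-homog by apply: pihomogP.
have h1 : p1' \is 1.-homog by apply: pihomogP.
have n0 : p0 != 0.
  by apply: contraNneq nhp => e; apply/homogP; exists 1%N; rewrite ep e add0r.
have n1 : p1' != 0.
  by apply: contraNneq nhp => e; apply/homogP; exists 0%N; rewrite ep e addr0.
have term i : (p0 ^+ (m - i) * p1' ^+ i) * w \is (i + d).-homog.
  apply: dhomogM hw; have := dhomogM (dhomogMn (m - i) h0) (dhomogMn i h1).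
  by rewrite mul0n mul1n add0n.
have comp (i : nat) : (i <= m)%N ->
    pihomog mdeg (i + d) (p ^+ m * w) = (p0 ^+ (m - i) * p1' ^+ i) * w *+ 'C(m, i).
  move=> im; rewrite ep exprDn mulr_suml linear_sum /=.
  rewrite (bigD1 (Ordinal (im : (i < m.+1)%N))) //= big1 => [|j nj].
    by rewrite addr0 mulrnAl linearMn /= pihomog_dE ?term.
  rewrite mulrnAl linearMn /= (pihomog_ne0 _ (term j)) ?mul0rn //.
  by rewrite eqn_add2r eq_sym; apply: contraNneq nj => e; apply/eqP/val_inj.
have nz (i : nat) : (i <= m)%N -> (i <= 1)%N ->
    exists2 k, k \in msupp (p ^+ m * w) & mdeg k = (i + d)%N.
  move=> im i1; have : pihomog mdeg (i + d) (p ^+ m * w) != 0.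
    have nat0 : ('C(m, i)%:R : F) != 0.
      by rewrite ((pcharf0P F).1 Fchar) -lt0n bin_gt0.
    rewrite comp // -[_ *+ _]mulr_natl -(rmorph_nat (@mpolyC 2 F)).
    by rewrite !mulf_neq0 ?expf_neq0 // mpolyC_eq0.
  move=> /topdeg_mem[k + _]; rewrite mcoeff_msupp pihomog_coef.
  by case: ifP => [/eqP ek nk|_ /eqP//]; exists k; rewrite ?mcoeff_msupp.
have [k kq ek] := nz 1%N m0 isT; have [k' kq' ek'] := nz 0%N (leq0n m) isT.
by exists k, k'; rewrite ek ek' add1n add0n.
Qed.

Section Node.
Variables (F : fieldType) (dx dy : F -> F).
Hypothesis Fchar : [pchar F] =i pred0.
Hypothesis DF : differential_field dx dy.
Hypothesis closedF : differentially_closed dx dy.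
Implicit Types (T : lpdo F) (g : seq (rat * F)) (Q : {mpoly F[2]}) (c M : rat).

Local Notation conj := (conj_coef dx dy).

Let dxP : derivation dx. Proof. by case: DF. Qed.
Let dyP : derivation dy. Proof. by case: DF. Qed.
Let Froots : has_roots F. Proof. exact: closed_has_roots Fchar DF closedF. Qed.

(* The leading form of the support on the line of slope c = s_k; the edges of
   smaller slope lie above the monomials of lowest degree of Q. *)
Definition node T g c M Q : Prop :=
  [/\ 0 < c, (last (0, 0) g).1 = c, forall x, x \in g -> 0 < x.1,
      below c M (conj T g) & [/\ leading_form c M (conj T g) Q, Q != 0
      & (0 < lowdeg Q)%N]].

(** Convexity: a point below the line of slope c, but on or beyond the line of smaller slope c'
    through a point of it, has at most the degree of that point. *)
Lemma slope_degrees T g c M Q c' j k k' : leading_form c M (conj T g) Q ->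
  below c M (conj T g) ->
  k \in msupp Q -> c' < c -> (conj T g j)@_k' != 0 ->
  M - c * (mdeg k)%:R + c' * (mdeg k)%:R <= j + c' * (mdeg k')%:R ->
  (mdeg k' <= mdeg k)%N.
Proof.
move=> lQ bC kQ c'c Cj le; have le1 := bC _ _ Cj.
rewrite -(ler_nat rat) -(ler_pM2l (_ : 0 < c - c')) ?subr_gt0 //; lra.
Qed.

Lemma edge_degrees T g c M Q c' M' Q' : leading_form c M (conj T g) Q ->
  below c M (conj T g) -> Q != 0 -> c' < c ->
  leading_form c' M' (conj T g) Q' -> below c' M' (conj T g) -> Q' != 0 ->
  (topdeg Q' <= lowdeg Q)%N.
Proof.
move=> lQ bC Q0 c'c lQ' bC' Q'0.
have [k kQ <-] := lowdeg_mem Q0; have [k' kQ' <-] := topdeg_mem Q'0.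
have Ck' := kQ'; rewrite mcoeff_msupp lQ' in Ck'.
apply: (slope_degrees lQ bC kQ c'c Ck'); rewrite subrK.
by apply: bC'; move: kQ; rewrite mcoeff_msupp lQ.
Qed.

Lemma right_edge_degree T g c M Q J : leading_form c M (conj T g) Q ->
  below c M (conj T g) -> Q != 0 -> 0 < c ->
  conj T g J != 0 -> (forall i, conj T g i != 0 -> i <= J) ->
  (topdeg (conj T g J) <= lowdeg Q)%N.
Proof.
move=> lQ bC Q0 c0 CJ maxJ.
have [k kQ <-] := lowdeg_mem Q0; have [k' kC' <-] := topdeg_mem CJ.
have Ck' := kC'; rewrite mcoeff_msupp in Ck'.
apply: (slope_degrees lQ bC kQ c0 Ck'); rewrite !mul0r !addr0.
apply: maxJ; have := kQ; rewrite mcoeff_msupp lQ.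
exact: coef_neq0.
Qed.

Lemma node_coef T g c M Q : node T g c M Q -> exists j, conj T g j != 0.
Proof.
case=> _ _ _ _ [lQ Q0 _]; have [k kQ _] := topdeg_mem Q0.
exists (M - c * (mdeg k)%:R); move: kQ; rewrite mcoeff_msupp lQ.
exact: coef_neq0.
Qed.

Lemma symb_neq0 T n : has_order T n -> symb T != 0 /\ topdeg (symb T) = n.
Proof.
move=> oT; have T0 : T != 0 by rewrite -msize_poly_eq0 oT.
have [k kT ek] := topdeg_mem T0.
have kS : k \in msupp (symb T).
  by rewrite mcoeff_msupp pihomog_coef ek eqxx -mcoeff_msupp.
have S0 : symb T != 0 by apply: contraTneq kS => ->; rewrite msupp0.
split=> //; have [k' + <-] := topdeg_mem S0.
by rewrite mcoeff_msupp pihomog_coef oT /=; case: ifP => [/eqP|_ /eqP].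
Qed.

(** The starting step is a continuing step from the empty [g], on the line j + t = n of slope 1,
    whose leading form is the symbol. The lowest degree after the shift is the multiplicity of [a]
    in the symbol. *)
Lemma node_start T n a f : has_order T n ->
  a \is 1.-homog -> mleadc a = 1 -> mdivides a (symb T) ->
  a.@[gradient dx dy f] = 0 -> (dx f, dy f) != (0, 0) ->
  let Q := mshift (gradient dx dy f) (symb T) in
  [/\ node T [:: (1, f)] 1 n%:R Q, mirreducible a, topdeg a = 1%N,
      lowdeg a = 1%N & mdivides (a ^+ lowdeg Q) (symb T)].
Proof.
move=> oT ha a1 aT av fv Q; have [S0 tS] := symb_neq0 oT.
have a0 : a != 0 by apply: contra_eq_neq a1 => ->; rewrite mleadc0 eq_sym oner_eq0.
have vi : exists i, gradient dx dy f i != 0.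
  move: fv; rewrite xpair_eqE negb_and => /orP[h|h].
    by exists ord0; rewrite /gradient eqxx.
  by exists ord_max.
have hS : symb T \is homog mdeg by apply/homogP; exists (msize T).-1; apply: pihomogP.
have [m [w [eS m0 wv [i ai]]]] := linear_factor_spec Froots Fchar S0 hS ha a0 aT av vi.
have [w0 am0] : w != 0 /\ a ^+ m != 0.
  by apply/andP; rewrite andbC -negb_or -mulf_eq0 -eS.
have lQ : lowdeg Q = m.
  rewrite /Q eS rmorphM rmorphXn lowdegM ?expf_neq0 ?mshift_neq0 //.
  rewrite lowdegX ?mshift_neq0 // (lowdeg_mshift1 av ai) lowdeg_mshift0 //.
  by rewrite muln1 addn0.
have ta := linear_topdeg ha a0.
split=> //; first 1 last.
- exact: mirreducible1.
- apply: etrans ta; apply/eqP; rewrite -homog_degP //.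
  by apply/homogP; exists 1%N.
- by rewrite lQ; exists w; rewrite mulrC.
have b0 : below 1 n%:R (conj T [::]).
  move=> j k; rewrite (conj_nil dxP dyP); case: ifP => [/eqP->|_]; last first.
    by rewrite mcoeff0 eqxx.
  move=> Tk; rewrite add0r mul1r ler_nat; have := oT.
  by rewrite /has_order => e; rewrite -ltnS -e msize_mdeg_lt // mcoeff_msupp.
have l0 : leading_form 1 n%:R (conj T [::]) (symb T).
  move=> k; rewrite (conj_nil dxP dyP) mul1r subr_eq0 eqr_nat pihomog_coef oT /= eq_sym.
  by case: ifP => // _; rewrite mcoeff0.
have [b1 l1] := conj_leading dxP dyP f ltr01 b0 l0.
split=> //; first by move=> x; rewrite inE => /eqP->.
by split=> //; rewrite ?mshift_neq0 ?lQ.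
Qed.

(** With Q = p^m w as in [generic_case_spec], the shift of p has lowest degree 1 and that of w has
    lowest degree 0, so that [lowdeg Q'] is m. *)
Lemma node_continue T g c0 M0 Q0 c M Q p f : node T g c0 M0 Q0 ->
  edge_poly dx dy T g c M Q -> 0 < c < c0 ->
  generic_case Q p (gradient dx dy f) ->
  let Q' := mshift (gradient dx dy f) Q in
  [/\ node T (rcons g (c, f)) c M Q', (topdeg Q <= lowdeg Q0)%N,
      [/\ mirreducible p, p \isn't homog mdeg & mdivides (p ^+ lowdeg Q') Q]
    & (2 * lowdeg Q' <= lowdeg Q0)%N \/
      exists k k', [/\ k \in msupp Q, k' \in msupp Q & mdeg k = (mdeg k').+1]].
Proof.
move=> nd eQ /andP[cgt0 clt] gc Q'; have [j0 Cj0] := node_coef nd.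
case: nd => c00 _ gpos bC0 [lQ0 nQ0 _].
have [bC lQ [k [_ [kQ _ _]]]] := edge_poly_leading dxP dyP gpos cgt0 Cj0 eQ.
have nQ : Q != 0 by apply: contraTneq kQ => ->; rewrite msupp0.
have [m [w [[eQm m0 pv wv [i pi]] [irrp nhp dich]]]] := generic_case_spec Froots nQ gc.
have [pm0 w0] : p ^+ m != 0 /\ w != 0.
  by apply/andP; rewrite -negb_or -mulf_eq0 -eQm.
have p0 := nonhomog_neq0 nhp.
have lQ' : lowdeg Q' = m.
  rewrite /Q' eQm rmorphM rmorphXn lowdegM ?expf_neq0 ?mshift_neq0 //.
  rewrite lowdegX ?mshift_neq0 // (lowdeg_mshift1 pv pi) lowdeg_mshift0 //.
  by rewrite muln1 addn0.
have tQ : (topdeg Q <= lowdeg Q0)%N := edge_degrees lQ0 bC0 nQ0 clt lQ bC nQ.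
have [b1 l1] := conj_leading dxP dyP f cgt0 bC lQ.
split=> //.
- split=> //; first by rewrite last_rcons.
    by move=> x; rewrite mem_rcons inE => /orP[/eqP->//|/gpos].
  by split=> //; rewrite ?mshift_neq0 ?lQ'.
- by split=> //; rewrite lQ'; exists w; rewrite mulrC.
rewrite lQ'; case: dich => [le|[tp hw]]; [left|right].
  exact: leq_trans le tQ.
by rewrite eQm; apply: adjacent_degrees.
Qed.

(** As c d q is an integer, the reduced denominator of c divides d q; so does the least common
    multiple of it and q. *)
Lemma denominator_rcons g c f d (q := denominator g) :
  c * d%:R * q%:R \is a Num.int -> (0 < d)%N ->
  (denominator (rcons g (c, f)) <= q * d)%N.
Proof.
move=> ci d0; apply: dvdn_leq; first by rewrite muln_gt0 denominator_gt0.
rewrite /denominator -cats1 big_cat big_seq1 /= dvdn_lcm.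
rewrite -/(denominator g) dvdn_mulr //=.
have /intrP[z ez] := ci.
have eq0 : (`|numq c| * (q * d))%N = (`|z| * `|denq c|)%N.
  have ez2 : numq c * (q * d)%N%:Z = z * denq c.
    apply: (@intr_inj rat); rewrite !rmorphM /= -ez -!pmulrn.
    have : ((denq c)%:~R : rat) != 0 by rewrite intr_eq0 denq_neq0.
    move: ((denq c)%:~R : rat) ((numq c)%:~R : rat) (divq_num_den c) => D N <- D0.
    by field.
  by have /(congr1 absz) := ez2; rewrite !abszM absz_nat.
have : (`|denq c| %| `|numq c| * (q * d))%N by rewrite eq0 dvdn_mull.
by rewrite Gauss_dvdr // coprime_sym coprime_num_den.
Qed.

(* At each step, either lowdeg is halved and the denominator is multiplied by at
   most n, or Q has terms of two consecutive degrees, and then the slope has a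
   denominator dividing the previous ones. *)
Lemma node_run T n b g : has_order T n -> generic_run dx dy T b g ->
  exists c M Q e, [/\ node T g c M Q, (2 ^ e * lowdeg Q <= n)%N
                    & (denominator g <= n ^ e)%N].
Proof.
move=> oT; elim=> [a f ha a1 aT av fv|{}b {}g c M Q p f _ IH eQ cc _ _ gc].
  have [nd _ ta _ dv] := node_start oT ha a1 aT av fv.
  have [S0 tS] := symb_neq0 oT.
  exists 1, n%:R, (mshift (gradient dx dy f) (symb T)), 0%N; split=> //.
    rewrite mul1n -tS; have [+ _] := topdeg_divides S0 dv.
    rewrite topdegX ?ta ?muln1 //.
    by apply: contra_eq_neq a1 => ->; rewrite mleadc0 eq_sym oner_eq0.
  by rewrite /denominator big_seq1.
have [c0 [M0 [Q0 [e [nd le qe]]]]] := IH.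
have ec0 : (last (0, 0) g).1 = c0 by case: nd.
rewrite ec0 in cc.
have [nd' tQ [_ _ dv] dich] := node_continue nd eQ cc gc.
have [j0 Cj0] := node_coef nd; case: nd => _ _ gpos _ [lQ0 nQ0 mQ0].
case/andP: cc => cgt0 clt.
have [bC lQ [k [k' [kQ kQ' kk']]]] := edge_poly_leading dxP dyP gpos cgt0 Cj0 eQ.
have nQ : Q != 0 by apply: contraTneq kQ => ->; rewrite msupp0.
have nhp : p != 0.
  case: gc => fs [b' [m [[_ _ fsP _] pfs _ _ _]]].
  by case: (fsP _ pfs) => -[].
have tl : (lowdeg (mshift (gradient dx dy f) Q) <= lowdeg Q0)%N.
  apply: leq_trans tQ; have [+ _] := topdeg_divides nQ dv.
  rewrite topdegX //; apply: leq_trans; rewrite leq_pmulr //.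
  case: gc => fs [b' [m [[_ _ fsP _] pfs _ _ _]]].
  by have [_ /nonhomog_lt + _] := fsP _ pfs; apply: leq_trans.
have key a : a \in msupp Q -> (M - c * (mdeg a)%:R) * (denominator g)%:R \is a Num.int.
  rewrite mcoeff_msupp lQ => /coef_neq0 Ca.
  by apply: (keys_int (T := T) (dx := dx) (dy := dy)); apply: conj_keys.
(* The points of the edge have abscissas in Z/q, and those of [a'] and [a] differ by c (|a| -
   |a'|). *)
have bound a a' : a \in msupp Q -> a' \in msupp Q -> (mdeg a' < mdeg a)%N ->
    (denominator (rcons g (c, f)) <= denominator g * (mdeg a - mdeg a'))%N.
  move=> aQ aQ' lt; apply: denominator_rcons; last by rewrite subn_gt0.
  rewrite natrB 1?ltnW //.
  have -> : c * ((mdeg a)%:R - (mdeg a')%:R) * (denominator g)%:R =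
    (M - c * (mdeg a')%:R) * (denominator g)%:R -
    (M - c * (mdeg a)%:R) * (denominator g)%:R by ring.
  by rewrite rpredB ?key.
exists c, M, (mshift (gradient dx dy f) Q).
case: dich => [le2|[a [a' [aQ aQ' ea]]]]; [exists e.+1|exists e]; split=> //.
- by rewrite expnSr -mulnA; apply: leq_trans le; rewrite leq_mul2l le2 orbT.
- wlog lt : k k' kQ kQ' kk' / (mdeg k' < mdeg k)%N.
    by move=> W; case: (ltngtP (mdeg k) (mdeg k')) kk' => // lt _;
      [apply: (W k' k)|apply: (W k k')] => //; rewrite ?(ltn_eqF lt) ?(gtn_eqF lt).
  apply: leq_trans (bound _ _ kQ kQ' lt) _; rewrite expnSr leq_mul //.
  apply: leq_trans (leq_subr _ _) _; apply: leq_trans (mdeg_topdeg kQ) _.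
  apply: leq_trans tQ _; apply: leq_trans le.
  by rewrite leq_pmull // expn_gt0.
- by apply: leq_trans le; rewrite leq_mul2l tl orbT.
have := bound _ _ aQ aQ'; rewrite ea subSnn muln1 => /(_ (ltnSn _)).
by move/leq_trans; apply.
Qed.

End Node.

(** * The sum of the multiplicities *)

(** Induction from the top: the interval of the greatest c is removed, and [lo c] becomes the new
    bound for the other intervals and for t. *)
Lemma interval_packing (cs : seq rat) (lo hi : rat -> nat) B t : uniq cs ->
  (t <= B)%N -> {in cs, forall c, t <= lo c <= hi c /\ hi c <= B}%N ->
  {in cs &, forall c c', c' < c -> (hi c' <= lo c)%N} ->
  (\sum_(c <- cs) (hi c - lo c) + t <= B)%N.
Proof.
move en: (size cs) => n; elim: n cs en B => [|n IH] cs en B ucs tB bnd sep.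
  by rewrite (size0nil en) big_nil.
have [c0 c0s] : exists c, c \in cs.
  by exists (head 0 cs); rewrite -nth0 mem_nth // en.
have [c cs_c cmax] := seq_argmax id c0s.
have [/andP[tlo lohi] hiB] := bnd c cs_c.
rewrite (perm_big _ (perm_to_rem cs_c)) big_cons -addnA.
have le : (\sum_(c' <- rem c cs) (hi c' - lo c') + t <= lo c)%N.
  apply: IH; rewrite ?rem_uniq ?size_rem ?en //.
    move=> c'; rewrite (mem_rem_uniq _ ucs) inE => /andP[nc c's].
    have [/andP[tlo' lohi'] _] := bnd c' c's; rewrite tlo' lohi'; split=> //.
    by apply: sep => //; rewrite lt_neqAle nc; apply: cmax.
  by move=> c1 c2 /mem_rem c1s /mem_rem c2s; apply: sep.
by apply: leq_trans (leq_trans (leq_add (leqnn _) le) _) hiB; rewrite subnK.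
Qed.

Lemma sum_by_class (I J : eqType) (f : I -> J) (s : seq I) (V : I -> nat) :
  (\sum_(x <- s) V x = \sum_(j <- undup [seq f x | x <- s])
     \sum_(x <- s | f x == j) V x)%N.
Proof.
under [RHS]eq_bigr do rewrite big_mkcond.
rewrite exchange_big /=; apply: eq_big_seq => x xs.
rewrite (bigD1_seq (f x)) ?undup_uniq ?mem_undup ?map_f //= eqxx.
by rewrite big1 ?addn0 // => j /negPf; rewrite eq_sym => ->.
Qed.

(** A set of branches is read as a tree: [heads] lists the choices at the root, and [tails bs x] the
    continuations of the choice [x]. The empty branch stands for a terminal step at the root. *)
Definition heads (A : eqType) (bs : seq (seq A)) : seq A := undup (pmap ohead bs).
Definition tails (A : eqType) (bs : seq (seq A)) x : seq (seq A) :=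
  [seq behead b | b <- bs & ohead b == Some x].

Lemma mem_heads (A : eqType) (bs : seq (seq A)) x :
  (x \in heads bs) = has (fun b => ohead b == Some x) bs.
Proof.
rewrite mem_undup mem_pmap; apply/mapP/hasP => -[b bsb].
  by move=> e; exists b; rewrite // -e eqxx.
by move/eqP=> <-; exists b.
Qed.

Lemma mem_tails (A : eqType) (bs : seq (seq A)) x b :
  (b \in tails bs x) = (x :: b \in bs).
Proof.
apply/mapP/idP => [[[|y b'] + ->]|xb]; rewrite ?mem_filter //=.
  by move=> /andP[/eqP[->]].
by exists (x :: b); rewrite // mem_filter eqxx.
Qed.

Lemma tails_uniq (A : eqType) (bs : seq (seq A)) x : uniq bs -> uniq (tails bs x).
Proof.
move=> ubs; rewrite map_inj_in_uniq ?filter_uniq // => b b'.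
rewrite !mem_filter => /andP[hb _] /andP[hb' _].
by case: b b' hb hb' => [|y b] [|y' b'] //= /eqP[->] /eqP[->] ->.
Qed.

Lemma sum_by_head (A : eqType) (bs : seq (seq A)) (V : seq A -> nat) : uniq bs ->
  (\sum_(b <- bs) V b = \sum_(x <- heads bs) \sum_(b <- tails bs x) V (x :: b) +
     ([::] \in bs) * V [::])%N.
Proof.
move=> ubs; rewrite (bigID (fun b => ohead b == None)) /= addnC; congr (_ + _)%N.
  transitivity (\sum_(x <- heads bs) \sum_(b <- bs | ohead b == Some x) V b)%N.
    under [RHS]eq_bigr do rewrite big_mkcond.
    rewrite exchange_big big_mkcond /=; apply: eq_big_seq => -[|x b] xbs /=.
      by rewrite big1.
    rewrite (bigD1_seq x) ?undup_uniq ?mem_heads //=.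
      rewrite eqxx big1 ?addn0 // => y /negPf nyx.
      by rewrite (inj_eq Some_inj) eq_sym nyx.
    by apply/hasP; exists (x :: b).
  apply: eq_bigr => x _; rewrite big_map big_filter.
  by apply: eq_bigr => -[|y b] //= /eqP[->].
have [nbs|nbs] := boolP ([::] \in bs).
  rewrite big_mkcond (bigD1_seq [::]) //= mul1n big1 ?addn0 // => b.
  by case: b.
by rewrite mul0n big1_seq // => -[|x b] //= h; case/negP: nbs.
Qed.

Section Multiplicity.
Variables (F : fieldType) (dx dy : F -> F).
Hypothesis Fchar : [pchar F] =i pred0.
Hypothesis DF : differential_field dx dy.
Hypothesis closedF : differentially_closed dx dy.
Implicit Types (T : lpdo F) (g : seq (rat * F)) (Q : {mpoly F[2]}) (c M : rat).

Local Notation conj := (conj_coef dx dy).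
Let dxP : derivation dx. Proof. by case: DF. Qed.
Let dyP : derivation dy. Proof. by case: DF. Qed.
Let Froots : has_roots F. Proof. exact: closed_has_roots Fchar DF closedF. Qed.

(** For a positive slope c, the edge lies on the line of the greatest value of j + c t; so M, and
    with it the edge polynomial, is determined by c. *)
Lemma edge_poly_inj T g c M Q M' Q' c0 M0 Q0 : node dx dy T g c0 M0 Q0 -> 0 < c ->
  edge_poly dx dy T g c M Q -> edge_poly dx dy T g c M' Q' -> Q = Q'.
Proof.
move=> nd c0'; have [j0 Cj0] := node_coef nd; case: nd => _ _ gpos _ _.
move=> /(edge_poly_leading dxP dyP gpos c0' Cj0)[bM lQ [k [_ [kQ _ _]]]].
move=> /(edge_poly_leading dxP dyP gpos c0' Cj0)[bM' lQ' [k' [_ [kQ' _ _]]]].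
have eM : M = M'.
  rewrite !mcoeff_msupp lQ lQ' in kQ kQ'.
  by have := bM _ _ kQ'; have := bM' _ _ kQ; rewrite !subrK; lra.
by apply/mpolyP => m; rewrite lQ lQ' eM.
Qed.

(* The polynomials Q of the edges below the node have terms of degrees in
   pairwise disjoint intervals, and the factors of Q with multiplicity m take
   up at least m of the length of its interval. *)
Lemma children_sum T g c0 M0 Q0 (xs : seq (rat * {mpoly F[2]}))
    (mt : rat * {mpoly F[2]} -> nat) t :
  node dx dy T g c0 M0 Q0 -> uniq xs ->
  {in xs, forall x, exists M Q, [/\ edge_poly dx dy T g x.1 M Q, 0 < x.1 < c0,
     mleadc x.2 = 1, mirreducible x.2
   & x.2 \isn't homog mdeg /\ mdivides (x.2 ^+ mt x) Q]} ->
  t = 0%N \/ (exists J, right_vertical_edge (polygon dx dy T g) J t) ->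
  (\sum_(x <- xs) mt x + t <= lowdeg Q0)%N.
Proof.
move=> nd uxs xsP tP; have [j0 Cj0] := node_coef nd.
have inj := edge_poly_inj nd.
case: nd => c00 _ gpos bC0 [lQ0 nQ0 m0].
have tlow c M Q : leading_form c M (conj T g) Q ->
    below c M (conj T g) -> Q != 0 -> 0 < c -> (t <= lowdeg Q)%N.
  move=> lQ bC nQ c0'; case: tP => [-> //|[J /(right_edge_elim dxP dyP gpos Cj0)]].
  move=> [CJ maxJ -> _]; exact: right_edge_degree lQ bC nQ c0' CJ maxJ.
(* One edge is selected for every slope, with the default (0, 0) where there is none; [inj]
   identifies it with the edges of that slope given by [xsP]. *)
have sel_ex c : exists s : rat * {mpoly F[2]},
    (exists M Q, edge_poly dx dy T g c M Q) -> edge_poly dx dy T g c s.1 s.2.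
  have [[M [Q h]]|nh] := boolp.pselect (exists M Q, edge_poly dx dy T g c M Q).
    by exists (M, Q).
  by exists (0, 0).
have [sel selP] := boolp.choice sel_ex.
pose Qof c := (sel c).2.
pose cs := undup [seq x.1 | x <- xs].
have csP c : c \in cs -> [/\ 0 < c < c0, below c (sel c).1 (conj T g),
    leading_form c (sel c).1 (conj T g) (Qof c) & Qof c != 0].
  rewrite mem_undup => /mapP[x /xsP[M [Q [eQ cc _ _ _]]] ->].
  have eQ' : edge_poly dx dy T g x.1 (sel x.1).1 (sel x.1).2 by apply: selP; exists M, Q.
  have cgt0 : 0 < x.1 by case/andP: cc.
  have [bC lQ [k [_ [kQ _ _]]]] := edge_poly_leading dxP dyP gpos cgt0 Cj0 eQ'.
  by split=> //; apply: contraTneq kQ => e; rewrite -/(Qof x.1) e msupp0.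
rewrite (sum_by_class (fun x => x.1)).
suff span c : c \in cs -> (\sum_(x <- xs | x.1 == c) mt x <=
    topdeg (Qof c) - lowdeg (Qof c))%N.
  apply: (@leq_trans (\sum_(c <- cs) (topdeg (Qof c) - lowdeg (Qof c)) + t)).
    by rewrite leq_add2r big_seq [leqRHS]big_seq; apply: leq_sum.
  apply: interval_packing; first exact: undup_uniq.
  - exact: tlow lQ0 bC0 nQ0 c00.
  - move=> c /csP[/andP[cgt0 clt] bC lQ nQ]; split.
      by rewrite (tlow _ _ _ lQ bC nQ cgt0) low_le_top.
    exact: edge_degrees lQ0 bC0 nQ0 clt lQ bC nQ.
  move=> c c' /csP[/andP[cgt0 clt] bC lQ nQ] /csP[_ bC' lQ' nQ'] lt.
  exact: edge_degrees lQ bC nQ lt lQ' bC' nQ'.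
move=> /csP[_ _ _ nQ].
pose s := [seq (x.2, mt x) | x <- xs & x.1 == c].
have sP : {in s, forall y, [/\ mirreducible y.1, mleadc y.1 = 1
    & mdivides (y.1 ^+ y.2) (Qof c)] /\ y.1 \isn't homog mdeg}.
  move=> y /mapP[x]; rewrite mem_filter => /andP[/eqP xc /xsP] + ->.
  move=> [M [Q [eQ /andP[cgt0 _] x1 irrx [nhx dv]]]] /=; split=> //; split=> //.
  have -> : Qof c = Q; last by [].
  rewrite -xc; apply: (inj _ _ _ _ _ cgt0 _ eQ); apply: selP.
  by exists M, Q.
have us : uniq [seq y.1 | y <- s].
  rewrite -map_comp map_inj_in_uniq ?filter_uniq // => -[a p] [a' p'].
  by rewrite !mem_filter /= => /andP[/eqP-> _] /andP[/eqP-> _] ->.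
have dv := mdivides_prod_coprime Froots us (fun y ys => (sP y ys).1).
have [_ +] := topdeg_divides nQ dv.
have [_ -> ->] := topdeg_prod (fun y ys => nonhomog_neq0 (sP y ys).2).
(* The difference [topdeg - lowdeg] is additive on products and at least 1 for a non-homogeneous
   polynomial, so each factor contributes at least its multiplicity. *)
apply: leq_trans; rewrite leq_subRL; last first.
  rewrite big_seq [leqRHS]big_seq; apply: leq_sum => y /sP[_ nh].
  by rewrite leq_mul2l (ltnW (nonhomog_lt nh)) orbT.
have -> : (\sum_(x <- xs | x.1 == c) mt x = \sum_(y <- s) y.2)%N.
  by rewrite big_map big_filter.
rewrite -big_split /= big_seq [leqRHS]big_seq; apply: leq_sum => y /sP[_ nh].
by rewrite -mulnSr leq_mul2l nonhomog_lt ?orbT.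
Qed.

Lemma represented_rcons (rho : @branch F -> F) b x :
  represented rho (rcons b x) = rcons (represented rho b) (x.1, rho (rcons b x)).
Proof.
rewrite /represented size_rcons mkseqS; congr rcons; last first.
  by rewrite nth_rcons ltnn eqxx take_oversize ?size_rcons.
apply/eq_in_map => k; rewrite mem_iota add0n => /andP[_ lt].
by rewrite nth_rcons lt -cats1 takel_cat.
Qed.

Lemma run_inv T b g : generic_run dx dy T b g ->
  (exists a f, [/\ b = [:: (1, a)], g = [:: (1, f)], a \is 1.-homog,
     mleadc a = 1 & [/\ mdivides a (symb T), a.@[gradient dx dy f] = 0
     & (dx f, dy f) != (0, 0)]]) \/
  (exists b' g' c p f, [/\ b = rcons b' (c, p), g = rcons g' (c, f),
     generic_run dx dy T b' g', mleadc p = 1 &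
     exists M Q, [/\ edge_poly dx dy T g' c M Q, 0 < c < (last (0, 0) g').1
                   & generic_case Q p (gradient dx dy f)]]).
Proof.
case=> [a f ha a1 aT av fv|b' g' c M Q p f run eQ cc _ p1 gc]; [left|right].
  by exists a, f.
by exists b', g', c, p, f; split=> //; exists M, Q.
Qed.

Lemma run_neq_nil T b g : generic_run dx dy T b g -> b != [::].
Proof. by case=> // b' *; rewrite -size_eq0 size_rcons. Qed.

Lemma run_rcons T (rho : @branch F -> F) b x : b != [::] ->
  generic_run dx dy T (rcons b x) (represented rho (rcons b x)) ->
  [/\ generic_run dx dy T b (represented rho b), mleadc x.2 = 1 &
   exists M Q, [/\ edge_poly dx dy T (represented rho b) x.1 M Q,
     0 < x.1 < (last (0, 0) (represented rho b)).1
   & generic_case Q x.2 (gradient dx dy (rho (rcons b x)))]].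
Proof.
rewrite represented_rcons => bn /run_inv[[a [f [e _ _ _ _]]]|].
  by case: b bn e => // y [|z b].
move=> [b' [g' [c [p [f [+ + run p1 ex]]]]]].
move=> /rcons_inj[eb ex'] /rcons_inj[eg [_ ef]].
by subst.
Qed.

Lemma run_prefix T (rho : @branch F -> F) b b' : b != [::] ->
  generic_run dx dy T (b ++ b') (represented rho (b ++ b')) ->
  generic_run dx dy T b (represented rho b).
Proof.
move=> bn; elim/last_ind: b' => [|b' x IH]; first by rewrite cats0.
rewrite -rcons_cat => /run_rcons[|/IH //]; first by case: b bn {IH}.
Qed.

(** Induction on a bound [N] for the lengths. The branches through a child are bounded by its lowest
    degree, and [children_sum] bounds the total over the children together with the terminal edge of
    the node itself. *)
Lemma branches_sum T (rho : @branch F -> F) (mu : @branch F -> nat) (N : nat) b0 c M Q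
    (bs : seq (@branch F)) :
  node dx dy T (represented rho b0) c M Q -> b0 != [::] -> uniq bs ->
  {in bs, forall b, (size b < N)%N /\ exists h,
     generic_solution dx dy T (b0 ++ b) (represented rho (b0 ++ b)) (mu (b0 ++ b)) h} ->
  (\sum_(b <- bs) mu (b0 ++ b) <= lowdeg Q)%N.
Proof.
elim: N b0 c M Q bs => [|N IH] b0 c M Q bs nd b0n ubs bsP.
  by rewrite big1_seq // => b /andP[_ /bsP[]].
rewrite (sum_by_head _ ubs) cats0.
(* The number m is the lowest degree at the child [x], and the corresponding power of the chosen
   factor divides the edge polynomial; it is 0 for an [x] that does not occur. *)
have child x : exists m : nat, x \in heads bs ->
    (exists M' Q', [/\ edge_poly dx dy T (represented rho b0) x.1 M' Q', 0 < x.1 < c,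
       mleadc x.2 = 1, mirreducible x.2
     & x.2 \isn't homog mdeg /\ mdivides (x.2 ^+ m) Q']) /\
    (\sum_(b <- tails bs x) mu (b0 ++ x :: b) <= m)%N.
  have [xh|nxh] := boolP (x \in heads bs); last by exists 0%N.
  have [b xb] : exists b, x :: b \in bs.
    move: xh; rewrite mem_heads => /hasP[[|y b] ybs //= /eqP[<-]].
    by exists b.
  have [_ [h [run _]]] := bsP _ xb.
  have run1 : generic_run dx dy T (rcons b0 x) (represented rho (rcons b0 x)).
    by apply: (@run_prefix _ _ _ b); rewrite ?cat_rcons // -size_eq0 size_rcons.
  have [run0 x1 [M' [Q' [eQ cc gc]]]] := run_rcons b0n run1.
  have ec : (last (0, 0) (represented rho b0)).1 = c by case: nd.
  rewrite ec in cc.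
  have [nd' _ [irrx nhx dv] _] := node_continue Fchar DF closedF nd eQ cc gc.
  rewrite -represented_rcons in nd'.
  exists (lowdeg (mshift (gradient dx dy (rho (rcons b0 x))) Q')) => _; split.
    by exists M', Q'.
  under eq_bigr do rewrite -cat_rcons.
  apply: IH nd' _ (tails_uniq _ ubs) _; first by rewrite -size_eq0 size_rcons.
  by move=> b'; rewrite mem_tails cat_rcons => /bsP[lt ex].
have [mt mtP] := boolp.choice child.
apply: (@leq_trans (\sum_(x <- heads bs) mt x + ([::] \in bs) * mu b0)).
  rewrite leq_add2r big_seq [leqRHS]big_seq.
  by apply: leq_sum => x xh; case: (mtP x xh).
apply: children_sum nd (undup_uniq _) _ _.
  by move=> x xh; case: (mtP x xh).
have [nbs|] := boolP ([::] \in bs); [right|by left].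
have [_ [h [_ [J [re _ _ _]]]]] := bsP _ nbs.
by exists J; rewrite mul1n; rewrite cats0 in re.
Qed.

(** At the root, the linear factors of the symbol take the place of the edges: the branches through
    one of them add up to at most its multiplicity, and the product of these powers divides the
    symbol, of degree [n]. *)
Lemma multiplicity_sum T n (rho : @branch F -> F) (mu : @branch F -> nat)
    (bs : seq (@branch F)) : has_order T n -> uniq bs ->
  {in bs, forall b, exists h,
     generic_solution dx dy T b (represented rho b) (mu b) h} ->
  (\sum_(b <- bs) mu b <= n)%N.
Proof.
move=> oT ubs bsP; have [S0 tS] := symb_neq0 oT.
rewrite (sum_by_head _ ubs).
have -> : ([::] \in bs) = false.
  by apply/negP => /bsP[h [/run_neq_nil]].
rewrite mul0n addn0.
have child x : exists m : nat, x \in heads bs ->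
    [/\ mirreducible x.2, mleadc x.2 = 1, mdivides (x.2 ^+ m) (symb T)
      & topdeg x.2 = 1%N /\ x.1 = 1] /\
    (\sum_(b <- tails bs x) mu (x :: b) <= m)%N.
  have [xh|nxh] := boolP (x \in heads bs); last by exists 0%N.
  have [b xb] : exists b, x :: b \in bs.
    move: xh; rewrite mem_heads => /hasP[[|y b] ybs //= /eqP[<-]].
    by exists b.
  have [h [run _]] := bsP _ xb.
  have run1 : generic_run dx dy T [:: x] (represented rho [:: x]).
    exact: (@run_prefix _ _ _ b).
  have [[a [f [[ex] eg ha a1 [aT av fv]]]]|] := run_inv run1; last first.
    move=> [b' [g' [c [p [f [e _ /run_neq_nil b'n _ _]]]]]].
    by case: b' b'n e => // y [].
  have [nd irra ta _ dv] := node_start Fchar DF closedF oT ha a1 aT av fv.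
  rewrite -eg in nd; rewrite ex.
  exists (lowdeg (mshift (gradient dx dy f) (symb T))) => _; split=> //.
  pose N := (\max_(b <- tails bs x) size b).+1.
  rewrite -ex; apply: (@branches_sum T rho mu N [:: x] _ _ _ _ nd) => //.
    exact: tails_uniq.
  move=> b' b't; split; first by rewrite ltnS leq_bigmax_seq.
  by apply: bsP; rewrite -mem_tails.
have [mt mtP] := boolp.choice child.
apply: (@leq_trans (\sum_(x <- heads bs) mt x)).
  rewrite big_seq [leqRHS]big_seq.
  by apply: leq_sum => x xh; case: (mtP x xh).
pose s := [seq (x.2, mt x) | x <- heads bs].
have sP : {in s, forall y, [/\ mirreducible y.1, mleadc y.1 = 1
    & mdivides (y.1 ^+ y.2) (symb T)] /\ topdeg y.1 = 1%N}.
  by move=> y /mapP[x /mtP[[? ? ? [? _]] _] ->].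
have us : uniq [seq y.1 | y <- s].
  rewrite -map_comp map_inj_in_uniq ?undup_uniq // => -[a p] [a' p'].
  by move=> /mtP[[_ _ _ [_ /= ->]] _] /mtP[[_ _ _ [_ /= ->]] _] ->.
have dv := mdivides_prod_coprime Froots us (fun y ys => (sP y ys).1).
have [+ _] := topdeg_divides S0 dv; rewrite tS; apply: leq_trans.
have [|_ -> _] := @topdeg_prod F s.
  by move=> y /sP[[[]]].
rewrite big_map /= big_seq [leqRHS]big_seq; apply: leq_sum => x xh.
by have [[_ _ _ [-> _]] _] := mtP x xh; rewrite muln1.
Qed.

End Multiplicity.

(** * Termination of the procedure and existence of a solution *)

Section Existence.
Variables (F : fieldType) (dx dy : F -> F).
Hypothesis Fchar : [pchar F] =i pred0.
Hypothesis DF : differential_field dx dy.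
Hypothesis closedF : differentially_closed dx dy.
Implicit Types (T : lpdo F) (g : seq (rat * F)) (Q : {mpoly F[2]}) (c M : rat).

Local Notation conj := (conj_coef dx dy).
Let dxP : derivation dx. Proof. by case: DF. Qed.
Let dyP : derivation dy. Proof. by case: DF. Qed.

(** From 2^e <= n follows e < n, so every denominator is at most n^n and divides (n^n)!, a common
    multiple that does not depend on the run. *)
Lemma slope_nat T n b g c M Q : has_order T n -> generic_run dx dy T b g ->
  node dx dy T g c M Q -> c * ((n ^ n)`!)%:R \is a Num.nat.
Proof.
move=> oT run nd.
have [c' [M' [Q' [e [nd' le qe]]]]] := node_run Fchar DF closedF oT run.
case: nd nd' => c0 ec _ _ _ [_ _ _ _ [_ _ lQ']].
have en : (e < n)%N.
  apply: leq_trans (ltn_expl e (leqnn 2)) _.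
  by apply: leq_trans le; rewrite leq_pmulr.
rewrite natrEint mulr_ge0 ?ler0n ?ltW // andbT.
have cg : last (0, 0) g \in g.
  by case: g ec {run qe} => [e0|x g _]; [rewrite -e0 ltxx in c0|rewrite /= mem_last].
have /dvdnP[k ->] : (denominator g %| (n ^ n)`!)%N.
  rewrite dvdn_fact // denominator_gt0; apply: leq_trans qe _.
  by rewrite leq_pexp2l ?(leq_trans _ en) // ltnW.
rewrite natrM mulrCA rpredM ?natr_int // -ec.
exact: denominator_int.
Qed.

(* The denominators are at most n ^ n along all runs, so that c (n ^ n)! runs
   through a decreasing sequence of natural numbers. *)
Lemma complete_run T n (k : nat) b g c M Q : has_order T n ->
  generic_run dx dy T b g -> node dx dy T g c M Q ->
  c * ((n ^ n)`!)%:R = k%:R ->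
  exists b g t h, generic_solution dx dy T b g t h.
Proof.
move=> oT; elim/ltn_ind: k b g c M Q => k IH b g c M Q run nd ck.
have [j0 Cj0] := node_coef nd.
have [c0 ec gpos bC [lQ nQ mQ]] := nd.
have j0s : j0 \in [seq j <- keys dx dy T g | conj T g j != 0].
  by rewrite mem_filter Cj0; apply: conj_keys.
have [J] := seq_argmax id j0s; rewrite mem_filter => /andP[CJ _] maxJs.
have maxJ i : conj T g i != 0 -> i <= J.
  by move=> Ci; apply: maxJs; rewrite mem_filter Ci; apply: conj_keys.
(* If T_J has positive order, the last column is a vertical edge and the procedure may stop; if not,
   the polygon must descend to it along another edge, of smaller slope. *)
have [tJ|] := posnP (topdeg (conj T g J)); last first.
  move=> tJ; have [h [h0 hB hs]] := terminal_solution dxP dyP closedF DF Fchar CJ maxJ tJ.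
  exists b, g, (topdeg (conj T g J)), h; split=> //; exists J; split=> //.
  exact: right_edge_intro.
have [m mQ' em] := lowdeg_mem nQ.
have Cm := mQ'; rewrite mcoeff_msupp lQ in Cm.
have [|c' [M' [Q' [m' [cc bC' lQ' [m'Q mQ'' ne]]]]]] :=
  next_edge c0 bC em mQ Cm _ CJ maxJ tJ.
  by move=> m' Cm'; apply: lowdeg_mdeg; rewrite mcoeff_msupp lQ.
have [cgt0 clt] : 0 < c' /\ c' < c by apply/andP.
have eQ := edge_poly_intro dxP dyP gpos cgt0 bC' lQ' mQ'' m'Q ne.
have nhQ : Q' \isn't homog mdeg.
  apply: contra ne => /homogP[d /dhomogP hd].
  by rewrite (hd _ m'Q) (hd _ mQ'').
have [p [f [p1 gc Qf]]] := generic_choice_exists Fchar DF closedF nhQ.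
have run' : generic_run dx dy T (rcons b (c', p)) (rcons g (c', f)).
  by apply: GenericContinue run eQ _ Qf p1 gc; rewrite ec.
have [nd' _ _ _] := node_continue Fchar DF closedF nd eQ cc gc.
have /natrP[k' ek'] := slope_nat oT run' nd'.
apply: (IH k' _ _ _ _ _ _ run' nd' ek').
by rewrite -(ltr_nat rat) -ek' -ck ltr_pM2r // ltr0n fact_gt0.
Qed.

Lemma generic_solution_exists T n : has_order T n -> (0 < n)%N ->
  exists b g t h, generic_solution dx dy T b g t h.
Proof.
move=> oT n0; have [S0 tS] := symb_neq0 oT.
have hS : symb T \is homog mdeg by apply/homogP; exists (msize T).-1; apply: pihomogP.
have [|a [f [ha a1 aT av fv]]] := start_choice_exists Fchar DF closedF hS.
  by rewrite tS.
have run := GenericStart ha a1 aT av fv.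
have [nd _ _ _ _] := node_start Fchar DF closedF oT ha a1 aT av fv.
have /natrP[k ek] := slope_nat oT run nd.
exact: complete_run oT run nd ek.
Qed.

End Existence.

(** * The numerical bound on the denominator *)

Section Bound.
Import Reals Lra.
Local Open Scope R_scope.

Lemma INR_expn (n e : nat) : INR (expn n e) = pow (INR n) e.
Proof. by elim: e => [|e IH] //=; rewrite expnS -IH -mult_INR. Qed.

(* q <= n^e with e ln 2 <= ln n, and ln 2 > 1/2. *)
Lemma quasipolynomial_boundI (n q e : nat) : leq 2 n -> leq (expn 2 e) n ->
  leq q (expn n e) -> quasipolynomial_bound (INR 4) n q.
Proof.
move=> n2 le_en le_q; rewrite /quasipolynomial_bound (INR_IZR_INZ 4) /=.
have n1 : 2 <= INR n by apply: (le_INR 2); apply/ssrnat.leP.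
have ln0 : 0 < ln (INR n) by rewrite -ln_1; apply: ln_increasing; Lra.lra.
have qn : INR q <= INR n ^ e by rewrite -INR_expn; apply/le_INR/ssrnat.leP.
have en : INR e * ln 2 <= ln (INR n).
  have le2 : 2 ^ e <= INR n by rewrite -[2]/(INR 2) -INR_expn; apply/le_INR/ssrnat.leP.
  rewrite -ln_pow; last Lra.lra.
  case: le2 => [lt|->]; last Lra.lra.
  by apply/Rlt_le/ln_increasing => //; apply: pow_lt; Lra.lra.
apply: Rle_lt_trans qn _; rewrite -Rpower_pow; last Lra.lra.
apply: exp_increasing; have := ln_lt_2; have := pos_INR e => e0 l2.
Lra.nra.
Qed.

End Bound.

Theorem proposition3p1 :
  exists c : Rdefinitions.R,
  forall (F : fieldType) (dx dy : F -> F),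
    [pchar F] =i pred0 ->
    differential_field dx dy ->
    differentially_closed dx dy ->
    kolchin_universal dx dy ->
  forall (n : nat) (T : lpdo F), has_order T n ->
  [/\ (0 < n)%N ->
        exists (b : @branch F) (g : seq (rat * F)) (t : nat)
               (h : nat -> F),
          generic_solution dx dy T b g t h,
      forall (rho : @branch F -> F) (mu : @branch F -> nat)
             (bs : seq (@branch F)),
        uniq bs ->
        (forall b, b \in bs ->
           exists h : nat -> F,
             generic_solution dx dy T b (represented rho b) (mu b) h) ->
        (\sum_(b <- bs) mu b <= n)%N
    & (2 <= n)%N ->
        forall (b : @branch F) (g : seq (rat * F)) (t : nat) (h : nat -> F),
          generic_solution dx dy T b g t h ->
          quasipolynomial_bound c n (denominator g)].
Proof.
(* From e ln 2 <= ln n and ln 2 > 1/2 follows e < 2 ln n for n >= 2; the constant 4 leaves room. *)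
exists (Raxioms.INR 4) => F dx dy Fchar DF closedF _ n T oT; split.
- exact: generic_solution_exists.
- by move=> rho mu bs; apply: multiplicity_sum.
move=> n2 b g t h [run _].
have [c [M [Q [e [nd le qe]]]]] := node_run Fchar DF closedF oT run.
(* The lowest degree at a node is positive, so 2^e itself is at most [n]. *)
apply: (quasipolynomial_boundI n2 _ qe); apply: leq_trans le.
by case: nd => _ _ _ _ [_ _ lQ]; rewrite leq_pmulr.
Qed.
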